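(* For integers $n\ge4$ and $d\ge n$ let $$c(n,d)=\min\left\{\left\lfloor\frac{\tilde s(d-m)}{g_n(m)}\right\rfloor: 0\le m\le n-2\right\},$$ where $$\tilde s(d)=\begin{cases}\frac1{24}d^2+\frac1{12}d&\text{if }d\equiv 0,4\pmod 6\\ \frac1{24}d^2+\frac16d-\frac5{24}&\text{if }d\equiv 1\pmod 6\\ \frac1{24}d^2+\frac1{12}d-\frac13&\text{if }d\equiv 2\pmod 6\\ \frac1{24}d^2+\frac16d+\frac18&\text{if }d\equiv 3,5\pmod 6\end{cases}$$ and $$g_n(m)=\begin{cases}n-3&\text{if }m=0\text{ or }m=n-3\\ n-4&\text{if }n\ge5\text{ and }m=1\\ 1&\text{if }m=n-2\\ m(n-m-3)&\text{if }2\le m\le n-4.\end{cases}$$ If $d\ge n\ge 4$ and $s$ is a positive integer with $s\le 2^{n-3}c(n,d)$, then $\sigma_s(\mathrm{Split}_d(\mathbb P^n))$ is nondefective.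
   Context: $\Bbbk$ is an algebraically closed field of characteristic zero, $R=\Bbbk[x_0,\dots,x_n]$, and $R_d$ is the vector space of degree $d$ forms in $R$, so $\mathbb P R_d=\mathbb P^{\binom{n+d}{d}-1}$. The variety of completely decomposable forms is $\mathrm{Split}_d(\mathbb P^n)=\{[f]\in\mathbb P R_d: f \text{ is a product of } d \text{ linear forms}\}$; it has dimension $dn$. For a projective variety $X\subset\mathbb P^N$, the $s$th secant variety $\sigma_s(X)$ is the Zariski closure of the union of all $(s-1)$-planes spanned by $s$ generic points of $X$. The secant variety $\sigma_s(\mathrm{Split}_d(\mathbb P^n))$ is called nondefective if $\dim\sigma_s(\mathrm{Split}_d(\mathbb P^n))=\min\{s(dn+1),\binom{n+d}{d}\}-1$, and defective otherwise. *)

(* Defs.v *)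
From HB Require Import structures.
From mathcomp Require Export all_boot all_order all_algebra.
From mathcomp Require Export classical_sets.
From mathcomp Require Export mpoly.

Set Implicit Arguments.
Unset Strict Implicit.
Unset Printing Implicit Defensive.

Import Order.TTheory GRing.Theory Num.Theory.

Local Open Scope ring_scope.
Local Open Scope classical_set_scope.

Section ProjectiveSpace.
Variables (K : fieldType) (V : vectType K).

Definition proj_space := {L : {vspace V} | \dim L == 1%N}.

(* The value at [v] of a polynomial in the coordinates of [V]; the basis is
   immaterial, since a change of basis preserves homogeneous polynomials. *)
Definition eval_coord (p : {mpoly K[\dim {:V}]}) (v : V) : K :=
  p.@[fun i => coord (vbasis {:V}) i v].

Definition zero_locus (F : set {mpoly K[\dim {:V}]}) : set proj_space :=
  [set L : proj_space | forall p, F p -> forall v, v \in val L -> eval_coord p v = 0].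

Definition zariski_closed (Z : set proj_space) : Prop :=
  exists2 F : set {mpoly K[\dim {:V}]},
    (forall p, F p -> exists e : nat, p \is e.-homog) & Z = zero_locus F.

Definition zariski_closure (S : set proj_space) : set proj_space :=
  [set L : proj_space | forall Z, zariski_closed Z -> S `<=` Z -> Z L].

Definition irreducible_closed (Z : set proj_space) : Prop :=
  [/\ zariski_closed Z, Z !=set0 &
      forall A B, zariski_closed A -> zariski_closed B ->
        Z `<=` A `|` B -> Z `<=` A \/ Z `<=` B].

Definition irreducible_chain (X : set proj_space) (r : nat) : Prop :=
  exists Z : nat -> set proj_space,
    (forall i, (i <= r)%N -> irreducible_closed (Z i) /\ Z i `<=` X) /\
    (forall i, (i < r)%N -> Z i `<` Z i.+1).

(* Krull dimension; meant for closed [X], whose closed subsets are the Zariski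
   closed sets contained in [X]. *)
Definition has_dimension (X : set proj_space) (r : nat) : Prop :=
  irreducible_chain X r /\ forall r', irreducible_chain X r' -> (r' <= r)%N.

(* The dimension condition says that the [s] points span an [(s-1)]-plane.  No
   further genericity is imposed on them: for irreducible [X] this does not
   change the closure of the union of these planes. *)
Definition secant_variety (s : nat) (X : set proj_space) : set proj_space :=
  zariski_closure
    [set L : proj_space | exists x : 'I_s -> proj_space,
       [/\ forall i, X (x i),
           \dim (\sum_(i < s) val (x i))%VS = s &
           (val L <= \sum_(i < s) val (x i))%VS]].

End ProjectiveSpace.

(* [dhomog n.+1 K d] is the space of degree [d] forms in [n.+1] variables. *)
Definition split_variety (K : fieldType) (n d : nat) :
    set (proj_space (dhomog n.+1 K d)) :=
  [set L | exists (f : dhomog n.+1 K d) (l : 'I_d -> dhomog n.+1 K 1),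
     val L = <[f]>%VS /\
     (f : {mpoly K[n.+1]}) = \prod_(i < d) (l i : {mpoly K[n.+1]})].

Definition nondefective (K : fieldType) (n d s : nat) : Prop :=
  has_dimension (secant_variety s (@split_variety K n d))
    (minn (s * (d * n + 1)) 'C(n + d, d) - 1)%N.

Definition s_tilde (d : nat) : rat :=
  let x : rat := d%:R in
  match (d %% 6)%N with
  | 0 | 4 => 1 / 24 * x ^+ 2 + 1 / 12 * x
  | 1 => 1 / 24 * x ^+ 2 + 1 / 6 * x - 5 / 24
  | 2 => 1 / 24 * x ^+ 2 + 1 / 12 * x - 1 / 3
  | _ => 1 / 24 * x ^+ 2 + 1 / 6 * x + 1 / 8
  end.

(* Only used for [4 <= n] and [m <= n - 2], where the last branch is the case
   [2 <= m <= n - 4]. *)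
Definition g_fun (n m : nat) : nat :=
  (if (m == 0) || (m == n - 3) then n - 3
   else if (5 <= n) && (m == 1) then n - 4
   else if m == n - 2 then 1
   else m * (n - m - 3))%N.

Definition c_term (n d m : nat) : int :=
  Num.floor (s_tilde (d - m) / (g_fun n m)%:R).

(* The default value of the iterated minimum is its term at [m = 0]. *)
Definition c_fun (n d : nat) : int :=
  \big[Order.min/c_term n d 0]_(0 <= m < n.-1) c_term n d m.

(* Main.v *)
(* By Terracini's principle it is enough to find [s] products of [d] linear forms
   whose tangent spaces, of dimension [d * n + 1] each, are independent: a flag of
   linear families of points then gives a chain of irreducible closed subsets of
   the secant variety of the expected length, and counting parameters bounds the
   length of every chain from above.

   Independence is an open condition, so it may be checked at the limit [t = 0] of
   a family of products.  The monomial of exponent [al] is the limit of the product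
   of the forms [x_a + t c x_(b a)], for [al a] distinct values of [c]; the tangent
   spaces degenerate to spans of monomials near [al].  Exponents supported on [N]
   pairs of variables exchanged by [b], in one residue class of a Sidon-type weight
   modulo [2 ^ N - 1], have disjoint sets of such monomials.  Pigeonhole provides
   enough of them when [n >= 5].

   For [n = 4] the points are specialized to the hyperplane [x_4 = 0], with
   induction on [d].  On the hyperplane, monomials [x_0 ^ p x_2 ^ q] with [p] in a
   residue class modulo 5 carry the tangent spaces, and the points of lower degree
   restrict to monomials in a residue class of a weight modulo 4. *)
From HB Require Import structures.
Require Import Defs.
From mathcomp Require Import perm boolp zify ring lra.

Set Implicit Arguments.
Unset Strict Implicit.
Unset Printing Implicit Defensive.

Import Order.TTheory GRing.Theory Num.Theory.

(** Dimension is measured by chains of closed sets, so both bounds rest on algebraic dependence: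
    more polynomials than variables satisfy a relation, while the tangent condition excludes
    relations.

    Restricting exponents to one class divides their number ['C(d + N - 1, N - 1)] by [2 ^ N - 1].
    For large [n] the result is compared with the term of [c_fun] at [m] near [(n - 3) / 2], where
    [m (n - m - 3)] is largest.

    For [n = 4] there are only two pairs, so the number of such exponents is linear in [d], against
    a demand of about [d ^ 2 / 12]. This obstacle forces the specialization: each degree contributes
    about [d / 5] points on the hyperplane, about [d ^ 2 / 10] in all. A point on the hyperplane
    has, besides the tangent vectors lying there, [x_4] times its partial products; after division
    by [x_4] these live one degree lower. The induction hypothesis therefore already contains the
    partial products of the points to be added in the next degree. *)

(** * Polynomials over an infinite field *)

Local Open Scope ring_scope.

Section Infinite.
Variables (K : fieldType).
Hypothesis charK : [pchar K] =i pred0.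

Lemma natr_inj_pchar0 : injective (fun i : nat => i%:R : K).
Proof.
move=> i j /= /eqP; wlog le_ij : i j / (i <= j)%N.
  by move=> H; case: (leqP i j) => [/H//|/ltnW/H{}H]; rewrite eq_sym => /H.
rewrite -(subnK le_ij) natrD -subr_eq0 opprD addrCA subrr addr0 oppr_eq0.
by move/(pcharf0P K): charK => ->; rewrite subnK // subn_eq0 => le_ji; apply/eqP; rewrite eqn_leq le_ij.
Qed.

Lemma poly_nonroot (p : {poly K}) : p != 0 -> exists t : K, p.[t] != 0.
Proof.
move=> p0; set rs := [seq (i%:R : K) | i <- iota 0 (size p)].
have : ~~ all (root p) rs.
  apply/negP => /(max_poly_roots p0); rewrite size_map size_iota ltnn.
  by rewrite map_inj_uniq ?iota_uniq //; [case/(_ isT) | exact: natr_inj_pchar0].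
by case/allPn => t _ pt; exists t.
Qed.

Lemma poly_fun0 (p : {poly K}) : (forall t, p.[t] = 0) -> p = 0.
Proof.
move=> p0; apply/eqP/negPn/negP => /poly_nonroot[t].
by rewrite p0 eqxx.
Qed.

Lemma meval_muni n (p : {mpoly K[n.+1]}) (v : 'I_n.+1 -> K) :
  p.@[v] = (map_poly (meval (fun i => v (widen_ord (leqnSn n) i))) (muni p)).[v ord_max].
Proof.
rewrite muniE mevalE rmorph_sum horner_sum; apply: eq_bigr => m _.
rewrite /= map_polyZ /= map_polyXn hornerZ hornerXn mevalZ mevalX big_ord_recr /= mulrA.
congr (_ * _ * _).
by apply: eq_bigr => i _; rewrite mnmE.
Qed.


Lemma mcoeff_muni n (p : {mpoly K[n.+1]}) (m : 'X_{1..n.+1}) :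
  (muni p)`_(m ord_max)@_[multinom m (widen_ord (leqnSn n) i) | i < n] = p@_m.
Proof.
rewrite muniE coef_sum raddf_sum /= [in RHS](mpolyE p) raddf_sum /=.
apply: eq_bigr => m1 _; rewrite coefZ coefXn mulr_natr mcoeffMn !mcoeffZ !mcoeffX.
rewrite -mulrnAr; congr (_ * _).
have -> : (m1 == m) = ([multinom m1 (widen_ord (leqnSn n) i) | i < n] ==
    [multinom m (widen_ord (leqnSn n) i) | i < n]) && (m ord_max == m1 ord_max).
  apply/eqP/andP => [-> //|[/eqP/mnmP E /eqP Em]]; apply/mnmP => i.
  case: (unliftP ord_max i) => [j|] -> //.
  have -> : lift ord_max j = widen_ord (leqnSn n) j by apply/val_inj; exact: lift_max.
  by have := E j; rewrite !mnmE.
by case: (_ == m1 ord_max); rewrite ?andbF ?andbT ?mulr0n.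
Qed.

Lemma muni_eq0 n (p : {mpoly K[n.+1]}) : muni p = 0 -> p = 0.
Proof. by move=> p0; apply/mpolyP => m; rewrite -mcoeff_muni p0 coef0 !mcoeff0. Qed.

Lemma mpoly_nonroot n (p : {mpoly K[n]}) : p != 0 -> exists v, p.@[v] != 0.
Proof.
elim: n p => [|n IHn] p p0.
  exists (fun=> 0); apply: contra p0; rewrite -[p]mpolyKC mevalC => /eqP->.
  by rewrite raddf0.
have mp0 : muni p != 0 by apply: contra p0 => /eqP/muni_eq0->.
have [v pv] : exists v, (lead_coef (muni p)).@[v] != 0.
  by apply: IHn; rewrite lead_coef_eq0.
have qn0 : map_poly (meval v) (muni p) != 0.
  apply: contra pv => /eqP q0; rewrite /lead_coef.
  by have := congr1 (fun q : {poly K} => q`_(size (muni p)).-1) q0; rewrite /= coef_map coef0 => ->.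
have [t qt] := poly_nonroot qn0.
exists (fun i => if unlift ord_max i is Some j then v j else t).
rewrite meval_muni /= unlift_none; apply: contra qt => /eqP <-; apply/eqP; congr (_.[_]).
apply: eq_map_poly => /= r; apply: meval_eq => i.
have -> : widen_ord (leqnSn n) i = lift ord_max i by apply/val_inj; apply/esym; exact: lift_max.
by rewrite liftK.
Qed.

Lemma mpoly_fun0 n (p : {mpoly K[n]}) : (forall v, p.@[v] = 0) -> p = 0.
Proof.
move=> p0; apply/eqP/negPn/negP => /mpoly_nonroot[v].
by rewrite p0 eqxx.
Qed.

Lemma msizeM_leq n (p q : {mpoly K[n]}) a b :
  (msize p <= a.+1 -> msize q <= b.+1 -> msize (p * q) <= (a + b).+1)%N.
Proof.
have [->|p0] := eqVneq p 0; first by rewrite mul0r msize0.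
have [->|q0] := eqVneq q 0; first by rewrite mulr0 msize0.
by rewrite msizeM //; move: (msize p) (msize q) => x y; lia.
Qed.

Lemma msizeX_leq n (p : {mpoly K[n]}) a k :
  (msize p <= a.+1 -> msize (p ^+ k) <= (k * a).+1)%N.
Proof.
move=> pa; elim: k => [|k IHk]; first by rewrite expr0 msize1.
by rewrite exprS mulSn; apply: msizeM_leq.
Qed.

Lemma msize_prod_leq n (I : Type) (r : seq I) (F : I -> {mpoly K[n]}) a :
  (forall i, msize (F i) <= a.+1)%N -> (msize (\prod_(i <- r) F i) <= (size r * a).+1)%N.
Proof.
move=> Fa; elim: r => [|i r IHr]; first by rewrite big_nil msize1.
by rewrite big_cons mulSn; apply: msizeM_leq.
Qed.

(** Counting: the monomials in the [phi i] with exponents at most [E] outnumber the monomials of the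
    box that contains their expansions, so a nonzero kernel vector of the coefficient matrix
    supplies [G]. *)
Lemma algebraic_dependence k m (phi : 'I_m -> {mpoly K[k]}) : (k < m)%N ->
  exists2 G : {mpoly K[m]}, G != 0 & forall y, G.@[fun i => (phi i).@[y]] = 0.
Proof.
move=> lt_km; pose D := (\max_i msize (phi i))%N.
have phiD i : (msize (phi i) <= D.+1)%N by apply: leqW; exact: leq_bigmax.
(* [B] bounds the degrees of the products, and [B + 1 <= (m D + 1) (E + 1)]. This choice of [E]
   gives [(B + 1) ^ k <= E (E + 1) ^ k < (E + 1) ^ m]. *)
pose E := ((m * D).+1 ^ k)%N; pose B := (m * (E * D))%N.
pose T1 := {ffun 'I_m -> 'I_E.+1}; pose T2 := {ffun 'I_k -> 'I_B.+1}.
have card12 : (#|T2| < #|T1|)%N.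
  rewrite !card_ffun !card_ord; apply: (@leq_trans (E.+1 ^ k.+1)%N).
    apply: (@leq_ltn_trans (((m * D).+1 * E.+1) ^ k)%N); first by
      case: (posnP k) => [->|k0]; rewrite ?expn0 ?leq_exp2r //; nia.
    by rewrite expnMn expnS ltn_mul2r expn_gt0 ltnSn.
  by rewrite leq_pexp2l.
pose q (u : T1) := \prod_(i < m) phi i ^+ u i.
pose mon1 (u : T1) := [multinom (u i : nat) | i < m].
pose mon2 (u : T2) := [multinom (u i : nat) | i < k].
have qB u : (msize (q u) <= B.+1)%N.
  have := @msize_prod_leq k 'I_m (index_enum _) (fun i => phi i ^+ u i) (E * D)%N.
  have -> : size (index_enum 'I_m) = m by rewrite -[RHS]card_ord cardE enumT.
  apply=> i; apply: leq_trans (msizeX_leq (u i) (phiD i)) _.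
  by rewrite ltnS leq_mul2r -ltnS ltn_ord orbT.
pose A : 'M[K]_(#|T1|, #|T2|) := \matrix_(i, j) (q (enum_val i))@_(mon2 (enum_val j)).
have : kermx A != 0.
  rewrite kermx_eq0; apply/negP => /eqP rA.
  by have := rank_leq_col A; rewrite rA leqNgt card12.
case/rowV0Pn => c /sub_kermxP cA c0.
exists (\sum_u c 0 (enum_rank u) *: 'X_[mon1 u]).
  apply: contra c0 => /eqP G0; apply/eqP/rowP => j; rewrite mxE.
  have := congr1 (mcoeff (mon1 (enum_val j))) G0; rewrite mcoeff0 => <-.
  rewrite raddf_sum (bigD1 (enum_val j)) //= mcoeffZ mcoeffX eqxx mulr1 enum_valK.
  rewrite big1 ?addr0 // => u uj; rewrite mcoeffZ mcoeffX; case: eqP => [Eu|]; last by rewrite mulr0.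
  case/negP: uj; apply/eqP/ffunP => i; apply/val_inj.
  by move/mnmP/(_ i): Eu; rewrite !mnmE.
move=> y; suff E0 : \sum_u c 0 (enum_rank u) *: q u = 0.
  rewrite -[RHS](meval0 y) -E0 !raddf_sum /=; apply: eq_bigr => u _.
  rewrite !mevalZ mevalX; congr (_ * _); rewrite /q rmorph_prod /=.
  by apply: eq_bigr => i _; rewrite rmorphXn mnmE.
apply/mpolyP => mu; rewrite mcoeff0 raddf_sum /=.
have [/forallP mu_box|] := boolP [forall i, (mu i < B.+1)%N]; last first.
  rewrite negb_forall => /existsP[i mui]; apply: big1 => u _.
  rewrite mcoeffZ (memN_msupp_eq0 (p := q u)) ?mulr0 //; apply: msize_mdeg_ge.
  apply: leq_trans (qB u) _; apply: leq_trans (_ : mu i <= _)%N; first by rewrite leqNgt.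
  by rewrite mdegE (bigD1 i) //= leq_addr.
pose j : T2 := [ffun i => Ordinal (mu_box i)].
have -> : mu = mon2 j by apply/mnmP => i; rewrite mnmE ffunE.
move/rowP/(_ (enum_rank j)): cA; rewrite !mxE => cAj; rewrite -[RHS]cAj.
rewrite (reindex_onto (@enum_val _ _) enum_rank) /=; last by move=> u _; exact: enum_rankK.
rewrite (eq_bigl xpredT) => [|i]; last by rewrite enum_valK eqxx.
by apply: eq_bigr => i _; rewrite mcoeffZ mxE enum_valK enum_rankK.
Qed.

End Infinite.

(** * Irreducible closed sets and chains *)

Local Open Scope classical_set_scope.

Lemma meval_homog (R : comNzRingType) n e (p : {mpoly R[n]}) c v :
  p \is e.-homog -> p.@[fun i => c * v i] = c ^+ e * p.@[v].
Proof.
move=> /dhomogP ph; rewrite !mevalE mulr_sumr !big_seq; apply: eq_bigr => m mp.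
rewrite mulrCA; congr (_ * _); have <- : mdeg m = e by exact: ph.
rewrite mdegE -prodrXr -big_split /=.
by apply: eq_bigr => i _; rewrite exprMn.
Qed.

Section Cones.
Variables (K : closedFieldType) (V : vectType K).
Hypothesis charK : [pchar K] =i pred0.
Local Notation N := (\dim {:V}).
Implicit Types (P Q : {mpoly K[N]}) (v : V) (Z S : set (proj_space V)) (L : proj_space V).

Lemma eval_coord_homog e P c v :
  P \is e.-homog -> eval_coord P (c *: v) = c ^+ e * eval_coord P v.
Proof.
move=> Ph; rewrite -(meval_homog _ _ Ph); apply: meval_eq => i.
by rewrite linearZ.
Qed.

Definition scaling_closed (C : V -> Prop) := forall c v, C v -> C (c *: v).

(** For fixed [v], the value of [P] at [t *: v] is a polynomial in [t] whose coefficients are the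
    values at [v] of the components of [P]; it vanishes for every [t]. *)
Lemma vanish_pihomog (C : V -> Prop) P e : scaling_closed C ->
  (forall v, C v -> eval_coord P v = 0) ->
  forall v, C v -> eval_coord (pihomog mdeg e P) v = 0.
Proof.
move=> Csc P0 v Cv; pose k := maxn (msize P) e.+1.
pose q := \poly_(i < k) eval_coord (pihomog mdeg i P) v.
have -> : eval_coord (pihomog mdeg e P) v = q`_e by rewrite coef_poly leq_maxr.
suff -> : q = 0 by rewrite coef0.
apply: (poly_fun0 charK) => t; rewrite horner_poly -[RHS](P0 (t *: v)); last exact: Csc.
rewrite [P in RHS](@pihomog_partitionE _ _ mdeg k) ?leq_maxl // /eval_coord raddf_sum /=.
apply: eq_bigr => i _; rewrite mulrC -[in RHS](pihomog_id mdeg) .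
by rewrite -(eval_coord_homog _ _ (pihomogP mdeg i P)) /eval_coord pihomog_id.
Qed.

Lemma proj_line L : exists2 v, v != 0 & val L = <[v]>%VS.
Proof.
have d1 := eqP (valP L); exists (vpick (val L)).
  by rewrite vpick0 -dimv_eq0 d1.
by apply/esym/eqP; rewrite eqEdim -memvE memv_pick d1 dim_vline vpick0 -dimv_eq0 d1.
Qed.

Lemma proj_point_subproof v : v != 0 -> \dim <[v]>%VS == 1%N.
Proof. by move=> v0; rewrite dim_vline v0. Qed.

Definition proj_point v (v0 : v != 0) : proj_space V :=
  exist _ <[v]>%VS (proj_point_subproof v0).

Definition vanish Z P := forall L, Z L -> forall v, v \in val L -> eval_coord P v = 0.

Definition cone Z v := exists2 L, Z L & v \in val L.

Lemma cone_scaling Z : scaling_closed (cone Z).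
Proof. by move=> c v [L ZL vL]; exists L => //; apply: memvZ. Qed.

Lemma vanish_cone Z P : vanish Z P <-> forall v, cone Z v -> eval_coord P v = 0.
Proof.
by split=> [H v [L ZL vL]|H L ZL v vL]; [exact: (H L) | apply: H; exists L].
Qed.

Lemma vanish_line e P L v : P \is e.-homog -> val L = <[v]>%VS ->
  eval_coord P v = 0 -> forall u, u \in val L -> eval_coord P u = 0.
Proof.
move=> Ph -> P0 u /vlineP[c ->]; by rewrite (eval_coord_homog _ _ Ph) P0 mulr0.
Qed.

Lemma closed_zero_locus1 e P : P \is e.-homog -> zariski_closed (zero_locus [set P]).
Proof. by move=> Ph; exists [set P] => // Q ->; exists e. Qed.

Lemma zero_locus1 P L : zero_locus [set P] L <-> forall v, v \in val L -> eval_coord P v = 0.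
Proof. by split=> [H v vL|H Q ->]; [exact: (H P)|]. Qed.

Lemma closure_vanish e S P : P \is e.-homog -> vanish S P -> vanish (zariski_closure S) P.
Proof.
move=> Ph SP L /(_ _ (closed_zero_locus1 Ph)) H; apply/zero_locus1; apply: H.
by move=> M SM; apply/zero_locus1; exact: SP.
Qed.

Lemma sub_closure S : S `<=` zariski_closure S.
Proof. by move=> L SL Z _; apply. Qed.

Lemma closure_min S Z : zariski_closed Z -> S `<=` Z -> zariski_closure S `<=` Z.
Proof. by move=> cZ SZ L; apply. Qed.

Lemma closure_closed S : zariski_closed (zariski_closure S).
Proof.
exists [set P | (exists e, P \is e.-homog) /\ vanish S P]; first by move=> P [].
apply/seteqP; split=> L.
  by move=> SL P [[e Ph] SP] v vL; exact: (closure_vanish Ph SP SL).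
move=> H Z [F Fh ->] SF P FP v vL; apply: (H P) => //; split; first exact: Fh.
by move=> M SM u uM; exact: (SF M SM P FP).
Qed.

Lemma closed_separate S Z : zariski_closed Z -> ~ (S `<=` Z) ->
  exists P e v, [/\ P \is e.-homog, vanish Z P, cone S v & eval_coord P v != 0].
Proof.
case=> F Fh -> /existsNP[L /not_implyP[SL]] /existsNP[P /not_implyP[FP]].
move=> /existsNP[v /not_implyP[vL /eqP Pv]].
have [e Pe] := Fh _ FP.
exists P, e, v; split=> //; last by exists L.
by move=> M /(_ P FP).
Qed.

(* The vanishing ideal of an irreducible set is prime; the first factor is
   homogeneous, the second need not be. *)
Lemma irreducible_prime Z e P Q : irreducible_closed Z -> P \is e.-homog ->
  ~ vanish Z P -> vanish Z (P * Q) -> vanish Z Q.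
Proof.
move=> [_ _ Zirr] Ph nZP ZPQ.
have PQi i v : cone Z v -> eval_coord P v = 0 \/ eval_coord (pihomog mdeg i Q) v = 0.
  move=> Zv; have [->|Pv] := eqVneq (eval_coord P v) 0; first by left.
  right; pose C u := exists c, u = c *: v.
  pose q := \poly_(j < maxn (msize Q) i.+1) eval_coord (pihomog mdeg j Q) v.
  have -> : eval_coord (pihomog mdeg i Q) v = q`_i by rewrite coef_poly leq_maxr.
  (* The factor ['X] takes care of [t = 0], where [t ^+ e] may vanish. *)
  suff /eqP : 'X * q = 0 by rewrite mulf_eq0 polyX_eq0 => /eqP->; rewrite coef0.
  apply: (poly_fun0 charK) => t; rewrite hornerM hornerX.
  have [->|t0] := eqVneq t 0; first by rewrite mul0r.
  have : eval_coord (P * Q) (t *: v) = 0.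
    by move/vanish_cone: ZPQ; apply; exact: cone_scaling.
  rewrite /eval_coord mevalM -/(eval_coord P _) -/(eval_coord Q _).
  move/eqP; rewrite mulf_eq0 (eval_coord_homog _ _ Ph) mulf_eq0 expf_eq0 (negPf t0) andbF (negPf Pv) /=.
  move=> /eqP Q0; apply/eqP; rewrite mulf_eq0; apply/orP; right; rewrite -Q0 horner_poly.
  apply/eqP; rewrite [Q in RHS](@pihomog_partitionE _ _ mdeg (maxn (msize Q) i.+1)) ?leq_maxl //.
  rewrite /eval_coord raddf_sum /=; apply: eq_bigr => j _; rewrite mulrC.
  by rewrite -(eval_coord_homog _ _ (pihomogP mdeg j Q)).
have Qi i : vanish Z (pihomog mdeg i Q).
  have Qih := pihomogP mdeg i Q.
  have /(Zirr _ _ (closed_zero_locus1 Ph) (closed_zero_locus1 Qih))[] :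
      Z `<=` zero_locus [set P] `|` zero_locus [set pihomog mdeg i Q].
    move=> L ZL; have [v v0 Lv] := proj_line L.
    have vL : v \in val L by rewrite Lv memv_line.
    have [P0|Q0] := PQi i v (ex_intro2 _ _ L ZL vL); [left|right]; apply/zero_locus1.
      exact: (vanish_line Ph Lv P0).
    exact: (vanish_line Qih Lv Q0).
  - by move=> ZP; case: nZP => L /ZP/zero_locus1.
  - by move=> ZQ L /ZQ/zero_locus1.
move=> L ZL v vL; rewrite [Q](@pihomog_partitionE _ _ mdeg _ _ (leqnn _)).
by rewrite /eval_coord raddf_sum /= big1 // => i _; exact: (Qi i L).
Qed.

End Cones.

(** * Upper bound for the length of chains *)

Section ChainBound.
Variables (K : closedFieldType) (V : vectType K).
Hypothesis charK : [pchar K] =i pred0.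
Local Notation N := (\dim {:V}).

Lemma coord_neq0 (v : V) : v != 0 -> exists i, coord (vbasis {:V}) i v != 0.
Proof.
move=> v0; apply/existsP; rewrite -negb_forall; apply: contra v0 => /forallP v0.
by rewrite (coord_vbasis (memvf v)) big1 // => i _; rewrite (eqP (v0 i)) scale0r.
Qed.

Lemma eval_coordX i (v : V) : eval_coord 'X_i v = coord (vbasis {:V}) i v.
Proof. by rewrite /eval_coord mevalXU. Qed.

(** For each step of the chain take a form vanishing on the smaller set but not on the larger one,
    and for the bottom a coordinate. These [r + 1] forms are algebraically independent on the top
    cone, yet along [Phi] they become polynomials in [k] variables. The third hypothesis says that
    the image of [Phi] is dense in [S]. *)
Lemma irreducible_chain_lt k (S : set (proj_space V)) (Phi : ('I_k -> K) -> V)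
    (phi : 'I_N -> {mpoly K[k]}) r :
  (forall y i, coord (vbasis {:V}) i (Phi y) = (phi i).@[y]) ->
  (forall c y, exists y', Phi y' = c *: Phi y) ->
  (forall e P, P \is e.-homog -> (forall y, eval_coord P (Phi y) = 0) -> vanish S P) ->
  irreducible_chain (zariski_closure S) r -> (r < k)%N.
Proof.
move=> phiE Phisc Sdense [Z [Zirr Zlt]].
have Zcl i : (i <= r)%N -> zariski_closed (Z i) by move=> /Zirr[[]].
have Zsub i : (i < r)%N -> Z i `<=` Z i.+1 by move=> /Zlt[].
have /choice[f fP] : forall i, exists P : {mpoly K[N]}, (i <= r)%N ->
  exists e, [/\ P \is e.-homog, ~ vanish (Z i) P, i = 0%N -> eval_coord P 0 = 0 &
               forall j, i = j.+1 -> vanish (Z j) P].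
  case=> [|i]; last first.
    have [lt_ir|le_ri] := ltnP i r; last by exists 0.
    have [] := @closed_separate _ _ (Z i.+1) (Z i) (Zcl _ (ltnW lt_ir)).
      by have [] := Zlt _ lt_ir.
    move=> P [e [v [Ph ZP [L ZL vL] Pv]]]; exists P => _; exists e; split=> //.
      by move=> /(_ L ZL v vL) P0; rewrite P0 eqxx in Pv.
    by move=> j [<-].
  have [[_ [L ZL] _] _] := Zirr 0%N (leq0n r).
  have [v v0 Lv] := proj_line L; have [i vi] := coord_neq0 v0.
  exists 'X_i => _; exists 1%N; split=> //.
  - by rewrite dhomogX; apply/eqP; exact: mdeg1.
  - by move=> /(_ L ZL v); rewrite Lv memv_line eval_coordX => /(_ isT) v1; rewrite v1 eqxx in vi.
  - by move=> _; rewrite eval_coordX linear0.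
(* Shifted index: below the cone over [Z 0] comes the origin, where [f 0] vanishes. *)
pose C i v := if i is j.+1 then cone (Z j) v else v = 0.
have Cf i v : (i <= r)%N -> C i v -> C i.+1 v /\ eval_coord (f i) v = 0.
  move=> le_ir; have [e [_ _ f0 fS]] := fP _ le_ir.
  case: i le_ir f0 fS => [|i] le_ir f0 fS /=; last first.
    case=> L ZL vL; split; last exact: (fS i erefl L ZL v vL).
    by exists L => //; apply: Zsub.
  move->; split; last exact: f0.
  by have [[_ [L ZL] _] _] := Zirr 0%N (leq0n r); exists L => //; exact: mem0v.
have indep i (G : {mpoly K[i]}) : (i <= r.+1)%N ->
    (forall v, C i v -> G.@[fun j : 'I_i => eval_coord (f j) v] = 0) -> G = 0.
  (* Read [G] as a polynomial in its last variable. On [C i] the value of [f i] is zero, so the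
     constant coefficient vanishes by induction; then [f i] is cancelled because the ideal of [Z i]
     is prime. *)
  elim: i G => [|i IHi] G le_ir GC.
    by have := GC 0 erefl; rewrite -[G]mpolyKC mevalC => ->; rewrite raddf0.
  apply: muni_eq0; have [e [fh nZf _ _]] := fP _ le_ir.
  have {GC}: forall v, C i.+1 v ->
      (map_poly (meval (fun j : 'I_i => eval_coord (f j) v)) (muni G)).[eval_coord (f i) v] = 0.
    by move=> v /GC; rewrite meval_muni.
  elim/poly_ind: (muni G) => [//|p c IHp] H.
  have c0 : c = 0.
    apply: IHi; first exact: ltnW.
    move=> v Civ; have [Civ' fv] := Cf _ _ le_ir Civ.
    by have := H _ Civ'; rewrite fv rmorphD rmorphM /= map_polyX map_polyC hornerMXaddC mulr0 add0r.
  rewrite c0 polyC0 addr0; suff -> : p = 0 by rewrite mul0r.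
  apply: IHp; pose ft := [tuple f j | j < i]; pose Q := (map_poly (comp_mpoly ft) p).[f i].
  have QE v : eval_coord Q v =
      (map_poly (meval (fun j : 'I_i => eval_coord (f j) v)) p).[eval_coord (f i) v].
    rewrite /eval_coord -horner_map /= -map_poly_comp; congr (_.[_]).
    by apply: eq_map_poly => g /=; rewrite comp_mpoly_meval; apply: meval_eq => j; rewrite tnth_mktuple.
  have [Ziri _] := Zirr _ le_ir.
  move=> v Cv; rewrite -QE; move: v Cv; apply/vanish_cone.
  apply: (irreducible_prime charK Ziri fh nZf); apply/vanish_cone => v Cv.
  rewrite /eval_coord mevalM -!/(eval_coord _ v) QE mulrC.
  by have := H _ Cv; rewrite c0 polyC0 addr0 rmorphM /= map_polyX hornerMX.
rewrite ltnNge; apply/negP => le_kr.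
pose psi (j : 'I_r.+1) := f j \mPo [tuple phi i | i < N].
have psiE j y : (psi j).@[y] = eval_coord (f j) (Phi y).
  rewrite comp_mpoly_meval; apply: meval_eq => i.
  by rewrite tnth_mktuple phiE.
have [G G0 Gpsi] := algebraic_dependence psi (le_kr : (k < r.+1)%N).
case/negP: G0; apply/eqP/indep => // v Cv.
pose P := G \mPo [tuple f j | j < r.+1].
have PE u : eval_coord P u = G.@[fun j : 'I_r.+1 => eval_coord (f j) u].
  by rewrite /eval_coord comp_mpoly_meval; apply: meval_eq => j; rewrite tnth_mktuple.
rewrite -PE; case: Cv => L ZL vL.
(* [P] may be inhomogeneous; its components vanish on the image of [Phi], which is stable under
   scaling. *)
rewrite [P](@pihomog_partitionE _ _ mdeg _ _ (leqnn _)) /eval_coord raddf_sum big1 //= => i _.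
have Pi : vanish (zariski_closure S) (pihomog mdeg i P).
  apply: (closure_vanish (pihomogP mdeg i P)); apply: Sdense (pihomogP mdeg i P) _ => y.
  apply: (vanish_pihomog charK (C := fun u => exists y, u = Phi y)); last by exists y.
    by move=> c _ [z ->]; have [y' <-] := Phisc c z; exists y'.
  by move=> _ [z ->]; rewrite PE -(Gpsi z); apply: meval_eq => j; rewrite psiE.
by apply: (Pi L) => //; have [_] := Zirr _ (leqnn r); apply.
Qed.

End ChainBound.

Lemma horner_mmap (R : comNzRingType) n (h : 'I_n -> {poly R}) (P : {mpoly R[n]}) t :
  (mmap polyC h P).[t] = P.@[fun a => (h a).[t]].
Proof.
rewrite /meval /mmap horner_sum; apply: eq_bigr => m _.
rewrite hornerM hornerC /mmap1 horner_prod; congr (_ * _).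
by apply: eq_bigr => i _; rewrite horner_exp.
Qed.

Lemma poly_decomp1 (R : nzRingType) (p : {poly R}) :
  exists2 h : {poly R}, p = h * 'X + (p`_0)%:P & h`_0 = p`_1.
Proof.
elim/poly_ind: p => [|p c _]; first by exists 0; rewrite ?mul0r ?coef0 ?addr0.
by exists p; rewrite !coefD !coefMX !coefC /= ?add0r ?addr0.
Qed.

(** * Chains from flags of parameter spaces *)

Section Flag.
Variables (K : closedFieldType).
Hypothesis charK : [pchar K] =i pred0.

(* The component of lowest order of [G] at [c] is detected by the first order
   parts [z] of the curves [q]. *)
Lemma tangent_independent m (G : {mpoly K[m]}) (c : 'I_m -> K) :
  (forall z : 'I_m -> K, exists q : 'I_m -> {poly K},
     (forall a, (q a)`_0 = c a /\ (q a)`_1 = z a) /\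
     (forall t, G.@[fun a => (q a).[t]] = 0)) -> G = 0.
Proof.
move=> H; pose G' := G \mPo [tuple 'X_a + (c a)%:MP | a < m].
have G'E v : G'.@[v] = G.@[fun a => v a + c a].
  rewrite comp_mpoly_meval; apply: meval_eq => a.
  by rewrite tnth_mktuple mevalD mevalXU mevalC.
suff G'0 : G' = 0.
  apply: (mpoly_fun0 charK) => v; transitivity G'.@[fun a => v a - c a]; last by rewrite G'0 meval0.
  by rewrite G'E; apply: meval_eq => a; rewrite subrK.
apply/eqP/negPn/negP => G'n0.
have exi : exists i, pihomog mdeg i G' != 0.
  apply: contrapT => /forallNP nexi; case/negP: G'n0; apply/eqP.
  rewrite [G'](@pihomog_partitionE _ _ mdeg _ _ (leqnn _)) big1 // => i _.
  by apply/eqP; move/negP: (nexi i); rewrite negbK.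
case: (ex_minnP exi) => e /negP e0 emin; apply: e0; apply/eqP/(mpoly_fun0 charK) => z.
have [q [q01 Gq]] := H z.
have /choice[h hP] : forall a, exists h : {poly K}, q a = h * 'X + (c a)%:P /\ h`_0 = z a.
  move=> a; have [<- <-] := q01 a; have [h] := poly_decomp1 (q a).
  by exists h.
pose k := maxn (msize G') e.+1.
pose R i := mmap polyC h (pihomog mdeg i G').
pose W := \sum_(i < k) 'X^i * R i.
have W0 : W = 0.
  apply: (poly_fun0 charK) => t; rewrite horner_sum -[RHS](Gq t).
  transitivity (G'.@[fun a => t * (h a).[t]]); last first.
    rewrite G'E; apply: meval_eq => a; have [-> _] := hP a.
    by rewrite hornerD hornerMX hornerC mulrC.
  rewrite [G' in RHS](@pihomog_partitionE _ _ mdeg k) ?leq_maxl // raddf_sum /=.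
  apply: eq_bigr => i _; rewrite (meval_homog _ _ (pihomogP mdeg i G')).
  by rewrite hornerM hornerXn horner_mmap.
have : W`_e = 0 by rewrite W0 coef0.
rewrite coef_sum (bigD1 (Ordinal (leq_maxr (msize G') e.+1))) //= coefXnM ltnn subnn.
rewrite big1 => [|i ie]; last first.
  rewrite coefXnM; case: ltnP => // le_ie; rewrite /R.
  have lt_ie : (i < e)%N by rewrite ltn_neqAle le_ie andbT.
  suff -> : pihomog mdeg i G' = 0 by rewrite mmap0 coef0.
  by apply/eqP/negPn/negP => /emin; rewrite leqNgt lt_ie.
rewrite addr0 -horner_coef0 horner_mmap => <-; apply: meval_eq => a.
by rewrite horner_coef0; have [_ ->] := hP a.
Qed.

Lemma closed_field_root D (c : K) : (0 < D)%N -> exists t : K, t ^+ D = c.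
Proof.
move=> D0; have /closed_rootP[t] : size ('X^D - c%:P : {poly K}) != 1%N.
  by rewrite size_XnsubC // eqSS -lt0n.
by rewrite /root hornerD hornerN hornerC hornerXn subr_eq0 => /eqP <-; exists t.
Qed.

Variables (V : vectType K).
Local Notation N := (\dim {:V}).
Local Notation crd := (coord (vbasis {:V})).

Definition extend0 k m (w : 'I_m -> K) (i : 'I_k) : K :=
  if insub (i : nat) : option 'I_m is Some j then w j else 0.

Definition image_lines m (Phi : ('I_m -> K) -> V) : set (proj_space V) :=
  [set L : proj_space V | exists2 w, Phi w != 0 & val L = <[Phi w]>%VS].

(** Forms that do not vanish on the image pull back to nonzero polynomials in the parameters, and a
    product of these is nonzero. *)
Lemma image_lines_irreducible m (Phi : ('I_m -> K) -> V) (phi : 'I_N -> {mpoly K[m]}) :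
  (forall y i, crd i (Phi y) = (phi i).@[y]) -> (exists y, Phi y != 0) ->
  irreducible_closed (zariski_closure (image_lines Phi)).
Proof.
move=> phiE [y0 Py0]; set S := image_lines Phi.
have ptS y (yP : Phi y != 0) : S (proj_point yP) by exists y.
split; first exact: closure_closed.
  by exists (proj_point Py0); apply: sub_closure.
move=> A B cA cB SAB; apply: contrapT => /not_orP[nA nB].
have sep Z : zariski_closed Z -> ~ zariski_closure S `<=` Z ->
    exists P e y, [/\ P \is e.-homog, vanish Z P & eval_coord P (Phi y) != 0].
  move=> cZ nZ; have [|P [e [v [Ph ZP [L [y _ Ly] vL] Pv]]]] := @closed_separate _ _ S Z cZ.
    by move=> SZ; apply: nZ; exact: closure_min.
  exists P, e, y; split=> //; apply: contra Pv => /eqP P0; apply/eqP.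
  exact: (vanish_line Ph Ly).
have [P [d [y1 [Ph AP Py1]]]] := sep _ cA nA.
have [Q [e [y2 [Qh BQ Qy2]]]] := sep _ cB nB.
have [i0 i0P] := coord_neq0 Py0.
pose pull (F : {mpoly K[N]}) := F \mPo [tuple phi i | i < N].
have pullE F y : (pull F).@[y] = eval_coord F (Phi y).
  by rewrite comp_mpoly_meval; apply: meval_eq => i; rewrite tnth_mktuple phiE.
have pull0 F y : eval_coord F (Phi y) != 0 -> pull F != 0.
  by apply: contra => /eqP F0; rewrite -pullE F0 meval0.
(* The third factor keeps [Phi y] nonzero, so that it spans a point. *)
have : pull P * pull Q * phi i0 != 0.
  rewrite !mulf_neq0 ?(pull0 _ _ Py1) ?(pull0 _ _ Qy2) //.
  by apply: contra i0P => /eqP E; rewrite phiE E meval0.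
case/(mpoly_nonroot charK) => y; rewrite !mevalM !pullE -phiE !mulf_eq0 !negb_or.
case/andP => /andP[PyP QyP] yi.
have yP : Phi y != 0 by apply: contra yi => /eqP->; rewrite linear0.
have vl : Phi y \in val (proj_point yP) by rewrite memv_line.
have [AL|BL] := SAB _ (sub_closure (ptS _ yP)).
  by move/eqP: PyP; apply; exact: (AP _ AL).
by move/eqP: QyP; apply; exact: (BQ _ BL).
Qed.

(** The members of the chain are closures of images of the first [j + 1] coordinates, all through
    the base point [e0]. If two consecutive ones agreed, [j + 2] of the functionals [la],
    polynomials in [j + 1] parameters, would satisfy a relation on both; the curves of the last
    hypothesis have arbitrary first order parts and exclude it. Homogeneity of degree [D] and [D]-th
    roots make the images cones. *)
Lemma irreducible_chain_flag k (S : set (proj_space V)) (Phi : ('I_k.+1 -> K) -> V)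
    (phi : 'I_N -> {mpoly K[k.+1]}) D (la : 'I_k.+1 -> 'I_N -> K) :
  let e0 i := (i == ord0 :> 'I_k.+1)%:R in
  (forall y i, crd i (Phi y) = (phi i).@[y]) ->
  (0 < D)%N -> (forall c y, Phi (fun i => c * y i) = c ^+ D *: Phi y) ->
  Phi e0 != 0 ->
  (forall y L, Phi y != 0 -> val L = <[Phi y]>%VS -> zariski_closure S L) ->
  (forall z a, exists q : {poly K}, q`_1 = z a /\
     forall t, q.[t] = \sum_i la a i * crd i (Phi (fun j => e0 j + t * z j))) ->
  irreducible_chain (zariski_closure S) k.
Proof.
move=> e0 phiE D0 PhiD Phi0 PhiS tan.
pose Phim m (w : 'I_m -> K) := Phi (extend0 w).
pose phim m (i : 'I_N) : {mpoly K[m]} := phi i \mPo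
  [tuple (if insub (j : nat) : option 'I_m is Some l then 'X_l else 0) | j < k.+1].
have phimE m (y : 'I_m -> K) i : crd i (Phim m y) = (phim m i).@[y].
  rewrite comp_mpoly_meval phiE; apply: meval_eq => j; rewrite tnth_mktuple /extend0.
  by case: insubP => [l _ _|_]; rewrite ?mevalXU ?meval0.
have PhimD m c (w : 'I_m -> K) : Phim m (fun i => c * w i) = c ^+ D *: Phim m w.
  rewrite /Phim -PhiD; congr Phi; apply/funext => i; rewrite /extend0.
  by case: insub => [l|] //; rewrite mulr0.
have Phim0 m : Phim m.+1 (fun i => (i == ord0)%:R) != 0.
  suff -> : Phim m.+1 (fun i => (i == ord0)%:R) = Phi e0 by [].
  congr Phi; apply/funext => i; rewrite /extend0 /e0; case: insubP => [l _ il|].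
    by congr (_%:R); rewrite -!(inj_eq val_inj) /= -il.
  by rewrite -leqNgt; case: eqP => // ->.
exists (fun j => zariski_closure (image_lines (Phim j.+1))); split=> [j le_jk|j lt_jk].
  split; first by apply: (image_lines_irreducible (@phimE j.+1)); exists (fun i => (i == ord0)%:R).
  apply: closure_min; first exact: closure_closed.
  by move=> L [w w0 Lw]; exact: (PhiS _ _ w0 Lw).
split.
  apply: closure_min; first exact: closure_closed.
  move=> L [w w0 Lw]; apply: sub_closure.
  suff Ew : Phim j.+1 w = Phim j.+2 (extend0 w) by exists (extend0 w); rewrite -?Ew.
  congr Phi; apply/funext => i; rewrite /extend0.
  case: insubP => [l _ il|ni]; case: insubP => [l' _ il'|ni'] //.
  - case: insubP => [l2 _ l2E|]; first by congr w; apply/val_inj; exact: etrans il (esym (etrans l2E il')).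
    by rewrite il' -il ltn_ord.
  - by move: ni'; rewrite -leqNgt -il => /ltnW; rewrite leqNgt ltn_ord.
  - case: insubP => [l2 _ l2E|//]; case/negP: ni.
    by move: (ltn_ord l2); rewrite -il' -[X in (X < _)%N]/(val l2) l2E.
pose up (a : 'I_j.+2) : 'I_k.+1 := widen_ord (lt_jk : (j.+1 < k.+1)%N) a.
move=> sub; pose psi (a : 'I_j.+2) := \sum_i la (up a) i *: phim j.+1 i.
have [G /negP G0 Gpsi] := algebraic_dependence psi (ltnSn j.+1).
apply: G0; apply/eqP.
pose P := G \mPo [tuple \sum_i la (up a) i *: 'X_i | a < j.+2].
have PE v : eval_coord P v = G.@[fun a => \sum_i la (up a) i * crd i v].
  rewrite /eval_coord comp_mpoly_meval; apply: meval_eq => a.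
  by rewrite tnth_mktuple raddf_sum; apply: eq_bigr => i _; rewrite /= mevalZ mevalXU.
pose C m v := exists w, v = Phim m w.
have Csc m : scaling_closed (C m).
  move=> c _ [w ->]; have [t <-] := closed_field_root c D0.
  by exists (fun i => t * w i); rewrite PhimD.
have P0 v : C j.+1 v -> eval_coord P v = 0.
  case=> w ->; rewrite PE -[RHS](Gpsi w); apply: meval_eq => a.
  by rewrite [RHS]raddf_sum; apply: eq_bigr => i _; rewrite /= mevalZ phimE.
have {}P0 v : C j.+2 v -> eval_coord P v = 0.
  move=> [w ->]; rewrite [P](@pihomog_partitionE _ _ mdeg _ _ (leqnn _)) /eval_coord
    raddf_sum big1 //= => i _.
  have Pih := pihomogP mdeg i P; have Pi := vanish_pihomog charK i (Csc j.+1) P0.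
  have [w0|w0] := eqVneq (Phim j.+2 w) 0.
    by rewrite -/(eval_coord _ _) w0; apply: Pi; rewrite -(scale0r (Phim j.+1 (fun=> 0)));
      apply: Csc; exists (fun=> 0).
  have : vanish (zariski_closure (image_lines (Phim j.+1))) (pihomog mdeg i P).
    apply: (closure_vanish Pih) => L [u u0 Lu]; apply: (vanish_line Pih Lu).
    by apply: Pi; exists u.
  move/(_ (proj_point w0)); apply; last by rewrite memv_line.
  by apply: sub; apply: sub_closure; exists w.
apply: (tangent_independent (c := fun a => \sum_i la (up a) i * crd i (Phi e0))) => z.
have /choice[q qP] := tan (extend0 z).
exists (fun a => q (up a)); split=> [a|t].
  have [q1 qt] := qP (up a); split.
    rewrite -horner_coef0 qt; apply: eq_bigr => i _; congr (_ * crd i (Phi _)).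
    by apply/funext => l; rewrite mul0r addr0.
  rewrite q1 /extend0; case: insubP => [l _ la1|]; last by rewrite /= ltn_ord.
  by congr z; apply/val_inj.
rewrite -[RHS](P0 (Phim j.+2 (fun a => (a == ord0)%:R + t * z a))); last by
  exists (fun a => (a == ord0)%:R + t * z a).
rewrite PE; apply: meval_eq => a; have [_ ->] := qP (up a); apply: eq_bigr => i _.
congr (_ * crd i (Phi _)); apply/funext => l; rewrite /extend0 /e0.
case: insubP => [l' _ ll'|].
  by congr (_%:R + _); rewrite -!(inj_eq val_inj) /= -ll'.
by rewrite -leqNgt mulr0 addr0; case: eqP => // ->.
Qed.

End Flag.

(** * Tangent vectors of products of linear forms *)

Local Close Scope classical_set_scope.

Section Tangent.
Variable A : comNzRingType.
Implicit Types (l m : nat -> A) (ls ms : seq A) (x : A).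

(* The derivative at [ls] in the direction [ms] of the product of the entries. *)
Fixpoint tvec ls ms : A :=
  match ls, ms with
  | l :: ls', m :: ms' => m * (\prod_(x <- ls') x) + l * tvec ls' ms'
  | _, _ => 0
  end.

(** [tvec] for factors indexed by [nat], convenient for exchanging sums of directions. *)
Definition tsum d l m : A := \sum_(i < d) m i * \prod_(j < d | j != i) l j.

Lemma tsumS d l m :
  tsum d.+1 l m = m 0%N * \prod_(i < d) l i.+1 + l 0%N * tsum d (l \o S) (m \o S).
Proof.
rewrite /tsum big_ord_recl /=; congr (_ * _ + _).
  by rewrite big_mkcond big_ord_recl /= mul1r; apply: eq_bigr.
rewrite mulr_sumr; apply: eq_bigr => i _; rewrite mulrCA; congr (_ * _).
rewrite big_mkcond big_ord_recl /= [in RHS]big_mkcond; congr (_ * _).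
Qed.

Lemma tvecE ls ms : size ms = size ls ->
  tvec ls ms = tsum (size ls) (nth 0 ls) (nth 0 ms).
Proof.
elim: ls ms => [|l ls IHls] [|m ms] //=; first by rewrite /tsum big_ord0.
case=> sz; rewrite tsumS IHls //=; congr (_ * _ + _).
by rewrite (big_nth 0) big_mkord.
Qed.

Lemma prod_first_order d l m x : exists r,
  \prod_(i < d) (l i + x * m i) = \prod_(i < d) l i + x * tsum d l m + x * x * r.
Proof.
elim: d l m => [|d IHd] l m; first by exists 0; rewrite !big_ord0 /tsum big_ord0; ring.
have [r Er] := IHd (l \o S) (m \o S).
exists (l 0%N * r + m 0%N * tsum d (l \o S) (m \o S) + x * m 0%N * r).
rewrite tsumS !big_ord_recl /=.
have -> : \prod_(i < d) l (lift ord0 i) = \prod_(i < d) l i.+1 by apply: eq_bigr.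
by rewrite [X in _ * X]Er /=; ring.
Qed.

Lemma tsum_sum (I : finType) d l (m : I -> nat -> A) (c : I -> A) :
  tsum d l (fun i => \sum_k c k * m k i) = \sum_k c k * tsum d l (m k).
Proof.
rewrite /tsum; under eq_bigr do rewrite mulr_suml.
rewrite exchange_big; apply: eq_bigr => k _; rewrite mulr_sumr.
by apply: eq_bigr => i _; rewrite mulrA.
Qed.

Lemma eq_tsum d l l' m m' : (forall i, (i < d)%N -> l i = l' i) ->
  (forall i, (i < d)%N -> m i = m' i) -> tsum d l m = tsum d l' m'.
Proof.
move=> ll mm; apply: eq_bigr => i _; rewrite mm //; congr (_ * _).
by apply: eq_bigr => j _; rewrite ll.
Qed.

(** Euler's relation; through it the sum of the points becomes the first tangent vector of the
    flag. *)
Lemma tsum_same d l : tsum d l l = (\prod_(i < d) l i) *+ d.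
Proof.
rewrite -[in X in _ *+ X](card_ord d) -sumr_const; apply: eq_bigr => i _.
by rewrite [RHS](bigD1 i).
Qed.

Lemma tsum0 d l : tsum d l (fun=> 0) = 0.
Proof. by rewrite /tsum big1 // => i _; rewrite mul0r. Qed.

End Tangent.

Lemma rmorph_tvec (A B : comNzRingType) (f : {rmorphism A -> B}) ls ms :
  f (tvec ls ms) = tvec (map f ls) (map f ms).
Proof.
elim: ls ms => [|l ls IHls] [|m ms] /=; rewrite ?rmorph0 //.
by rewrite rmorphD !rmorphM IHls rmorph_prod big_map.
Qed.

Lemma rmorph_tsum (A B : comNzRingType) (f : {rmorphism A -> B}) d l m :
  f (tsum d l m) = tsum d (f \o l) (f \o m).
Proof.
rewrite raddf_sum; apply: eq_bigr => i _; rewrite /= rmorphM rmorph_prod.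
by congr (_ * _); apply: eq_bigr.
Qed.

(** * Linear independence as an open condition *)

Section Free.
Variable K : fieldType.

Definition freef (A : lmodType K) (J : finType) (v : J -> A) :=
  forall c : J -> K, \sum_j c j *: v j = 0 -> forall j, c j = 0.

Variable n : nat.
Implicit Types J : finType.

Lemma freef_monomials J (e : J -> 'X_{1..n}) : injective e ->
  freef (fun j => 'X_[e j] : {mpoly K[n]}).
Proof.
move=> e_inj c /(congr1 (mcoeff (e _))) H j; move: (H j); rewrite mcoeff0 raddf_sum /=.
rewrite (bigD1 j) //= mcoeffZ mcoeffX eqxx mulr1 big1 ?addr0 // => i ij.
by rewrite mcoeffZ mcoeffX (inj_eq e_inj) (negPf ij) mulr0.
Qed.

Definition spec (t : K) : {mpoly {poly K}[n]} -> {mpoly K[n]} :=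
  map_mpoly (horner_eval t).

HB.instance Definition _ t := GRing.RMorphism.copy (spec t) (map_mpoly (horner_eval t)).

Lemma mcoeff_spec t v m : (spec t v)@_m = (v@_m).[t].
Proof. by rewrite mcoeff_map_mpoly. Qed.

Definition cst : {mpoly K[n]} -> {mpoly {poly K}[n]} := map_mpoly polyC.

HB.instance Definition _ := GRing.RMorphism.copy cst (map_mpoly polyC).

Lemma spec_cst t v : spec t (cst v) = v.
Proof. by apply/mpolyP => m; rewrite mcoeff_spec mcoeff_map_mpoly /= hornerC. Qed.

Lemma spec_lin t u v : spec t (cst u + 'X%:MP * cst v) = u + t *: v.
Proof.
rewrite mul_mpolyC rmorphD /= spec_cst; congr (_ + _); apply/mpolyP => m.
by rewrite mcoeff_spec !mcoeffZ hornerM hornerX -mcoeff_spec spec_cst.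
Qed.

Lemma mcoeff_first_order (u v : {mpoly K[n]}) (r : {mpoly {poly K}[n]}) m :
  ((cst u + 'X%:MP * cst v + 'X%:MP * 'X%:MP * r)@_m)`_1 = v@_m.
Proof.
have cstE (w : {mpoly K[n]}) : (cst w)@_m = (w@_m)%:P by exact: mcoeff_map_mpoly.
rewrite !mcoeffD -mulrA !mul_mpolyC !mcoeffZ !cstE !coefD.
by rewrite !coefXM !coefC /= add0r addr0.
Qed.

Definition line (u v : {mpoly K[n]}) : {mpoly {poly K}[n]} :=
  cst u + 'X *: cst (v - u).

Lemma spec_line t u v : spec t (line u v) = u + t *: (v - u).
Proof.
rewrite rmorphD /= spec_cst; congr (_ + _); apply/mpolyP => m.
by rewrite mcoeff_spec !mcoeffZ hornerM hornerX -mcoeff_spec spec_cst.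
Qed.

(** [D] is a maximal minor of the coefficient matrix, chosen nonzero at [t0]; wherever it does not
    vanish the rows stay independent. *)
Lemma freef_open J (v : J -> {mpoly {poly K}[n]}) t0 :
  freef (fun j => spec t0 (v j)) ->
  exists2 D : {poly K}, D.[t0] != 0 & forall t, D.[t] != 0 -> freef (fun j => spec t (v j)).
Proof.
move=> fr; pose k := (\max_j msize (v j))%N.
pose T : finType := 'X_{1..n < k}.
pose A : 'M[{poly K}]_(#|J|, #|T|) := \matrix_(i, j) (v (enum_val i))@_(bmnm (enum_val j)).
pose At t := map_mx (horner_eval t) A.
have AtE t i j : At t i j = (spec t (v (enum_val i)))@_(bmnm (enum_val j)).
  by rewrite !mxE mcoeff_spec.
have Afree : row_free (At t0).
  rewrite -kermx_eq0; apply/negPn/negP => /rowV0Pn[c /sub_kermxP cA c0].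
  case/negP: c0; apply/eqP/rowP => i; rewrite mxE.
  have /fr : \sum_j c 0 (enum_rank j) *: spec t0 (v j) = 0.
    apply/mpolyP => m; rewrite mcoeff0 raddf_sum /=.
    have [mk|km] := ltnP (mdeg m) k; last first.
      rewrite big1 // => j _; rewrite mcoeffZ mcoeff_spec memN_msupp_eq0 ?horner0 ?mulr0 //.
      by apply: msize_mdeg_ge; apply: leq_trans km; exact: (leq_bigmax j).
    have {}cA : (c *m At t0) 0 (enum_rank (BMultinom mk)) = 0 by rewrite cA mxE.
    rewrite -[RHS]cA mxE (reindex_onto (@enum_val _ _) enum_rank) /=; last by move=> u _; exact: enum_rankK.
    rewrite (eq_bigl xpredT) => [|j]; last by rewrite enum_valK eqxx.
    by apply: eq_bigr => j _; rewrite AtE enum_valK enum_rankK mcoeffZ.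
  by move/(_ (enum_val i)); rewrite enum_valK.
have full : row_full (At t0)^T by rewrite /row_full mxrank_tr; exact: Afree.
pose f := fullrankfun full.
pose B : 'M[{poly K}]_#|J| := \matrix_(i, j) A i (f j).
have BtE t : (\det B).[t] = \det (\matrix_(i, j) At t i (f j)).
  rewrite -[LHS]/(horner_eval t (\det B)) -det_map_mx; congr (\det _).
  by apply/matrixP => i j; rewrite !mxE.
exists (\det B).
  rewrite BtE -unitfE -unitmxE -unitmx_tr.
  have -> : (\matrix_(i, j) At t0 i (f j))^T = rowsub f (At t0)^T.
    by apply/matrixP => i j; rewrite !mxE.
  exact: fullrowsub_unit.
move=> t Dt c cv j; pose r : 'rV_#|J| := \row_i c (enum_val i).
suff : r = 0 by move/rowP/(_ (enum_rank j)); rewrite !mxE enum_rankK.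
move: Dt; rewrite BtE => Dt; apply: (@row_free_inj _ _ _ _ (\matrix_(i, j) At t i (f j))).
  by rewrite row_free_unit unitmxE unitfE.
rewrite mul0mx; apply/rowP => b; rewrite !mxE.
have /(congr1 (mcoeff (bmnm (enum_val (f b))))) := cv.
rewrite mcoeff0 raddf_sum /= => E; rewrite -[RHS]E.
rewrite [RHS](reindex_onto (@enum_val _ _) enum_rank) /=; last by move=> u _; exact: enum_rankK.
rewrite [RHS](eq_bigl xpredT) => [|i]; last by rewrite enum_valK eqxx.
by apply: eq_bigr => i _; rewrite mxE mxE AtE mcoeffZ.
Qed.

End Free.

Local Open Scope classical_set_scope.

(** * Forms with parameters and their coordinates *)

Section Homog.
Variables (n : nat) (R : comNzRingType).
Implicit Types (l m : {mpoly R[n]}) (ls ms : seq {mpoly R[n]}).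

Definition linforms d ls := (size ls == d) && all (fun l => l \is 1.-homog) ls.

Lemma linforms_cons d l ls :
  linforms d.+1 (l :: ls) = (l \is 1.-homog) && linforms d ls.
Proof. by rewrite /linforms /= eqSS andbCA. Qed.

Lemma linforms_nth d ls i : linforms d ls -> nth 0 ls i \is 1.-homog.
Proof.
case/andP => _ /allP ls1; have [lt|ge] := ltnP i (size ls); first exact/ls1/mem_nth.
by rewrite nth_default // dhomog0.
Qed.

Lemma prod_homog d ls : linforms d ls -> \prod_(l <- ls) l \is d.-homog.
Proof.
elim: ls d => [|l ls IHls] [|d] //; first by rewrite big_nil dhomog1.
by rewrite linforms_cons big_cons -add1n => /andP[l1 /IHls]; exact: dhomogM l1.
Qed.

Lemma tvec_homog d ls ms : linforms d ls -> linforms d ms -> tvec ls ms \is d.-homog.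
Proof.
elim: ls d ms => [|l ls IHls] [|d] [|m ms] //=; rewrite ?dhomog0 //.
rewrite !linforms_cons => /andP[l1 ls1] /andP[m1 ms1].
rewrite dhomogD // -add1n; apply: dhomogM => //; [exact: prod_homog|exact: IHls].
Qed.

End Homog.

Lemma dhomog_map n (R R' : comNzRingType) (g : {rmorphism R -> R'}) d (G : {mpoly R[n]}) :
  G \is d.-homog -> map_mpoly g G \is d.-homog.
Proof.
move=> /dhomogP Gh; apply/dhomogP => m; rewrite mcoeff_msupp mcoeff_map_mpoly => gm.
by apply: Gh; rewrite mcoeff_msupp; apply: contra gm => /eqP Gm0; apply/eqP; rewrite Gm0; exact: (rmorph0 g).
Qed.

Section Coordinates.
Variables (K : fieldType) (n d : nat).
Local Notation V := (dhomog n.+1 K d).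
Local Notation crd := (coord (vbasis {:V})).

Definition form (p : {mpoly K[n.+1]}) : V := indhomog d p.

Lemma formK p : p \is d.-homog -> form p = p :> {mpoly K[n.+1]}.
Proof. by move=> ph; rewrite /form /indhomog /insubd insubT. Qed.

Lemma form_val (u : V) : form u = u.
Proof. by apply/val_inj; rewrite [LHS]formK // dhomog_is_dhomog. Qed.

Lemma val_form_sum (I : Type) (r : seq I) (u : I -> V) :
  \sum_(i <- r) u i = \sum_(i <- r) (u i : {mpoly K[n.+1]}) :> {mpoly K[n.+1]}.
Proof. exact: (raddf_sum (@mpoly_of_dhomog _ _ _)). Qed.

Lemma form_sum (I : finType) (c : I -> K) (f : I -> {mpoly K[n.+1]}) :
  (forall i, f i \is d.-homog) -> form (\sum_i c i *: f i) = \sum_i c i *: form (f i).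
Proof.
move=> fh; apply/val_inj => /=; rewrite [LHS]formK.
  by rewrite val_form_sum; apply: eq_bigr => i _; rewrite -[f i in LHS]formK.
by apply: rpred_sum => i _; apply: rpredZ.
Qed.

Lemma formZ c f : f \is d.-homog -> form (c *: f) = c *: form f.
Proof.
move=> fh; apply/val_inj => /=; rewrite [LHS]formK ?rpredZ //.
by rewrite -[f in LHS]formK.
Qed.

Lemma form_eq0 f : f \is d.-homog -> (form f == 0) = (f == 0).
Proof. by move=> fh; rewrite -(inj_eq val_inj) /= [X in X == _]formK. Qed.

Lemma crd_sum (u : V) i :
  crd i u = \sum_(m : 'X_{1..n.+1 < d.+1}) (u : {mpoly K[n.+1]})@_m * crd i (form 'X_[m]).
Proof.
have uh := dhomog_is_dhomog u.
have uE : u = \sum_(m : 'X_{1..n.+1 < d.+1}) (u : {mpoly K[n.+1]})@_m *: form 'X_[m].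
  apply/val_inj; rewrite [RHS]val_form_sum [LHS](@mpolywE _ _ d.+1).
    apply: eq_bigr => m _.
    have [md|md] := eqVneq (mdeg m) d.
      by rewrite -['X_[m] in LHS]formK // dhomogX; apply/eqP.
    by rewrite (dhomog_nemf_coeff uh) // !scale0r.
  rewrite msizeE; apply/bigmax_leqP_seq => m mu _.
  by have /= -> := dhomog_mf uh mu.
by rewrite {1}uE linear_sum; apply: eq_bigr => m _; rewrite linearZ.
Qed.

Variables (R : comNzRingType) (iota : K -> R) (g : {rmorphism R -> K}).
Hypothesis giota : forall c, g (iota c) = c.

(** The basis of [V] lives over [K]; these are the coordinates of a form whose coefficients lie in
    [R], such as polynomials in parameters. *)
Definition coords (G : {mpoly R[n.+1]}) i : R :=
  \sum_(m : 'X_{1..n.+1 < d.+1}) G@_m * iota (crd i (form 'X_[m])).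

Lemma coordsE G i : G \is d.-homog -> crd i (form (map_mpoly g G)) = g (coords G i).
Proof.
move=> Gh; rewrite crd_sum rmorph_sum; apply: eq_bigr => m _.
by rewrite rmorphM giota formK ?mcoeff_map_mpoly ?dhomog_map.
Qed.

End Coordinates.

Section Curves.
Variables (K : closedFieldType) (n d : nat).
Hypothesis charK : [pchar K] =i pred0.
Local Notation V := (dhomog n.+1 K d).
Local Notation crd := (coord (vbasis {:V})).
Local Notation cds := (@coords K n d {poly K} polyC).

Lemma crd_spec t G i : G \is d.-homog -> crd i (form d (spec t G)) = (cds G i).[t].
Proof. by apply: coordsE => c; rewrite /= horner_evalE hornerC. Qed.

Lemma eval_coord_spec (P : {mpoly K[\dim {:V}]}) t G : G \is d.-homog ->
  eval_coord P (form d (spec t G)) = (mmap polyC (cds G) P).[t].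
Proof.
move=> Gh; rewrite horner_mmap; apply: meval_eq => i.
exact: crd_spec.
Qed.

(** Passage to the limit along a curve: the value of [P] is a polynomial in [t] that vanishes after
    multiplication by [D]. *)
Lemma eval_coord_spec0 (P : {mpoly K[\dim {:V}]}) G (D : {poly K}) :
  G \is d.-homog -> D != 0 ->
  (forall t, D.[t] != 0 -> eval_coord P (form d (spec t G)) = 0) ->
  forall t, eval_coord P (form d (spec t G)) = 0.
Proof.
move=> Gh D0 H t; rewrite eval_coord_spec //.
suff /eqP : D * mmap polyC (cds G) P = 0.
  by rewrite mulf_eq0 (negPf D0) => /eqP->; rewrite horner0.
apply: (poly_fun0 charK) => u; rewrite hornerM; have [->|Du] := eqVneq D.[u] 0.
  by rewrite mul0r.
by rewrite -eval_coord_spec // H ?mulr0.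
Qed.

End Curves.

Lemma freef_neq0 (K : fieldType) (A : lmodType K) (J : finType) (v : J -> A) j :
  freef v -> v j != 0.
Proof.
move=> fr; apply/eqP => vj0; have := fr (fun i => (i == j)%:R).
move=> /(_ _ j); rewrite eqxx => H; have /eqP : (1 : K) = 0; last by rewrite oner_eq0.
apply: H; rewrite (bigD1 j) //= vj0 scaler0 add0r big1 // => i /negPf ->.
by rewrite scale0r.
Qed.

Lemma linforms_enum n (R : comNzRingType) d (F : 'I_d -> {mpoly R[n]}) :
  (forall i, F i \is 1.-homog) -> linforms d [seq F i | i <- enum 'I_d].
Proof.
move=> F1; rewrite /linforms size_map size_enum_ord eqxx /=.
by apply/allP => _ /mapP[i _ ->].
Qed.

Lemma prod_enum_homog n (R : comNzRingType) d (F : 'I_d -> {mpoly R[n]}) :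
  (forall i, F i \is 1.-homog) -> \prod_(i < d) F i \is d.-homog.
Proof.
by move=> F1; have := prod_homog (linforms_enum F1); rewrite big_map big_enum.
Qed.

Lemma mpolyX1_homog n (R : comNzRingType) (j : 'I_n) : ('X_j : {mpoly R[n]}) \is 1.-homog.
Proof. by rewrite dhomogX; apply/eqP; exact: mdeg1. Qed.

(** * Points of secant planes and the parameter count *)

Section SecantLines.
Variables (K : closedFieldType) (n d s : nat).
Hypothesis charK : [pchar K] =i pred0.
Local Notation V := (dhomog n.+1 K d.+1).
Local Notation crd := (coord (vbasis {:V})).
Local Notation form := (form d.+1).
Local Notation prods f := (\sum_p \prod_(l <- f p) l).

(** The union of planes before closure: [secant_variety] of the split variety unfolds to its
    [zariski_closure]. *)
Definition secant_lines : set (proj_space V) :=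
  [set L : proj_space V | exists x : 'I_s -> proj_space V,
     [/\ forall i, @split_variety K n d.+1 (x i),
         \dim (\sum_(i < s) val (x i))%VS = s &
         (val L <= \sum_(i < s) val (x i))%VS]].

Lemma secant_lines_sum (f : 'I_s -> seq {mpoly K[n.+1]}) L :
  (forall p, linforms d.+1 (f p)) -> freef (fun p => \prod_(l <- f p) l) ->
  val L = <[form (prods f)]>%VS -> secant_lines L.
Proof.
move=> fl fr LE; pose v p := form (\prod_(l <- f p) l).
have vh p := prod_homog (fl p).
have v0 p : v p != 0 by rewrite form_eq0 //; exact: (freef_neq0 p fr).
have spanE : (\sum_(i < s) val (proj_point (v0 i)) = <<[tuple v p | p < s]>>)%VS.
  by rewrite span_def big_tuple; apply: eq_bigr => i _; rewrite tnth_mktuple.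
exists (fun p => proj_point (v0 p)); split.
- move=> p; exists (v p), (fun i => indhomog 1 (nth 0 (f p) i)); split=> //.
  rewrite [LHS]formK // (big_nth 0) big_mkord; have /andP[/eqP -> _] := fl p.
  by apply: eq_bigr => i _; rewrite [RHS]formK // (linforms_nth _ (fl p)).
- rewrite spanE; suff /eqP -> : free [tuple v p | p < s] by rewrite size_tuple.
  apply/freeP => k; under eq_bigr do rewrite -tnth_nth tnth_mktuple.
  rewrite -form_sum // => /eqP; rewrite form_eq0; last by apply: rpred_sum => i _; apply: rpredZ.
  by move/eqP/fr.
- rewrite LE spanE -memvE; have -> : form (prods f) = \sum_p v p.
    have := form_sum (d := d.+1) (fun=> 1) vh.
    under eq_bigr do rewrite scale1r; move=> ->.
    by apply: eq_bigr => p _; rewrite scale1r.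
  by apply: memv_suml => p _; apply: memv_span; apply/tnthP; exists p; rewrite tnth_mktuple.
Qed.

Lemma secant_lines_form L v : secant_lines L -> v \in val L ->
  exists f : 'I_s -> seq {mpoly K[n.+1]},
    (forall p, linforms d.+1 (f p)) /\ v = form (prods f).
Proof.
case=> x [/choice[g /choice[l gP]] _ sub] /(subvP sub) /memv_sumP[u ux ->].
have /choice[c uc] : forall p, exists c, u p = c *: g p.
  by move=> p; have [gE _] := gP p; have := ux p isT; rewrite gE => /vlineP.
(* The scalar of each summand is absorbed into its first factor. *)
exists (fun p => c p *: (l p ord0 : {mpoly K[n.+1]}) ::
          [seq (l p (lift ord0 i) : {mpoly K[n.+1]}) | i <- enum 'I_d]).
have lh p i := dhomog_is_dhomog (l p i).
have ll p : linforms d.+1 (c p *: (l p ord0 : {mpoly K[n.+1]}) ::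
          [seq (l p (lift ord0 i) : {mpoly K[n.+1]}) | i <- enum 'I_d]).
  rewrite linforms_cons; apply/andP; split; first by apply: rpredZ; exact: lh.
  by apply: (@linforms_enum n.+1 K d (fun i => l p (lift ord0 i))) => i; exact: lh.
split=> //; have := form_sum (d := d.+1) (fun=> 1) (fun p => prod_homog (ll p)).
under eq_bigr do rewrite scale1r; move=> ->.
apply: eq_bigr => p _; rewrite scale1r uc big_cons big_map big_enum /= -scalerAl.
have [_ gE] := gP p; rewrite big_ord_recl in gE.
by rewrite -gE formZ ?dhomog_is_dhomog // form_val.
Qed.

(** A general linear form can be scaled to have coefficient 1 at [x_0]. A product of [d + 1] of them
    then takes [(d + 1) n] parameters and one scalar; products outside this chart are limits. *)
Lemma secant_chain_lt r :
  irreducible_chain (zariski_closure secant_lines) r -> (r < s * (d.+1 * n + 1))%N.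
Proof.
pose T : finType := ('I_s * option ('I_d.+1 * 'I_n))%type.
have cardT : #|T| = (s * (d.+1 * n + 1))%N.
  by rewrite card_prod card_option card_prod !card_ord addn1.
rewrite -cardT; pose R := {mpoly K[#|T|]}.
pose chart (A : comNzRingType) (y : T -> A) : {mpoly A[n.+1]} :=
  \sum_(p < s) y (p, None) *: \prod_(i < d.+1)
    ('X_ord0 + \sum_(j < n) y (p, Some (i, j)) *: 'X_(lift ord0 j)).
pose F : {mpoly R[n.+1]} := chart _ (fun x => 'X_(enum_rank x)).
have chartM (A B : comNzRingType) (g : {rmorphism A -> B}) y :
    map_mpoly g (chart A y) = chart B (fun x => g (y x)).
  rewrite raddf_sum; apply: eq_bigr => p _; rewrite /= map_mpolyZ rmorph_prod; congr (_ *: _).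
  apply: eq_bigr => i _; rewrite /= rmorphD /= map_mpolyX raddf_sum; congr (_ + _).
  by apply: eq_bigr => j _; rewrite /= map_mpolyZ map_mpolyX.
have chartH (A : comNzRingType) y : chart A y \is d.+1.-homog.
  apply: rpred_sum => p _; apply: rpredZ.
  apply: prod_enum_homog => i; rewrite rpredD ?mpolyX1_homog // rpred_sum // => j _.
  by rewrite rpredZ // mpolyX1_homog.
pose Phi (y : 'I_#|T| -> K) := form (map_mpoly (meval y) F).
have PhiE y : Phi y = form (chart K (fun x => y (enum_rank x))).
  rewrite /Phi chartM; congr (form (chart _ _)); apply/funext => x.
  by rewrite /= mevalXU.
apply: (@irreducible_chain_lt _ V charK _ _ Phi (coords (@mpolyC _ K) F)).
- by move=> y i; apply: coordsE; [move=> c; rewrite /= mevalC | exact: chartH].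
- move=> c y; exists (fun i => if (enum_val i).2 is None then c * y i else y i).
  rewrite !PhiE -(formZ c (chartH _ _)) scaler_sumr; congr form; apply: eq_bigr => p _.
  rewrite scalerA enum_rankK /=; congr (_ *: _); apply: eq_bigr => i _; congr (_ + _).
  by apply: eq_bigr => j _; rewrite enum_rankK.
move=> e P Ph P0 L SL v vL; have [f [fl ->]] := secant_lines_form SL vL.
(* Adding [t x_0] to every factor makes all coefficients at [x_0] nonzero for general [t], hence
   leads into the chart; [t = 0] is the given point. *)
pose l p i : {mpoly {poly K}[n.+1]} := cst (nth 0 (f p) i) + 'X *: 'X_ord0.
pose a p i : {poly K} := ((nth 0 (f p) i)@_(U_(ord0)%MM))%:P + 'X.
pose G := \sum_(p < s) \prod_(i < d.+1) l p i.
have nthH p i : nth 0 (f p) i \is 1.-homog by exact: linforms_nth (fl p).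
have specl t p i : spec t (l p i) = nth 0 (f p) i + t *: 'X_ord0.
  rewrite rmorphD /= spec_cst; congr (_ + _); apply/mpolyP => m.
  by rewrite mcoeff_spec !mcoeffZ hornerM hornerX !mcoeffX hornerMn hornerC.
have specG t : spec t G = \sum_(p < s) \prod_(i < d.+1) (nth 0 (f p) i + t *: 'X_ord0).
  rewrite raddf_sum; apply: eq_bigr => p _; rewrite /= rmorph_prod.
  by apply: eq_bigr => i _; exact: specl.
have GH : G \is d.+1.-homog.
  apply: rpred_sum => p _; apply: prod_enum_homog => i.
  by rewrite rpredD ?dhomog_map // rpredZ // mpolyX1_homog.
have -> : form (prods f) = form (spec 0 G).
  rewrite specG; congr form; apply: eq_bigr => p _; rewrite (big_nth 0) big_mkord.
  have /andP[/eqP -> _] := fl p.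
  by apply: eq_bigr => i _; rewrite scale0r addr0.
apply: (eval_coord_spec0 charK (D := \prod_(p < s) \prod_(i < d.+1) a p i)) => //.
  apply/prodf_neq0 => p _; apply/prodf_neq0 => i _.
  by rewrite /a addrC -size_poly_eq0 size_XaddC.
move=> t Dt; have at0 p (i : 'I_d.+1) : (nth 0 (f p) i)@_(U_(ord0)%MM) + t != 0.
  move: Dt; rewrite horner_prod => /prodf_neq0/(_ p isT).
  by rewrite horner_prod => /prodf_neq0/(_ i isT); rewrite /a hornerD hornerX hornerC.
pose y (x : T) := if x.2 is Some (i, j)
  then ((nth 0 (f x.1) i)@_(U_(ord0)%MM) + t)^-1 * (nth 0 (f x.1) i)@_(U_(lift ord0 j)%MM)
  else \prod_(i < d.+1) ((nth 0 (f x.1) i)@_(U_(ord0)%MM) + t).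
suff -> : spec t G = chart K y.
  rewrite -[RHS](P0 (fun i => y (enum_val i))) PhiE; congr (eval_coord P (form (chart _ _))).
  by apply/funext => x; rewrite enum_rankK.
rewrite specG; apply: eq_bigr => p _; rewrite /y /= -scaler_prod; apply: eq_bigr => i _.
rewrite scalerDr scaler_sumr.
under [in RHS]eq_bigr do rewrite scalerA mulrA divff // mul1r.
have {1}-> : nth 0 (f p) i = \sum_(j < n.+1) (nth 0 (f p) i)@_(U_(j)%MM) *: 'X_j.
  apply/mpolyP => m; rewrite raddf_sum /=.
  have [m1|m1] := eqVneq (mdeg m) 1%N.
    have /eqP/mdeg1P[k /eqP ->] := m1.
    rewrite (bigD1 k) //= mcoeffZ mcoeffX eqxx mulr1 big1 ?addr0 // => j jk.
    by rewrite mcoeffZ mcoeffXU (negPf jk) mulr0.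
  rewrite (dhomog_nemf_coeff (nthH p i)) // big1 // => j _.
  rewrite mcoeffZ mcoeffX; case: eqP => [E|]; last by rewrite mulr0.
  by rewrite -E mdeg1 eqxx in m1.
by rewrite big_ord_recl scalerDl addrAC.
Qed.

End SecantLines.

(** * Terracini's principle *)

Section Exchange.
Variables (K : fieldType) (A : lmodType K).

Lemma freef_inj (I J : finType) (v : J -> A) (f : I -> J) :
  injective f -> freef v -> freef (fun i => v (f i)).
Proof.
move=> f_inj fr c cv i; have := fr (fun j => \sum_(k | f k == j) c k) _ (f i).
rewrite (big_pred1 i) => [|k]; last by rewrite /= inj_eq.
apply; rewrite -[RHS]cv [RHS](partition_big f xpredT) //=; apply: eq_bigr => j _.
by rewrite scaler_suml; apply: eq_bigr => k /eqP ->.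
Qed.

(** Steinitz exchange: the flag starts at a prescribed vector, which has to become the first of the
    independent tangent vectors. *)
Lemma freef_exchange (J : finType) (v : J -> A) k v0 : #|J| = k.+1 -> freef v -> v0 != 0 ->
  exists2 f : 'I_k.+1 -> J, injective f &
    freef (fun i => if i == ord0 then v0 else v (f i)).
Proof.
move=> cardJ fr v00; pose e i := enum_val (cast_ord (esym cardJ) i).
have e_inj : injective e by move=> i j /enum_val_inj/cast_ord_inj.
have fre := freef_inj e_inj fr.
(* It is enough that [v0] avoids the span of the vectors other than [i0]. If [v0] is outside the
   whole span any index works, otherwise one with nonzero coefficient in [v0]. *)
suff [i0 H] : exists i0, forall a (c : 'I_k.+1 -> K), a *: v0 + \sum_(i | i != i0) c i *: v (e i) = 0 -> a = 0.
  have t_inj := @perm_inj _ (tperm ord0 i0).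
  exists (fun i => e (tperm ord0 i0 i)); first by move=> i j /e_inj/t_inj.
  move=> c; rewrite (bigD1 ord0) //= => E.
  have E' : \sum_(i < k.+1 | i != ord0) c i *: (if i == ord0 then v0 else v (e (tperm ord0 i0 i)))
     = \sum_(i < k.+1 | i != i0) c (tperm ord0 i0 i) *: v (e i).
    have tE i : (tperm ord0 i0 i == ord0) = (i == i0) by rewrite -(inj_eq t_inj) tpermK tpermL.
    rewrite (reindex_inj t_inj) /=; apply: eq_big => [i|i]; rewrite tE //.
    by move=> /negPf ->; rewrite tpermK.
  have c0 : c ord0 = 0 by apply: (H _ (fun i => c (tperm ord0 i0 i))); rewrite -E' -[RHS]E.
  rewrite E' c0 scale0r add0r in E.
  have := fre (fun i => if i == i0 then 0 else c (tperm ord0 i0 i)).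
  rewrite (bigD1 i0) //= eqxx scale0r add0r.
  under eq_bigr => i /negPf ii0 do rewrite ii0.
  move=> /(_ E) H0 j; have [->|j0] := eqVneq j ord0; first exact: c0.
  have := H0 (tperm ord0 i0 j); rewrite tpermK; case: eqP => // E0.
  by case/eqP: j0; apply: t_inj; rewrite E0 tpermL.
have [[b bE]|nb] := pselect (exists b, v0 = \sum_i b i *: v (e i)); last first.
  exists ord0 => a c E; apply/eqP/negPn/negP => a0; case: nb.
  exists (fun i => if i == ord0 then 0 else - a^-1 * c i).
  rewrite (bigD1 ord0) //= scale0r add0r.
  under eq_bigr => i /negPf ii0 do rewrite ii0 mulNr scaleNr -scalerA.
  rewrite sumrN -scaler_sumr; apply: (scalerI a0); rewrite scalerN scalerA divff // scale1r.
  by apply/eqP; rewrite -addr_eq0 E.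
have [i0 bi0] : exists i0, b i0 != 0.
  apply/existsP; rewrite -negb_forall; apply: contra v00 => /forallP b0.
  by rewrite bE big1 // => i _; rewrite (eqP (b0 i)) scale0r.
exists i0 => a c E; have := fre (fun i => a * b i + (if i == i0 then 0 else c i)).
under eq_bigr do rewrite scalerDl -scalerA.
rewrite big_split /= -scaler_sumr -bE [X in _ + X](bigD1 i0) //= eqxx scale0r add0r.
under eq_bigr => i /negPf ii0 do rewrite ii0.
move=> /(_ E i0)/eqP; rewrite eqxx addr0 mulf_eq0 (negPf bi0) orbF.
by move/eqP.
Qed.

End Exchange.

(** A certificate for Terracini's principle: [M j] is a direction at the point [pt j], and there are
    as many as the expected dimension of the affine cone. Independence of the products lets the
    points span an [(s - 1)]-plane. *)
Definition indep_config (K : fieldType) (n d s : nat) : Prop :=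
  exists (L : 'I_s -> seq {mpoly K[n.+1]}) (J : finType) (pt : J -> 'I_s)
         (M : J -> seq {mpoly K[n.+1]}),
  [/\ forall p, linforms d (L p), forall j, linforms d (M j),
      #|J| = (s * (d * n + 1))%N, freef (fun p => \prod_(l <- L p) l) &
      freef (fun j => tvec (L (pt j)) (M j))].

Section Nondefective.
Variables (K : closedFieldType) (n d s : nat).
Hypothesis charK : [pchar K] =i pred0.
Local Notation V := (dhomog n.+1 K d.+1).
Local Notation crd := (coord (vbasis {:V})).
Local Notation form := (form d.+1).

(** The factors of all products are made linear in [k + 1] parameters: parameter 0 moves them along
    themselves, every other one along one direction [M j] at one point. At [e0] the sum of the
    products has the independent first order parts [w]. *)
Lemma indep_config_nondefective :
  (0 < s)%N -> indep_config K n d.+1 s -> nondefective K n d.+1 s.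
Proof.
move=> s0 [L [J [pt [M [Ll Ml cardJ Lfr Mfr]]]]].
pose k := (s * (d.+1 * n + 1)).-1.
have kE : (s * (d.+1 * n + 1))%N = k.+1 by rewrite prednK // muln_gt0 s0 addn1.
rewrite kE in cardJ.
pose ps := \sum_(p < s) \prod_(l <- L p) l.
have psh : ps \is d.+1.-homog by apply: rpred_sum => p _; apply: prod_homog.
have ps0 : ps != 0.
  apply/eqP => E; have := Lfr (fun=> 1) _ (Ordinal s0) => /(_ _)/eqP; rewrite oner_eq0 => H.
  suff : false by []. apply: H; rewrite -[RHS]E; apply: eq_bigr => p _; exact: scale1r.
have dn0 : (d.+1)%:R != 0 :> K by move/(pcharf0P K): charK => ->.
(* The derivative along parameter 0, by Euler's relation; characteristic zero keeps it nonzero. *)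
have v00 : ps *+ d.+1 != 0 by rewrite -scaler_nat scaler_eq0 negb_or dn0.
have [f f_inj wfr] := freef_exchange cardJ Mfr v00.
set w := (X in freef X) in wfr.
pose B (i : 'I_k.+1) p a := if i == ord0 then nth 0 (L p) a else
  if p == pt (f i) then nth 0 (M (f i)) a else 0.
have Bh i p a : B i p a \is 1.-homog.
  rewrite /B; case: ifP => _; first exact: linforms_nth (Ll p).
  by case: ifP => _; [exact: linforms_nth (Ml _) | exact: dhomog0].
have wE i : w i = \sum_(p < s) tsum d.+1 (nth 0 (L p)) (B i p).
  rewrite /w /B; case: eqP => _.
    rewrite /ps -sumrMnl; apply: eq_bigr => p _; rewrite tsum_same (big_nth 0) big_mkord.
    by have /andP[/eqP -> _] := Ll p.
  rewrite (bigD1 (pt (f i))) //= eqxx big1 => [|p /negPf pf]; last first.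
    by rewrite pf; exact: tsum0.
  have /andP[/eqP szL _] := Ll (pt (f i)); have /andP[/eqP szM _] := Ml (f i).
  by rewrite addr0 tvecE szL ?szM.
pose fac (A : comNzRingType) (g : K -> A) (y : 'I_k.+1 -> A) p a : {mpoly A[n.+1]} :=
  \sum_i y i *: map_mpoly g (B i p a).
pose F := \sum_(p < s) \prod_(a < d.+1) fac _ (@mpolyC k.+1 K) (fun i => 'X_i) p a.
pose fK (y : 'I_k.+1 -> K) p a := \sum_i y i *: B i p a.
have fKh y p a : fK y p a \is 1.-homog by apply: rpred_sum => i _; apply: rpredZ.
pose FK (y : 'I_k.+1 -> K) := \sum_(p < s) \prod_(a < d.+1) fK y p a.
have FE y : map_mpoly (meval y) F = FK y.
  rewrite raddf_sum; apply: eq_bigr => p _; rewrite /= rmorph_prod; apply: eq_bigr => a _.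
  rewrite /= raddf_sum; apply: eq_bigr => i _; rewrite /= map_mpolyZ; congr (_ *: _); first exact: mevalXU.
  by apply/mpolyP => m; rewrite !mcoeff_map_mpoly /= mevalC.
have Fh : F \is d.+1.-homog.
  apply: rpred_sum => p _; apply: prod_enum_homog => a; apply: rpred_sum => i _.
  by rewrite rpredZ // dhomog_map.
have FKh y : FK y \is d.+1.-homog by rewrite -FE; apply: dhomog_map.
pose Phi y := form (map_mpoly (meval y) F).
pose e0 (i : 'I_k.+1) : K := (i == ord0)%:R.
have fKe0 p a : fK e0 p a = nth 0 (L p) a.
  rewrite /fK (bigD1 ord0) //= /e0 eqxx scale1r /B eqxx big1 ?addr0 // => i /negPf ->.
  by rewrite scale0r.
have prodL p : \prod_(l <- L p) l = \prod_(a < d.+1) nth 0 (L p) a.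
  by rewrite (big_nth 0) big_mkord; have /andP[/eqP -> _] := Ll p.
pose X := [tuple form (w i) | i < k.+1].
have wh i : w i \is d.+1.-homog.
  rewrite /w; case: eqP => _; last exact: tvec_homog.
  by rewrite rpredMn.
have Xfree : free X.
  apply/freeP => c; under eq_bigr do rewrite -tnth_nth tnth_mktuple.
  rewrite -form_sum => [|i]; last exact: wh.
  move=> /eqP; rewrite form_eq0; last by apply: rpred_sum => i _; apply: rpredZ; exact: wh.
  by move/eqP/wfr.
(* There are [k + 1] independent forms, so the minimum is its first argument. *)
have minE : (minn (s * (d.+1 * n + 1)) 'C(n + d.+1, d.+1) - 1 = k)%N.
  rewrite (minn_idPl _) kE ?subn1 // -[X in (X <= _)%N](size_tuple X) -(eqP Xfree).
  by apply: leq_trans (dimvS (subvf _)) _; rewrite dimvf addnC.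
rewrite /nondefective minE.
change (has_dimension (zariski_closure (@secant_lines K n d s)) k).
split; last by move=> r /(secant_chain_lt charK); rewrite kE ltnS.
(* The functional dual to member [a] of the free family [X], in coordinates. *)
pose la a (i : 'I_(\dim {:V})) := coord X a (vbasis {:V})`_i.
have laE a (v : V) : \sum_i la a i * crd i v = coord X a v.
  rewrite [in RHS](coord_vbasis (memvf v)) linear_sum; apply: eq_bigr => i _.
  by rewrite linearZ /= mulrC.
apply: (@irreducible_chain_flag _ charK V k _ Phi (coords (@mpolyC _ K) F) d.+1 la) => //.
- by move=> y i; apply: coordsE; [move=> c; rewrite /= mevalC | exact: Fh].
- move=> c y; rewrite /Phi !FE -(formZ _ (FKh y)) scaler_sumr; congr form; apply: eq_bigr => p _.
  have -> : c ^+ d.+1 = \prod_(a < d.+1) c by rewrite prodr_const card_ord.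
  rewrite -scaler_prod; apply: eq_bigr => a _.
  by rewrite scaler_sumr; apply: eq_bigr => i _; rewrite scalerA.
- rewrite /Phi FE form_eq0 // /FK; under eq_bigr => p _ do under eq_bigr do rewrite fKe0.
  by under eq_bigr do rewrite -prodL.
- move=> y l Py LE Z [F0 F0h ->] SZ P PF0; have [e Ph] := F0h _ PF0.
  apply: (vanish_line Ph LE).
  (* The products at [y] may be dependent and span too small a plane. Moving each factor on a line
     towards [L] makes them independent for general [t]; [t = 0] is a limit. *)
  pose u p a := line (fK y p a) (nth 0 (L p) a).
  pose g t p a := fK y p a + t *: (nth 0 (L p) a - fK y p a).
  have uh p a : u p a \is 1.-homog.
    rewrite rpredD ?dhomog_map // rpredZ // dhomog_map // rpredB //.
    exact: linforms_nth (Ll p).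
  have gh t p a : g t p a \is 1.-homog.
    by rewrite rpredD // rpredZ // rpredB //; exact: linforms_nth (Ll p).
  have specu t p : spec t (\prod_(a < d.+1) u p a) = \prod_(a < d.+1) g t p a.
    by rewrite rmorph_prod; apply: eq_bigr => a _; exact: spec_line.
  pose G := \sum_(p < s) \prod_(a < d.+1) u p a.
  have specG t : spec t G = \sum_(p < s) \prod_(a < d.+1) g t p a.
    by rewrite raddf_sum; apply: eq_bigr => p _; exact: specu.
  have Gh : G \is d.+1.-homog by apply: rpred_sum => p _; apply: prod_enum_homog.
  have -> : Phi y = form (spec 0 G).
    rewrite /Phi FE specG; congr form; apply: eq_bigr => p _; apply: eq_bigr => a _.
    by rewrite /g scale0r addr0.
  have [|D D1 Dfr] := @freef_open K n.+1 _ (fun p => \prod_(a < d.+1) u p a) 1.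
    have -> // : (fun p => spec 1 (\prod_(a < d.+1) u p a)) = (fun p => \prod_(l <- L p) l).
    apply/funext => p; rewrite specu prodL; apply: eq_bigr => a _.
    by rewrite /g scale1r addrC subrK.
  apply: (eval_coord_spec0 charK (D := D)) => //.
    by apply: contra D1 => /eqP ->; rewrite horner0.
  move=> t /Dfr fr; pose ft p := [seq g t p (a : 'I_d.+1) | a <- enum 'I_d.+1].
  have ftE p : \prod_(l <- ft p) l = \prod_(a < d.+1) g t p a by rewrite big_map big_enum.
  have {}fr : freef (fun p => \prod_(l <- ft p) l).
    by move: fr; congr freef; apply/funext => p; rewrite ftE.
  have GE : spec t G = \sum_p \prod_(l <- ft p) l.
    by rewrite specG; apply: eq_bigr => p _; rewrite ftE.
  have G0 : form (spec t G) != 0.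
    rewrite form_eq0 ?dhomog_map // GE; apply/eqP => E.
    have := fr (fun=> 1) _ (Ordinal s0) => /(_ _)/eqP; rewrite oner_eq0 => H.
    suff : false by []. apply: H; rewrite -[RHS]E; apply: eq_bigr => p _; exact: scale1r.
  have SG : @secant_lines K n d s (proj_point G0).
    apply: (secant_lines_sum (f := ft)) => //; last by rewrite -GE.
    by move=> p; apply: linforms_enum.
  by apply: (SZ _ SG P) => //; exact: memv_line.
move=> z a.
pose m p b := \sum_i z i *: B i p b.
pose lc p b : {mpoly {poly K}[n.+1]} := cst (nth 0 (L p) b).
pose mc p b : {mpoly {poly K}[n.+1]} := cst (m p b).
pose x : {mpoly {poly K}[n.+1]} := 'X%:MP.
pose G := \sum_(p < s) \prod_(b < d.+1) (lc p b + x * mc p b).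
have specG t : spec t G = FK (fun j => e0 j + t * z j).
  rewrite raddf_sum; apply: eq_bigr => p _; rewrite /= rmorph_prod; apply: eq_bigr => b _.
  rewrite [LHS]spec_lin /fK; under [in RHS]eq_bigr do rewrite scalerDl -scalerA.
  by rewrite big_split /= -scaler_sumr -/(m p b) -/(fK e0 p b) fKe0.
have Gh : G \is d.+1.-homog.
  apply: rpred_sum => p _; apply: prod_enum_homog => b.
  rewrite rpredD ?dhomog_map //; first exact: linforms_nth (Ll p).
  by rewrite mul_mpolyC rpredZ // dhomog_map // rpred_sum // => i _; rewrite rpredZ.
pose T := \sum_(p < s) tsum d.+1 (nth 0 (L p)) (m p).
have G1 mu : (G@_mu)`_1 = T@_mu.
  rewrite !raddf_sum /= coef_sum; apply: eq_bigr => p _.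
  have [r ->] := prod_first_order d.+1 (lc p) (mc p) x.
  have <- : cst (\prod_(b < d.+1) nth 0 (L p) b) = \prod_(i < d.+1) lc p i.
    exact: rmorph_prod.
  have <- : cst (tsum d.+1 (nth 0 (L p)) (m p)) = tsum d.+1 (lc p) (mc p).
    exact: rmorph_tsum.
  exact: mcoeff_first_order.
have TE : T = \sum_i z i *: w i.
  rewrite /T; under [in RHS]eq_bigr do rewrite wE scaler_sumr.
  rewrite [RHS]exchange_big; apply: eq_bigr => p _; rewrite /m.
  transitivity (tsum d.+1 (nth 0 (L p)) (fun b => \sum_i (z i)%:MP * B i p b)).
    by apply: eq_tsum => // b _; apply: eq_bigr => i _; rewrite mul_mpolyC.
  by rewrite tsum_sum; apply: eq_bigr => i _; rewrite mul_mpolyC.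
have Th : T \is d.+1.-homog by rewrite TE; apply: rpred_sum => i _; apply: rpredZ; exact: wh.
exists (\sum_i (la a i)%:P * coords polyC G i); split.
  rewrite coef_sum; transitivity (\sum_i la a i * crd i (form T)).
    apply: eq_bigr => i _; rewrite coefCM; congr (_ * _).
    rewrite crd_sum coef_sum; apply: eq_bigr => mu _.
    by rewrite coefMC G1 formK.
  rewrite laE TE form_sum // linear_sum (bigD1 a) //= linearZ /=.
  have wX i : form (w i) = X`_i by rewrite -tnth_nth tnth_mktuple.
  rewrite wX coord_free // eqxx mulr1 big1 ?addr0 // => i ia.
  rewrite linearZ /= wX coord_free //; case: eqP => [E|]; last by rewrite mulr0.
  case/eqP: ia; apply/val_inj; first [exact: E|exact: (esym E)|exact: (congr1 val E)|exact: (congr1 val (esym E))].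
move=> t; rewrite horner_sum; apply: eq_bigr => i _.
by rewrite hornerM hornerC /Phi FE -specG crd_spec.
Qed.

End Nondefective.

(** * Degenerations of products to monomials *)

Local Close Scope classical_set_scope.

Section TvecLinear.
Variable A : comNzRingType.
Implicit Types (ls ms : seq A).

Lemma tvec_scale x ls ms : tvec ls [seq x * m | m <- ms] = x * tvec ls ms.
Proof.
elim: ls ms => [|l ls IHls] [|m ms] /=; rewrite ?mulr0 //.
by rewrite IHls; ring.
Qed.

Lemma tvec0 ls k : tvec ls (nseq k 0) = 0.
Proof. by elim: ls k => [|l ls IHls] [|k] //=; rewrite IHls; ring. Qed.

Lemma tvec_cat ls1 ls2 ms1 ms2 : size ms1 = size ls1 ->
  tvec (ls1 ++ ls2) (ms1 ++ ms2) =
  tvec ls1 ms1 * (\prod_(l <- ls2) l) + (\prod_(l <- ls1) l) * tvec ls2 ms2.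
Proof.
elim: ls1 ms1 => [|l ls1 IHls] [|m ms1] //=; first by rewrite big_nil mul0r mul1r add0r.
by case=> sz; rewrite IHls // big_cat big_cons /=; ring.
Qed.

Lemma tvec_head l ls k : tvec (l :: ls) (l :: nseq k 0) = \prod_(x <- l :: ls) x.
Proof. by rewrite /= tvec0 mulr0 addr0 big_cons. Qed.

End TvecLinear.

Section ConstantDirections.
Variables (K : fieldType) (n : nat).
Local Notation A := {mpoly K[n]}.
Implicit Types (ls : seq A) (v : A).

(* The span of the products of all entries of [ls] but one. *)
Definition dconst ls v := exists2 cs : seq K, size cs = size ls &
  v = tvec ls [seq c%:MP | c <- cs].

Lemma dconst_prod l ls : dconst (l :: ls) (\prod_(x <- ls) x).
Proof.
exists (1 :: nseq (size ls) 0); first by rewrite /= size_nseq.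
by rewrite /= map_nseq mpolyC0 tvec0 mulr0 addr0 mpolyC1 mul1r.
Qed.

Lemma dconst_cons l ls v : dconst ls v -> dconst (l :: ls) (l * v).
Proof.
by case=> cs sz ->; exists (0 :: cs); rewrite /= ?sz // mpolyC0 mul0r add0r.
Qed.

Lemma dconst_cat ls1 ls2 v : dconst ls1 v -> dconst (ls1 ++ ls2) (v * \prod_(l <- ls2) l).
Proof.
case=> cs sz ->; exists (cs ++ nseq (size ls2) 0); first by rewrite !size_cat size_nseq sz.
by rewrite map_cat tvec_cat ?size_map // map_nseq mpolyC0 tvec0 mulr0 addr0.
Qed.

Lemma dconst_catl ls1 ls2 v : dconst ls2 v -> dconst (ls1 ++ ls2) (\prod_(l <- ls1) l * v).
Proof.
elim: ls1 => [|l ls1 IHls] H /=; first by rewrite big_nil mul1r.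
by rewrite big_cons -mulrA; apply/dconst_cons/IHls.
Qed.

Lemma dconst_lin ls a u v : dconst ls u -> dconst ls v -> dconst ls (a *: u + v).
Proof.
case=> cs sz -> [cs' sz' ->].
elim: ls cs cs' sz sz' => [|l ls IHls] [|c cs] [|c' cs'] //=; first by exists [::]; rewrite //= scaler0 addr0.
move=> [sz] [sz']; have [es szs E] := IHls _ _ sz sz'.
exists (a * c + c' :: es); rewrite /= ?szs // -E mpolyCD mpolyCM -!mul_mpolyC.
by ring.
Qed.

Lemma dconst0 ls : dconst ls 0.
Proof.
by exists (nseq (size ls) 0); rewrite ?size_nseq // map_nseq mpolyC0 tvec0.
Qed.

Variables (X Y : A).
Local Notation blk cs := [seq X + c *: Y | c <- cs].

(* Two factors [l = X + c Y] and [l' = X + c' Y] span [X] and [Y]. *)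
Lemma dconst_extend c cs v : c \notin cs -> dconst (blk cs) v ->
  dconst (blk (c :: cs)) (Y * v).
Proof.
move=> ncs [es sz ->] /=.
elim: cs es ncs sz => [|c' cs IHcs] [|e es] //=; first by rewrite mulr0 => _ _; exact: dconst0.
rewrite inE negb_or => /andP[cc' ncs] [sz].
have [fs fsz E] := IHcs _ ncs sz.
have dl : dconst [:: X + c *: Y, X + c' *: Y & blk cs] ((X + c' *: Y) * (Y * tvec (blk cs) [seq x%:MP | x <- es])).
  case: fs fsz E => [//|f fs] [fsz] /= E.
  exists [:: f, 0 & fs]; first by rewrite /= fsz.
  by rewrite /= big_cons E mpolyC0; ring.
have dp : dconst [:: X + c *: Y, X + c' *: Y & blk cs] (Y * \prod_(x <- blk cs) x).
  exists [:: - (c - c')^-1, (c - c')^-1 & nseq (size cs) 0].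
    by rewrite /= size_nseq size_map.
  rewrite /= map_nseq mpolyC0 tvec0 mulr0 addr0 big_cons.
  transitivity (((c - c')^-1 * (c - c')) *: (Y * \prod_(x <- blk cs) x)).
    by rewrite mulVf ?scale1r // subr_eq0.
  rewrite -!mul_mpolyC mpolyCM mpolyCB mpolyCN; ring.
have := dconst_lin e dp dl; congr dconst.
by rewrite -!mul_mpolyC; ring.
Qed.

(** For distinct constants the products omitting one factor are the Lagrange basis of binary forms
    in [X] and [Y], so they reach every monomial. *)
Lemma dconst_monomial cs i : uniq cs -> (i < size cs)%N ->
  dconst (blk cs) (X ^+ (size cs - i.+1) * Y ^+ i).
Proof.
elim: cs i => [//|c cs IHcs] i /= /andP[ncs ucs] ilt.
case: cs ncs ucs ilt IHcs => [|c' cs] ncs ucs ilt IHcs.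
  case: i ilt => // _; rewrite subnn mul1r expr0.
  by have := dconst_prod (X + c *: Y) [::]; rewrite big_nil.
case: i ilt => [|i] ilt; last first.
  rewrite subSS [Y ^+ i.+1]exprS mulrCA; apply: (@dconst_extend c (c' :: cs)) => //.
  exact: IHcs.
rewrite subSS subn0 mulr1; have H0 := IHcs 0%N ucs (ltn0Sn _).
rewrite subn1 /= mulr1 in H0.
have := dconst_lin (- c) (@dconst_extend c (c' :: cs) _ ncs H0) (dconst_cons (X + c *: Y) H0).
by congr dconst; rewrite mulrDl scaleNr scalerAl addrCA addNr addr0 -exprS.
Qed.

End ConstantDirections.

Lemma dconst_flatten (K : fieldType) n (I : eqType) (F : I -> seq {mpoly K[n]}) s a v :
  uniq s -> a \in s -> dconst (F a) v ->
  dconst (flatten [seq F x | x <- s]) ((\prod_(x <- s | x != a) \prod_(l <- F x) l) * v).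
Proof.
elim: s => [//|x s IHs] /= /andP[xs us]; rewrite inE big_cons.
have [xa _ Hv|xa /= as_ Hv] := eqVneq x a.
  have -> : \prod_(y <- s | y != a) \prod_(l <- F y) l = \prod_(l <- flatten [seq F y | y <- s]) l.
    rewrite big_flatten big_map big_seq_cond [RHS]big_seq; apply: eq_bigl => y.
    by case ys: (y \in s) => //=; apply: contraNneq xs => ya; rewrite xa -ya.
  by rewrite xa mulrC; exact: dconst_cat.
by rewrite -mulrA; apply/dconst_catl/IHs.
Qed.

(** * Monomials as limits of products of linear forms *)

Section MonomialPoint.
Variables (n : nat) (b : 'I_n -> 'I_n).
Implicit Types (al : 'X_{1..n}) (a : 'I_n).

Definition mblock (R : comNzRingType) (tau : R) al a : seq {mpoly R[n]} :=
  [seq 'X_a + (tau * c%:R) *: 'X_(b a) | c <- iota 0 (al a)].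

Definition mpoint (R : comNzRingType) (tau : R) al : seq {mpoly R[n]} :=
  flatten [seq mblock tau al a | a <- enum 'I_n].

(* A combination of the partial products of [mpoint tau al]; for [tau = 0] it is
   the monomial of exponent [mpartial_lead al a i]. *)
Definition mpartial (R : comNzRingType) (tau : R) al a i : {mpoly R[n]} :=
  (\prod_(x | x != a) \prod_(l <- mblock tau al x) l) *
  ('X_a ^+ (al a - i.+1) * 'X_(b a) ^+ i).

Definition mpartial_lead al a i : 'X_{1..n} :=
  (al - U_(a) *+ i.+1 + U_(b a) *+ i)%MM.

Section Map.
Variables (R R' : comNzRingType) (f : {rmorphism R -> R'}).

Lemma map_mblock tau al a :
  [seq map_mpoly f l | l <- mblock tau al a] = mblock (f tau) al a.
Proof.
rewrite -map_comp; apply: eq_map => c /=.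
by rewrite rmorphD /= map_mpolyZ !map_mpolyX rmorphM rmorph_nat.
Qed.

Lemma map_mpoint tau al : [seq map_mpoly f l | l <- mpoint tau al] = mpoint (f tau) al.
Proof.
rewrite map_flatten -map_comp; congr flatten; apply: eq_map => a.
exact: map_mblock.
Qed.

Lemma map_mpartial tau al a i :
  map_mpoly f (mpartial tau al a i) = mpartial (f tau) al a i.
Proof.
rewrite /mpartial !rmorphM !rmorphXn /= !map_mpolyX rmorph_prod; congr (_ * _).
by apply: eq_bigr => x _; rewrite /= rmorph_prod -map_mblock big_map.
Qed.

End Map.

Lemma mpoint_linforms (R : comNzRingType) (tau : R) al : linforms (mdeg al) (mpoint tau al).
Proof.
rewrite /linforms size_flatten /shape -map_comp sumnE big_map big_enum /=.
rewrite mdegE; apply/andP; split.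
  by apply/eqP/eq_bigr => a _; rewrite /= size_map size_iota.
apply/allP => l /flatten_mapP[a _ /mapP[c _ ->]].
by rewrite rpredD ?mpolyX1_homog // rpredZ // mpolyX1_homog.
Qed.

Lemma mpointP (R : comNzRingType) (tau : R) al l : l \in mpoint tau al ->
  exists a c, (0 < al a)%N /\ l = 'X_a + c *: 'X_(b a).
Proof.
move=> /flatten_mapP[a _ /mapP[c]]; rewrite mem_iota => /andP[_ clt] ->.
by exists a, (tau * c%:R); split=> //; exact: leq_ltn_trans clt.
Qed.

Lemma mblock0 (R : comNzRingType) al a :
  \prod_(l <- mblock (0 : R) al a) l = 'X_a ^+ al a.
Proof.
rewrite big_map; under eq_bigr do rewrite mul0r scale0r addr0.
by rewrite big_const_seq count_predT size_iota -Monoid.iteropE.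
Qed.

Lemma mpoint0 (R : comNzRingType) al : \prod_(l <- mpoint (0 : R) al) l = 'X_[al].
Proof.
rewrite big_flatten big_map big_enum mpolyXE_id /=.
by apply: eq_bigr => a _; rewrite mblock0.
Qed.

Lemma mpartial0 (R : comNzRingType) al a i : (i < al a)%N ->
  mpartial (0 : R) al a i = 'X_[mpartial_lead al a i].
Proof.
move=> ia; rewrite /mpartial mpolyXD -!mpolyXn mulrA; congr (_ * _).
rewrite [in RHS]mpolyXE_id [RHS](bigD1 a) //= mulrC; congr (_ * _).
  by rewrite mnmBE mulmnE mnm1E eqxx mul1n.
apply: eq_bigr => x xa; rewrite mblock0 mnmBE mulmnE mnm1E eq_sym (negPf xa).
by rewrite mul0n subn0.
Qed.

Variable K : fieldType.
Hypothesis charK : [pchar K] =i pred0.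

Lemma dconst_mpartial (t : K) al a i : t != 0 -> (i < al a)%N ->
  dconst (mpoint t al) (mpartial t al a i).
Proof.
move=> t0 ia; rewrite /mpartial.
have <- : \prod_(x <- enum 'I_n | x != a) \prod_(l <- mblock t al x) l =
    \prod_(x | x != a) \prod_(l <- mblock t al x) l by rewrite big_enum_cond.
apply: dconst_flatten; rewrite ?enum_uniq ?mem_enum //.
have -> : mblock t al a = [seq 'X_a + c *: 'X_(b a) | c <- [seq t * c%:R | c <- iota 0 (al a)]].
  by rewrite -map_comp.
have sz : al a = size [seq t * c%:R | c <- iota 0 (al a)] by rewrite size_map size_iota.
rewrite {2}sz; apply: dconst_monomial; last by rewrite -sz.
rewrite map_inj_uniq ?iota_uniq // => x y /(mulfI t0).
exact: natr_inj_pchar0.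
Qed.

End MonomialPoint.

Section Moves.
Variables (n d : nat) (b : 'I_n -> 'I_n) (Q : pred 'I_n).
Hypothesis bP : forall a, b a != a.
Implicit Types (al : 'X_{1..n}) (a j : 'I_n).

(** [None] is the point itself; [Some (a, j, i)] is partial product [i] of the block of [x_a], times
    [x_j]. Validity excludes [j = a]: those products give way to the single [None], leaving
    [1 + (#|Q| - 1) d] vectors. *)
Definition move : finType := option ('I_n * 'I_n * 'I_d).

Definition valid_move al (x : move) : bool :=
  if x is Some (a, j, i) then [&& Q j, j != a & (i < al a)%N] else true.

Definition move_lead al (x : move) : 'X_{1..n} :=
  if x is Some (a, j, i) then (mpartial_lead b al a i + U_(j))%MM else al.

Definition move_vec (R : comNzRingType) (tau : R) al (x : move) : {mpoly R[n]} :=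
  if x is Some (a, j, i) then mpartial b tau al a i * 'X_j
  else \prod_(l <- mpoint b tau al) l.

Lemma map_move_vec (R R' : comNzRingType) (f : {rmorphism R -> R'}) tau al x :
  map_mpoly f (move_vec tau al x) = move_vec (f tau) al x.
Proof.
case: x => [[[a j] i]|] /=; first by rewrite rmorphM /= map_mpolyX map_mpartial.
by rewrite rmorph_prod -map_mpoint big_map.
Qed.

Lemma move_vec0 (R : comNzRingType) al x : valid_move al x ->
  move_vec (0 : R) al x = 'X_[move_lead al x].
Proof.
case: x => [[[a j] i]|] /=; last by rewrite mpoint0.
by case/and3P => _ _ ia; rewrite mpartial0 // -mpolyXD.
Qed.

Lemma move_leadE al a j (i : 'I_d) x :
  move_lead al (Some (a, j, i)) x =
  (al x - (a == x) * i.+1 + (b a == x) * i + (j == x))%N.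
Proof. by rewrite /= /mpartial_lead !mnmDE mnmBE !mulmnE !mnm1E. Qed.

(** [x_a] is the only variable whose exponent drops, by [i + 1]; with [a] and [i] known, the
    remaining factor is [x_j]. *)
Lemma move_lead_inj al x y : valid_move al x -> valid_move al y ->
  move_lead al x = move_lead al y -> x = y.
Proof.
have lta a j (i : 'I_d) : j != a -> (i < al a)%N -> (move_lead al (Some (a, j, i)) a < al a)%N.
  move=> /negPf ja ia; rewrite move_leadE eqxx (negPf (bP a)) ja; lia.
case: x y => [[[a j] i]|] [[[a' j'] i']|] //.
- case/and3P => Qj ja ia /and3P[Qj' ja' ia'] E.
  have aa : a = a'.
    apply/eqP; apply: contraTT (lta _ _ _ ja ia) => naa.
    by rewrite E move_leadE eq_sym (negPf naa); lia.
  subst a'; have /eqP := congr1 (fun m : 'X_{1..n} => m a) E.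
  rewrite !move_leadE eqxx (negPf (bP a)) (negPf ja) (negPf ja') => ii.
  have {}ii : i = i' by apply/val_inj => /=; lia.
  subst i'; congr (Some (_, _, _)).
  have /eqP := congr1 (fun m : 'X_{1..n} => m j) E.
  by rewrite !move_leadE eqn_add2l eqxx; case: (eqVneq j' j).
- case/and3P => _ ja ia _ E; have := lta _ _ _ ja ia.
  by rewrite E ltnn.
- move=> _ /and3P[_ ja ia] E; have := lta _ _ _ ja ia.
  by rewrite -E ltnn.
Qed.

Lemma card_moves al : (mdeg al = d)%N -> (forall a, (0 < al a)%N -> Q a) ->
  #|[pred x | valid_move al x]| = (1 + (#|Q| - 1) * d)%N.
Proof.
move=> ald alQ; have al_le a : (al a <= d)%N by rewrite -ald mdegE (bigD1 a) //= leq_addr.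
have -> : #|[pred x | valid_move al x]| = (\sum_(x : move) valid_move al x)%N.
  by rewrite -sum1_card big_mkcond; apply: eq_bigr => x _; rewrite inE /=; case: valid_move.
rewrite -[index_enum _]/(index_enum _) (bigD1 None) //=; congr (_ + _)%N.
rewrite (reindex_omap (@Some ('I_n * 'I_n * 'I_d)) id) => [|[x|]] //=.
rewrite (eq_bigl xpredT) => [|x]; last by rewrite eqxx.
rewrite (eq_bigr (fun u : 'I_n * 'I_n * 'I_d => [&& Q u.1.2, u.1.2 != u.1.1 &
  (u.2 < al u.1.1)%N] : nat)); last by case=> [[? ?] ?].
rewrite -(pair_bigA _ (fun (u : 'I_n * 'I_n) (i : 'I_d) => [&& Q u.2, u.2 != u.1 & (i < al u.1)%N] : nat)) /=.
rewrite -(pair_bigA _ (fun a j : 'I_n => \sum_(i < d) ([&& Q j, j != a & (i < al a)%N] : nat))%N) /=.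
rewrite -[X in _ = (_ * X)%N]ald mdegE big_distrr /=; apply: eq_bigr => a _.
have si : (\sum_(i < d) (i < al a) = al a)%N.
  rewrite -(big_mkord xpredT (fun i => (i < al a)%N : nat)) (big_cat_nat _ (al_le a)) //=.
  have -> : (\sum_(al a <= i < d) (i < al a) = 0)%N.
    by rewrite big_nat big1 // => i /andP[ai _]; rewrite ltnNge ai.
  rewrite addn0.
  rewrite big_nat (eq_bigr (fun=> 1%N)) => [|i /andP[_ ->]] //.
  by rewrite -big_nat sum_nat_const_nat muln1 subn0.
have [->|ala] := posnP (al a).
  by rewrite muln0 big1 // => j _; rewrite big1 // => i _; rewrite ltn0 !andbF.
transitivity (\sum_(j | Q j && (j != a)) al a)%N.
  rewrite [RHS]big_mkcond; apply: eq_bigr => j _; case: ifP => jQ.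
    by apply: etrans si; apply: eq_bigr => i _; rewrite andbA jQ.
  by rewrite big1 // => i _; rewrite andbA jQ.
rewrite sum_nat_const; congr (_ * _)%N.
have Qa : a \in Q by exact: alQ.
rewrite [#|Q|](cardD1 a) Qa add1n subn1 /=.
by apply: eq_card => j; rewrite !inE andbC.
Qed.

Variable K : fieldType.
Hypothesis charK : [pchar K] =i pred0.

(** [P] is a property of the directions, such as lying on a hyperplane, that must be kept when a
    combination is written as one tangent vector. *)
Lemma move_vec_dir (P : {mpoly K[n]} -> Prop) (t : K) al x :
  mdeg al = d -> (0 < d)%N -> t != 0 -> valid_move al x ->
  (forall j c, Q j -> P (c *: 'X_j)) -> P 0 -> (forall l, l \in mpoint b t al -> P l) ->
  exists ms, [/\ linforms d ms, forall m, m \in ms -> P m &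
    move_vec t al x = tvec (mpoint b t al) ms].
Proof.
move=> ald d0 t0 vx PX P0 Pl; have := mpoint_linforms b t al; rewrite ald => pl.
case: x vx => [[[a j] i]|] /=.
  case/and3P => Qj ja ia; have [cs sz ->] := dconst_mpartial b charK t0 ia.
  exists [seq c *: 'X_j | c <- cs]; split.
  - rewrite /linforms size_map sz; have /andP[-> _] := pl.
    by apply/allP => _ /mapP[c _ ->]; rewrite rpredZ // mpolyX1_homog.
  - by move=> _ /mapP[c _ ->]; apply: PX.
  rewrite mulrC -tvec_scale -map_comp; congr tvec; apply: eq_map => c /=.
  by rewrite mulrC mul_mpolyC.
move=> _; case: (mpoint b t al) pl Pl => [|l ls] pl Pl.
  by move: d0; case/andP: pl => /eqP <-.
(* The product is its own derivative when the first factor moves along itself. *)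
exists (l :: nseq (size ls) 0); split; last by rewrite tvec_head.
  case/andP: pl => /= sz /andP[l1 _]; rewrite /linforms /= size_nseq sz l1 /=.
  by apply/allP => m /nseqP[-> _]; exact: dhomog0.
move=> m; rewrite inE => /orP[/eqP ->|/nseqP[-> _]] //.
by apply: Pl; rewrite mem_head.
Qed.

End Moves.

Lemma common_nonroot (K : fieldType) (D1 D2 : {poly K}) : [pchar K] =i pred0 ->
  D1 != 0 -> D2 != 0 -> exists t, [/\ t != 0, D1.[t] != 0 & D2.[t] != 0].
Proof.
move=> charK D10 D20; have : 'X * D1 * D2 != 0 by rewrite !mulf_neq0 // polyX_eq0.
case/(poly_nonroot charK) => t; rewrite !hornerM hornerX !mulf_eq0 !negb_or.
by case/andP => /andP[? ?] ?; exists t.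
Qed.

Lemma horner_neq0 (K : fieldType) (D : {poly K}) t : D.[t] != 0 -> D != 0.
Proof. by apply: contra => /eqP ->; rewrite horner0. Qed.

Lemma eq_freef (K : fieldType) (A : lmodType K) (J : finType) (u v : J -> A) :
  u =1 v -> freef v -> freef u.
Proof. by move=> /funext ->. Qed.

(** At [t = 0] the factors of a block coincide and the tangent spaces may shrink, but the chosen
    tangent vectors tend to distinct monomials. Their independence passes to general [t], taken
    nonzero so that they are tangent. *)
Lemma good_family_config (K : fieldType) n d s (b : 'I_n.+1 -> 'I_n.+1)
    (al : 'I_s -> 'X_{1..n.+1}) :
  [pchar K] =i pred0 -> (0 < d)%N -> (forall a, b a != a) -> (forall p, mdeg (al p) = d) ->
  (forall p q (x y : move n.+1 d), valid_move predT (al p) x -> valid_move predT (al q) y ->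
     move_lead b (al p) x = move_lead b (al q) y -> p = q) ->
  indep_config K n d s.
Proof.
move=> charK d0 bP ald good.
pose J : finType := {u : 'I_s * move n.+1 d | valid_move predT (al u.1) u.2}.
pose V (R : comNzRingType) (tau : R) (u : J) := move_vec b tau (al (val u).1) (val u).2.
pose W (R : comNzRingType) (tau : R) p := \prod_(l <- mpoint b tau (al p)) l.
have specV t u : spec t (V {poly K} 'X u) = V K t u.
  by rewrite /spec map_move_vec /= horner_evalE hornerX.
have specW t p : spec t (W {poly K} 'X p) = W K t p.
  by rewrite /spec rmorph_prod /W -(big_map (map_mpoly (horner_eval t)) xpredT id)
    map_mpoint /= horner_evalE hornerX.
have [|D1 D10 D1fr] := @freef_open K n.+1 J (V {poly K} 'X) 0.
  apply: (eq_freef (v := fun u : J => 'X_[move_lead b (al (val u).1) (val u).2])).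
    by move=> u; rewrite specV /V (move_vec0 b _ (valP u)).
  apply: freef_monomials => u v E.
  have vu := valP u; have vv := valP v; have pq := good _ _ _ _ vu vv E.
  apply/val_inj; case: (val u) (val v) pq vu vv E => [p x] [q y] /= <- vu vv E.
  by congr pair; apply: (move_lead_inj bP vu vv E).
have [|D2 D20 D2fr] := @freef_open K n.+1 _ (W {poly K} 'X) 0.
  apply: (eq_freef (v := fun p => 'X_[al p])).
    by move=> p; rewrite specW /W mpoint0.
  by apply: freef_monomials => p q E; apply: (good p q None None).
have [t [t0 D1t D2t]] := common_nonroot charK (horner_neq0 D10) (horner_neq0 D20).
have /choice[M MP] : forall u : J, exists ms,
    linforms d ms /\ V K t u = tvec (mpoint b t (al (val u).1)) ms.
  move=> u; have [//|//|//|ms [msl _ E]] :=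
    @move_vec_dir _ _ b predT K charK (fun=> True) t _ _ (ald (val u).1) d0 t0 (valP u).
  by exists ms.
exists (fun p => mpoint b t (al p)), J, (fun u => (val u).1), M; split.
- by move=> p; rewrite -(ald p); apply: mpoint_linforms.
- by move=> u; have [] := MP u.
- rewrite card_sig -sum1_card big_mkcond /=.
  rewrite -(pair_bigA _ (fun p x => if valid_move predT (al p) x then 1 else 0)%N) /=.
  rewrite (eq_bigr (fun=> 1 + n * d)%N) => [|p _].
    by rewrite sum_nat_const card_ord addnC [(n * d)%N]mulnC.
  by rewrite -big_mkcond sum1_card card_moves // card_ord subn1.
- by apply: eq_freef (D2fr _ D2t) => p; rewrite specW.
- by apply: eq_freef (D1fr _ D1t) => u; rewrite specV; have [_ ->] := MP u.
Qed.

(** * Packings of monomials *)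

Local Open Scope nat_scope.

(** The powers of 2 form a Sidon set: the largest of the four exponents must occur on both sides. *)
Lemma sum2_expn2 a b c d : 2 ^ a + 2 ^ b = 2 ^ c + 2 ^ d ->
  (a = c /\ b = d) \/ (a = d /\ b = c).
Proof.
wlog ab : a b / a <= b => [H|].
  have [/H//|/ltnW/H{}H] := leqP a b.
  by rewrite addnC => /H; case=> [] [-> ->]; [right|left].
wlog cd : c d / c <= d => [H|].
  have [/H//|/ltnW/H{}H] := leqP c d.
  by rewrite [in X in _ = X]addnC => /H; case=> [] [-> ->]; [right|left].
wlog bd : a b c d ab cd / d <= b => [H|].
  have [/(H _ _ _ _ ab cd)//|/ltnW/(H _ _ _ _ cd ab){}H] := leqP d b.
  by move/esym/H; case=> [] [-> ->]; [left|right].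
have [bd'|bd' E] := eqVneq b d.
  by rewrite bd' => /addIn/eqP; rewrite eqn_exp2l // => /eqP ->; left.
have lt_db : d < b by rewrite ltn_neqAle eq_sym bd' bd.
have : 2 ^ d.+1 <= 2 ^ b by rewrite leq_exp2l.
have : 2 ^ c <= 2 ^ d by rewrite leq_exp2l.
have : 0 < 2 ^ a by rewrite expn_gt0.
by rewrite expnS; lia.
Qed.

Lemma pigeonhole (T : finType) (h : T -> nat) q s : (forall x, h x < q) ->
  q * s < #|T| -> exists (r : nat) (f : 'I_s.+1 -> T), injective f /\ forall i, h (f i) = r.
Proof.
move=> hq card.
have [r rP|no] := pickP [pred r : 'I_q | s < #|[pred x | h x == r]|].
  exists r, (fun i => enum_val (widen_ord rP i)); split.
    by move=> i j /enum_val_inj/(congr1 val)/= ij; apply/val_inj.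
  by move=> i; have := enum_valP (widen_ord rP i); rewrite inE => /eqP.
move: card; rewrite ltnNge; case/negP.
rewrite -sum1_card (partition_big (fun x => Ordinal (hq x)) xpredT) //=.
apply: leq_trans (_ : \sum_(r < q) s <= _); last by rewrite sum_nat_const card_ord.
apply: leq_sum => r _; have := no r; rewrite /= ltnNge => /negbFE; apply: leq_trans.
by rewrite -sum1_card; apply: eq_leq; apply: eq_bigl => x; rewrite inE -val_eqE.
Qed.

(** * Exponents supported on pairs of variables *)

Section Pairs.
Variables (n N : nat).
Hypotheses (N2 : 1 < N) (Nn : N.*2 <= n.+1).
Implicit Types (x a j : 'I_n.+1).

(** Exchanges [2 e] and [2 e + 1]. Variables outside the pairs go to 0 so that [partner x != x]
    holds for them too. *)
Definition partner x : 'I_n.+1 :=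
  inord (if x < N.*2 then if odd x then x.-1 else x.+1 else 0).

Lemma partnerE x : x < N.*2 -> partner x = (if odd x then x.-1 else x.+1) :> nat.
Proof.
move=> xN; rewrite /partner xN inordK //; case: ifP => ox; first by case: x xN ox => x /=; lia.
by have := odd_double_half x; rewrite ox; lia.
Qed.

Lemma partner_neq x : partner x != x.
Proof.
rewrite -val_eqE /=; have [xN|xN] := ltnP x N.*2.
  by rewrite partnerE //; case: ifP => ox; case: (val x) ox => //=; lia.
by rewrite /partner ltnNge xN /= inordK //; lia.
Qed.

Definition pair_sum (m : 'X_{1..n.+1}) e := m (inord e.*2) + m (inord e.*2.+1).

Variable d : nat.
Implicit Type y : move n.+1 d.

(** The pairs losing and gaining a unit; [None] counts as a move within pair 0. A value of [dst]
    from [N] on stands for a variable outside the pairs. *)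
Definition src y := if y is Some (a, j, i) then (a : nat)./2 else 0.
Definition dst y := if y is Some (a, j, i) then (j : nat)./2 else 0.

Definition paired (m : 'X_{1..n.+1}) := forall x, N.*2 <= x -> m x = 0.

Lemma src_lt m y : paired m -> valid_move predT m y -> src y < N.
Proof.
case: y => [[[a j] i]|] /=; last by lia.
move=> pm /andP[_ ia]; have [|/pm] := ltnP a N.*2; last by lia.
by rewrite ltn_half_double.
Qed.

(** Powers pass from [x_a] to its partner within a pair, so the sums change only by the loss of one
    [x_a] and the factor [x_j]. *)
Lemma pair_sum_lead m y e : paired m -> valid_move predT m y -> e < N ->
  pair_sum (move_lead partner m y) e + (src y == e) = pair_sum m e + (dst y == e).
Proof.
move=> pm vy eN; case: y vy => [[[a j] i]|] vy //=; rewrite /pair_sum !move_leadE.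
have aN : a < N.*2 by have := src_lt pm vy; rewrite /= ltn_half_double.
move: vy => /= /andP[ja ia].
set A0 := inord e.*2 : 'I_n.+1; set A1 := inord e.*2.+1 : 'I_n.+1.
have A0E : A0 = e.*2 :> nat by rewrite inordK //; lia.
have A1E : A1 = e.*2.+1 :> nat by rewrite inordK //; lia.
have jE : (j == A0) + (j == A1) = (j./2 == e) by rewrite -!val_eqE /= A0E A1E; lia.
have aE : (a == A0) + (a == A1) = (a./2 == e) by rewrite -!val_eqE /= A0E A1E; lia.
have pE := partnerE aN; rewrite -jE -aE.
have [aA0|aA0] := eqVneq a A0.
  rewrite aA0 A0E odd_double in pE.
  have -> : (a == A1) = false by rewrite -val_eqE /= aA0 A0E A1E; lia.
  have -> : (partner a == A0) = false by rewrite -val_eqE /= aA0 pE A0E; lia.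
  have -> : (partner a == A1) by rewrite -val_eqE /= aA0 pE A1E; lia.
  move: ia; rewrite aA0; move: (m A0) (m A1) (j == A0) (j == A1) => u v p q; lia.
have [aA1|aA1] := eqVneq a A1.
  rewrite aA1 A1E /= odd_double /= in pE.
  have -> : (partner a == A1) = false by rewrite -val_eqE /= aA1 pE A1E; lia.
  have -> : (partner a == A0) by rewrite -val_eqE /= aA1 pE A0E; lia.
  move: ia; rewrite aA1; move: (m A0) (m A1) (j == A0) (j == A1) => u v p q; lia.
have -> : (partner a == A0) = false.
  apply/negbTE; move: (odd_double_half a) aA0 aA1; rewrite -!val_eqE /= pE A0E A1E.
  by case: (odd a) => /=; move: (a./2) (nat_of_ord a) => h v; clear; lia.
have -> : (partner a == A1) = false.
  apply/negbTE; move: (odd_double_half a) aA0 aA1; rewrite -!val_eqE /= pE A0E A1E.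
  by case: (odd a) => /=; move: (a./2) (nat_of_ord a) => h v; clear; lia.
by rewrite !mul0n !subn0 !addn0; move: (m A0) (m A1) (j == A0) (j == A1) => u v p q; lia.
Qed.

End Pairs.

Lemma eqmod_small q x y lo : x = y %[mod q] -> lo <= x < lo + q -> lo <= y < lo + q -> x = y.
Proof.
wlog xy : x y / x <= y => [H|].
  by have [/H//|/ltnW/H{}H] := leqP x y => /esym/H{}H bx /H ->.
move/esym/eqP; rewrite eqn_mod_dvd // => /dvdnP[[|k] E]; first by move: E; lia.
by move: E; rewrite mulSn => E; move: (k * q) E => u; lia.
Qed.

Section PairedGood.
Variables (n N d : nat).
Hypotheses (N2 : 1 < N) (Nn : N.*2 <= n.+1).
Implicit Types (m : 'X_{1..n.+1}) (y : move n.+1 d).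
Local Notation partner := (@partner n N).
Local Notation paired := (@paired n N).

(* A leading monomial changes two of the sums [pair_sum m e] by at most 1, and the
   differences [2 ^ e - 2 ^ e'] determine [e] and [e'], even modulo [2 ^ N - 1]. *)
Definition pair_hash m := \sum_(e < N) 2 ^ e * pair_sum m e.

Lemma sum_pow_indic (k : nat) : \sum_(e < N) 2 ^ e * (k == e) = (if k < N then 2 ^ k else 0).
Proof.
case: ifP => kN.
  rewrite (bigD1 (Ordinal kN)) //= eqxx muln1 big1 ?addn0 // => e.
  by rewrite -val_eqE eq_sym /= => /negPf ->; rewrite muln0.
rewrite big1 // => e _; case: eqP => [ke|_]; last by rewrite muln0.
by rewrite ke ltn_ord in kN.
Qed.

(** A variable outside the pairs is absent from [m] and [m']; its exponent 1 in the common monomial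
    reveals it. *)
Lemma dst_large m m' y y' : paired m -> paired m' ->
  valid_move predT m y -> valid_move predT m' y' ->
  move_lead partner m y = move_lead partner m' y' -> N <= dst y -> dst y' = dst y.
Proof.
move=> pm pm' vy vy'; case: y vy => [[[a j] i]|] vy E /=; last by lia.
rewrite geq_half_double => jN; have aN := src_lt N2 Nn pm vy; rewrite /= ltn_half_double in aN.
have /eqP := congr1 (fun u : 'X_{1..n.+1} => u j) E.
have nj (a' : 'I_n.+1) : a' < N.*2 -> (a' == j) = false.
  by move=> a'N; apply/negbTE; rewrite -val_eqE /=; lia.
have pN (a' : 'I_n.+1) : a' < N.*2 -> partner a' < N.*2.
  by move=> a'N; rewrite partnerE //; have := odd_double_half a'; case: odd => /=; lia.
rewrite move_leadE (nj a) // (nj (partner a)) ?pN // eqxx.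
case: y' vy' E => [[[a' j'] i']|] vy' E; last by rewrite /= pm' // addn1.
have aN' := src_lt N2 Nn pm' vy'; rewrite /= ltn_half_double in aN'.
rewrite move_leadE (nj a') // (nj (partner a')) ?pN // pm' // pm //=.
by case: (eqVneq j' j) => [->|].
Qed.

(** If both destinations are pairs, weighting by [2 ^ e] gives [2 ^ dst y + 2 ^ src y' = 2 ^ dst y'
    + 2 ^ src y] modulo [2 ^ N - 1]. Both sides lie between 2 and [2 ^ N], exactly one period, so
    they are equal and the Sidon property applies. *)
Lemma paired_good m m' y y' : paired m -> paired m' ->
  valid_move predT m y -> valid_move predT m' y' ->
  move_lead partner m y = move_lead partner m' y' ->
  pair_hash m = pair_hash m' %[mod (2 ^ N).-1] ->
  (forall e, e < N -> pair_sum m e = pair_sum m' e) /\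
  ((src y = src y' /\ dst y = dst y') \/ (src y = dst y /\ src y' = dst y')).
Proof.
move=> pm pm' vy vy' E hm.
have star e : e < N -> pair_sum m e + ((dst y == e) + (src y' == e)) =
    pair_sum m' e + ((dst y' == e) + (src y == e)).
  move=> eN; have := pair_sum_lead N2 Nn pm vy eN; have := pair_sum_lead N2 Nn pm' vy' eN.
  by rewrite E; lia.
suff H : (src y = src y' /\ dst y = dst y') \/ (src y = dst y /\ src y' = dst y').
  split=> // e eN; have := star e eN.
  by case: H => [] [-> ->]; lia.
(* A destination outside the pairs adds nothing to the hash. *)
pose D k := if k < N then 2 ^ k else 0.
have sN := src_lt N2 Nn pm vy; have sN' := src_lt N2 Nn pm' vy'.
have hE : pair_hash m + (D (dst y) + 2 ^ src y') = pair_hash m' + (D (dst y') + 2 ^ src y).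
  have Ds k : k < N -> 2 ^ k = \sum_(e < N) 2 ^ e * (k == e) by rewrite sum_pow_indic => ->.
  have De k : D k = \sum_(e < N) 2 ^ e * (k == e) by rewrite sum_pow_indic.
  rewrite !De (Ds _ sN) (Ds _ sN') /pair_hash -!big_split /=; apply: eq_bigr => e _.
  by rewrite -!mulnDr star.
have {hm}hE : D (dst y) + 2 ^ src y' = D (dst y') + 2 ^ src y %[mod (2 ^ N).-1].
  by apply/eqP; rewrite -(eqn_modDl (pair_hash m)) hE -(modnDml (pair_hash m)) hm modnDml.
have two : 2 ^ N = 2 * 2 ^ N.-1 by rewrite -expnS prednK // ltnW.
have pw k : k < N -> 0 < 2 ^ k <= 2 ^ N.-1.
  by move=> kN; rewrite expn_gt0 leq_exp2l //; lia.
have p1 : 1 < 2 ^ N.-1 by rewrite (@ltn_exp2l 2 0) //; lia.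
have [dN|dN] := ltnP (dst y) N; have [dN'|dN'] := ltnP (dst y') N.
- move: hE; rewrite /D dN dN' => hE.
  have /sum2_expn2[] : 2 ^ dst y + 2 ^ src y' = 2 ^ dst y' + 2 ^ src y.
    apply: (eqmod_small (lo := 2) hE); move: (pw _ dN) (pw _ dN') (pw _ sN) (pw _ sN') two; lia.
  + by case=> -> ->; left.
  + by case=> -> ->; right.
- by have := dst_large pm' pm vy' vy (esym E) dN'; move: dN dN'; lia.
- by have := dst_large pm pm' vy vy' E dN; move: dN dN'; lia.
left; split; last by rewrite (dst_large pm pm' vy vy' E dN).
move: hE; rewrite /D ltnNge dN ltnNge dN' /= !add0n => hE.
have /eqP : 2 ^ src y' = 2 ^ src y.
  by apply: (eqmod_small (lo := 1) hE); move: (pw _ sN) (pw _ sN') two p1; lia.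
by rewrite eqn_exp2l // => /eqP ->.
Qed.

Lemma lead_untouched m y e : paired m -> valid_move predT m y -> e < N ->
  e != src y -> e != dst y -> move_lead partner m y (inord e.*2.+1) = m (inord e.*2.+1).
Proof.
move=> pm vy eN; case: y vy => [[[a j] i]|] // vy ea ej.
have aN := src_lt N2 Nn pm vy; rewrite /= ltn_half_double in aN; rewrite move_leadE.
have A1E : (inord e.*2.+1 : 'I_n.+1) = e.*2.+1 :> nat by rewrite inordK //; lia.
have -> : (a == inord e.*2.+1) = false.
  by apply/negbTE; apply: contra ea => /eqP ->; rewrite /= A1E /= uphalf_double.
have -> : (j == inord e.*2.+1) = false.
  by apply/negbTE; apply: contra ej => /eqP ->; rewrite /= A1E /= uphalf_double.
have -> : (partner a == inord e.*2.+1) = false.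
  apply/negbTE; apply: contra ea; rewrite -val_eqE /= partnerE // A1E.
  by move: (odd_double_half a); case: (odd a) => /=; move: (a./2) (nat_of_ord a) => h v; clear; lia.
by rewrite !mul0n subn0 !addn0.
Qed.

(** The first variable of pair [e] carries [t_e], the second [dl], so [dl] and the pair sums recover
    the exponent. *)
Definition pair_exp (dl : nat) (t : seq nat) : 'X_{1..n.+1} :=
  [multinom (if x < N.*2 then if odd x then dl else nth 0 t x./2 else 0) | x < n.+1].

Lemma pair_exp_paired dl t : paired (pair_exp dl t).
Proof. by move=> x xN; rewrite mnmE ltnNge xN. Qed.

Lemma pair_exp_odd dl t e : e < N -> pair_exp dl t (inord e.*2.+1) = dl.
Proof.
move=> eN; rewrite mnmE inordK; last by lia.
by rewrite /= odd_double ltn_Sdouble eN.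
Qed.

Lemma pair_sum_exp dl t e : e < N -> pair_sum (pair_exp dl t) e = nth 0 t e + dl.
Proof.
move=> eN; rewrite /pair_sum pair_exp_odd // mnmE inordK; last by lia.
by rewrite odd_double ltn_double eN doubleK.
Qed.

Lemma mdeg_pair_exp dl t : mdeg (pair_exp dl t) = \sum_(e < N) nth 0 t e + N * dl.
Proof.
rewrite mdegE; under eq_bigr do rewrite mnmE.
rewrite -(big_mkord xpredT (fun x => if x < N.*2 then if odd x then dl else nth 0 t x./2 else 0)).
rewrite (big_cat_nat _ Nn) //= [X in _ + X]big_nat [X in _ + X]big1 ?addn0; last first.
  by move=> x /andP[xN _]; rewrite ltnNge xN.
rewrite big_nat; under eq_bigr => x /andP[_ ->] do over.
rewrite -big_nat; elim: (N) => [|k IHk]; first by rewrite big_geq // big_ord0.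
rewrite doubleS !big_nat_recr //= IHk big_ord_recr /= odd_double /= doubleK mulSn; lia.
Qed.

End PairedGood.

Lemma avoid_two N x y : 2 < N -> exists e, [/\ e < N, e != x & e != y].
Proof.
move=> N3; have [/andP[? ?]|] := boolP ((0 != x) && (0 != y)); first by exists 0; split=> //; lia.
have [/andP[? ?]|] := boolP ((1 != x) && (1 != y)); first by exists 1; split=> //; lia.
by move=> ? ?; exists 2; split; lia.
Qed.

(* The exponents vanish at the second variable of each pair; [twist] adds those
   equal to 1 there, which a third pair tells apart. *)
Lemma pairs_config (K : fieldType) n d N s (twist : bool) :
  ([pchar K] =i pred0)%R -> 1 < N -> N.*2 <= n.+1 -> 0 < d -> (twist -> 2 < N <= d) ->
  (2 ^ N).-1 * s < 'C(d + N.-1, N.-1) + (if twist then 'C(d - N + N.-1, N.-1) else 0) ->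
  indep_config K n d s.+1.
Proof.
move=> charK N2 Nn d0 tw; case: N N2 Nn tw => [//|N] N2 Nn tw /= card.
pose T0 : finType := {t : N.+1.-tuple 'I_d.+1 | \sum_(i <- t) i == d}.
pose T1 : finType := {t : N.+1.-tuple 'I_(d - N.+1).+1 | twist && (\sum_(i <- t) i == d - N.+1)}.
have cT0 : #|T0| = 'C(d + N, N).
  by rewrite card_sig addnC -(card_ord_partitions N d); apply: eq_card => t; rewrite !inE.
have cT1 : #|T1| = if twist then 'C(d - N.+1 + N, N) else 0.
  rewrite card_sig /T1; case: (twist) => /=; last by apply: eq_card0 => t; rewrite !inE.
  by rewrite addnC -(card_ord_partitions N); apply: eq_card => t; rewrite !inE.
pose dl (u : T0 + T1) : nat := if u is inr _ then 1 else 0.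
pose ts (u : T0 + T1) : seq nat := match u with
  | inl t => map (@nat_of_ord _) (val t) | inr t => map (@nat_of_ord _) (val t) end.
pose al u := pair_exp n N.+1 (dl u) (ts u).
have sum_ts u : \sum_(e < N.+1) nth 0 (ts u) e + N.+1 * dl u = d.
  case: u => u /=; have := valP u.
    move/eqP => ud; rewrite muln0 addn0 -[RHS]ud big_tuple; apply: eq_bigr => e _.
    by rewrite (nth_map ord0) ?size_tuple // -tnth_nth.
  case/andP => /tw/andP[_ Nd] /eqP ud; rewrite muln1.
  have -> : \sum_(e < N.+1) nth 0 (map (@nat_of_ord _) (val u)) e = d - N.+1.
    rewrite -[RHS]ud big_tuple; apply: eq_bigr => e _.
    by rewrite (nth_map ord0) ?size_tuple // -tnth_nth.
  by rewrite subnK.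
have Q0 : 0 < (2 ^ N.+1).-1.
  have : 2 ^ 1 <= 2 ^ N.+1 by rewrite leq_exp2l.
  by move: (2 ^ N.+1) => u; lia.
have [||r [f [f_inj fr]]] := @pigeonhole (T0 + T1)%type
  (fun u => pair_hash N.+1 (al u) %% (2 ^ N.+1).-1) (2 ^ N.+1).-1 s.
- by move=> u; rewrite ltn_mod.
- by rewrite card_sum cT0 cT1.
apply: (good_family_config (b := partner N.+1) (al := fun p => al (f p))) => //.
- exact: partner_neq.
- by move=> p; rewrite mdeg_pair_exp // sum_ts.
move=> p q x y vx vy E; apply: f_inj.
have pal u : paired N.+1 (al u) by exact: pair_exp_paired.
have [ps tch] := paired_good N2 Nn (pal _) (pal _) vx vy E (etrans (fr p) (esym (fr q))).
have dlE : dl (f p) = dl (f q).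
  have [tw1|] := boolP twist; last first.
    move=> tw0; have d0' u : dl u = 0 by case: u => // u; have /andP[tw1] := valP u; case/negP: tw0.
    by rewrite !d0'.
  have /andP[N3 _] := tw tw1.
  have [e [eN e1 e2]] : exists e, [/\ e < N.+1,
      (e != src x) && (e != dst x) & (e != src y) && (e != dst y)].
    case: tch => [[<- <-]|[-> ->]].
      have [e [eN e1 e2]] := avoid_two (src x) (dst x) N3.
      by exists e; rewrite e1 e2.
    have [e [eN e1 e2]] := avoid_two (dst x) (dst y) N3.
    by exists e; rewrite e1 e2.
  case/andP: e1 => e1 e1'; case/andP: e2 => e2 e2'.
  have := congr1 (fun m : 'X_{1..n.+1} => m (inord e.*2.+1)) E.
  rewrite (lead_untouched N2 Nn (pal _) vx eN e1 e1') (lead_untouched N2 Nn (pal _) vy eN e2 e2').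
  by rewrite !pair_exp_odd.
have nthE e : e < N.+1 -> nth 0 (ts (f p)) e = nth 0 (ts (f q)) e.
  by move=> eN; have := ps e eN; rewrite !pair_sum_exp // dlE => /addIn.
have tsE : ts (f p) = ts (f q).
  have szt u : size (ts u) = N.+1 by case: u => u; rewrite /= size_map size_tuple.
  by apply: (@eq_from_nth _ 0); rewrite ?szt.
move: dlE tsE; case: (f p) (f q) => u [] v //= _ /(inj_map (@ord_inj _))/val_inj/val_inj -> //.
Qed.

(** * Specialization to a hyperplane *)

Local Open Scope ring_scope.

Lemma spec_tvec_map (K : fieldType) n (t : K) (ls ms : seq {mpoly {poly K}[n]}) :
  spec t (tvec ls ms) = tvec (map (spec t) ls) (map (spec t) ms).
Proof.
elim: ls ms => [|l ls IHls] [|m ms] /=; rewrite ?rmorph0 //.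
by rewrite (rmorphD (spec t)) !(rmorphM (spec t)) (rmorph_prod (spec t)) big_map -IHls.
Qed.

Lemma spec_tvec (K : fieldType) n (t : K) (ls : seq {mpoly {poly K}[n]})
    (ms : seq {mpoly K[n]}) :
  spec t (tvec ls (map (@cst K n) ms)) = tvec (map (spec t) ls) ms.
Proof.
have msE : map (spec t) (map (@cst K n) ms) = ms by apply: mapK => m; apply: spec_cst.
by rewrite spec_tvec_map msE.
Qed.

Lemma spec_prod (K : fieldType) n (t : K) (ls : seq {mpoly {poly K}[n]}) :
  spec t (\prod_(l <- ls) l) = \prod_(l <- [seq spec t l | l <- ls]) l.
Proof. by rewrite big_map (rmorph_prod (spec t)). Qed.

Section Horace.
Variables (K : fieldType) (n : nat).
Hypothesis charK : [pchar K] =i pred0.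
Local Notation A := {mpoly K[n.+1]}.
Local Notation xn := ('X_ord_max : A).

(* Restriction to the hyperplane [x_n = 0]. *)
Definition restrict : A -> A :=
  comp_mpoly [tuple (if i == ord_max then 0 else 'X_i) | i < n.+1].

HB.instance Definition _ := GRing.LRMorphism.copy restrict
  (comp_mpoly [tuple (if i == ord_max then 0 else 'X_i) | i < n.+1]).

Lemma restrictX i : restrict 'X_i = if i == ord_max then 0 else 'X_i.
Proof. by rewrite /restrict comp_mpolyXU -tnth_nth tnth_mktuple. Qed.

Definition on_hyper (l : A) := restrict l == l.

Lemma on_hyper_prod ls : all on_hyper ls -> restrict (\prod_(l <- ls) l) = \prod_(l <- ls) l.
Proof.
by move=> /allP lh; rewrite rmorph_prod !big_seq; apply: eq_bigr => l /lh/eqP.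
Qed.

Lemma on_hyper_tvec ls ms : all on_hyper ls -> all on_hyper ms ->
  restrict (tvec ls ms) = tvec ls ms.
Proof.
have mapid s : all on_hyper s -> [seq restrict l | l <- s] = s.
  by move=> /allP lh; rewrite -[RHS]map_id; apply/eq_in_map => l /lh/eqP.
by move=> lh mh; rewrite rmorph_tvec !mapid.
Qed.

Lemma on_hyperX i : i != ord_max -> on_hyper 'X_i.
Proof. by move=> /negPf im; rewrite /on_hyper restrictX im; apply: eqxx. Qed.

Lemma on_hyperZ c u : on_hyper u -> on_hyper (c *: u).
Proof. by rewrite /on_hyper => /eqP uh; rewrite linearZ /= uh; apply: eqxx. Qed.

Lemma on_hyperD u v : on_hyper u -> on_hyper v -> on_hyper (u + v).
Proof. by rewrite /on_hyper => /eqP uh /eqP vh; rewrite rmorphD /= uh vh; apply: eqxx. Qed.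

Definition consts (cs : seq K) : seq A := [seq c%:MP | c <- cs].

Lemma on_hyper_consts cs : all on_hyper (consts cs).
Proof. by apply/allP => _ /mapP[c _ ->]; rewrite /on_hyper /restrict comp_mpolyC. Qed.

(* Products [L p] of degree [d], whose tangent spaces are independent together
   with the spans of the partial products of the products [F r] of degree
   [d + 1] of forms on the hyperplane. *)
Definition horace d (P R : finType) : Prop :=
  exists (L : P -> seq A) (J : finType) (pt : J -> P) (M : J -> seq A)
         (F : R -> seq A) (J' : finType) (pt' : J' -> R) (C : J' -> seq K),
  [/\ [/\ forall p, linforms d (L p), forall j, linforms d (M j) & #|J| = (#|P| * (d * n + 1))%N],
      [/\ forall r, linforms d.+1 (F r) && all on_hyper (F r), forall j, size (C j) = d.+1
          & #|J'| = (#|R| * d.+1)%N],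
      freef (fun p => \prod_(l <- L p) l) &
      freef (fun u : J + J' => match u with
         inl j => tvec (L (pt j)) (M j) | inr j => tvec (F (pt' j)) (consts (C j)) end)].

(* What remains on the hyperplane, a space of [n] variables, when the points [P]
   are multiplied by [x_n] and the points [G], already on it, are added. *)
Definition trace d (P G R : finType) : Prop :=
  exists (h : P -> seq A) (g : G -> seq A) (J : finType) (pt : J -> G) (M : J -> seq A)
         (F : R -> seq A) (J' : finType) (pt' : J' -> R) (C : J' -> seq K),
  [/\ forall p, linforms d (h p) && all on_hyper (h p),
      [/\ forall q, linforms d.+1 (g q) && all on_hyper (g q),
          forall j, linforms d.+1 (M j) && all on_hyper (M j) & #|J| = (#|G| * (d.+1 * n.-1 + 1))%N],
      [/\ forall r, linforms d.+2 (F r) && all on_hyper (F r), forall j, size (C j) = d.+2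
          & #|J'| = (#|R| * d.+2)%N],
      freef (fun q => \prod_(l <- g q) l) &
      freef (fun u : (P * 'I_n) + (J + J') => match u with
         | inl (p, i) => \prod_(l <- h p) l * 'X_(widen_ord (leqnSn n) i)
         | inr (inl j) => tvec (g (pt j)) (M j)
         | inr (inr j) => tvec (F (pt' j)) (consts (C j)) end)].

Definition lines (us vs : seq A) : seq {mpoly {poly K}[n.+1]} :=
  [seq line w.1 w.2 | w <- zip us vs].

Definition mixes (t : K) (us vs : seq A) : seq A :=
  [seq w.1 + t *: (w.2 - w.1) | w <- zip us vs].

Lemma spec_lines t us vs : [seq spec t l | l <- lines us vs] = mixes t us vs.
Proof. by rewrite -map_comp; apply: eq_map => w /=; rewrite spec_line. Qed.

Lemma mixes0 us vs : size us = size vs -> mixes 0 us vs = us.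
Proof.
move=> sz; rewrite -[RHS](@unzip1_zip _ _ us vs) ?sz //; apply: eq_map => w.
by rewrite scale0r addr0.
Qed.

Lemma mixes1 us vs : size us = size vs -> mixes 1 us vs = vs.
Proof.
move=> sz; rewrite -[RHS](@unzip2_zip _ _ us vs) ?sz //; apply: eq_map => w.
by rewrite scale1r addrC subrK.
Qed.

Lemma mixes_linforms d t us vs : linforms d us -> linforms d vs -> linforms d (mixes t us vs).
Proof.
case/andP => /eqP su lu /andP[/eqP sv lv].
rewrite /linforms size_map size1_zip ?su ?sv // eqxx /=.
elim: us vs lu lv {su sv} => [|u us IHus] [|v vs] //= /andP[uh lu] /andP[vh lv].
by rewrite IHus // andbT rpredD // rpredZ // rpredB.
Qed.

Lemma mixes_hyper t us vs : all on_hyper us -> all on_hyper vs -> all on_hyper (mixes t us vs).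
Proof.
elim: us vs => [|u us IHus] [|v vs] //= /andP[/eqP uh lu] /andP[/eqP vh lv].
rewrite IHus // andbT on_hyperD ?on_hyperZ // /on_hyper ?rmorphB /= ?vh ?uh; exact: eqxx.
Qed.

Lemma restrict_mix t u v : on_hyper v ->
  restrict (u + t *: (v - u)) = restrict u + t *: (v - restrict u).
Proof. by move=> /eqP vh; rewrite rmorphD /= linearZ /= rmorphB /= vh. Qed.

Lemma restrict_mixes t us vs : all on_hyper vs ->
  [seq restrict l | l <- mixes t us vs] = mixes t [seq restrict l | l <- us] vs.
Proof.
rewrite /mixes; elim: us vs => [|u us IHus] [|v vs] //= /andP[vh vsh].
by rewrite restrict_mix // IHus.
Qed.

(** Restriction kills the multiples of [x], so a relation first loses its [w] part and can then be
    divided by [x]. *)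
Lemma freef_split (I I' : finType) (x : A) (v : I -> A) (w : I' -> A) : x != 0 ->
  restrict x = 0 -> freef v -> freef (fun i => restrict (w i)) ->
  freef (fun u : I + I' => match u with inl i => x * v i | inr i => w i end).
Proof.
move=> x0 rx vfr wfr c; rewrite big_sumType /=.
have -> : \sum_i c (inl i) *: (x * v i) = x * \sum_i c (inl i) *: v i.
  by rewrite mulr_sumr; apply: eq_bigr => i _; rewrite scalerAr.
move=> s0; have cr i : c (inr i) = 0.
  apply: (wfr (fun i => c (inr i))) => {i}.
  have := congr1 restrict s0; rewrite raddf0 raddfD /= rmorphM /= rx mul0r add0r => H.
  rewrite -[RHS]H raddf_sum /=; apply: eq_bigr => i _; exact/esym/comp_mpolyZ.
case=> [i|//]; apply: (vfr (fun i => c (inl i))); apply/eqP.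
move/eqP: s0; rewrite [X in _ + X]big1 => [|j _]; last by rewrite cr scale0r.
by rewrite addr0 mulf_eq0 (negPf x0).
Qed.

End Horace.

Section Horace.
Variables (K : fieldType) (n : nat).
Hypothesis charK : [pchar K] =i pred0.
Local Notation A := {mpoly K[n.+1]}.
Local Notation xn := ('X_ord_max : A).
Local Notation horace := (horace K n).
Local Notation trace := (trace K n).
Local Notation on_hyper := (@on_hyper K n).
Local Notation consts := (@consts K n).

(** The tangent space at [x_n] times a product is [x_n] times the old one plus the product times the
    other [n] variables. At a product on the hyperplane it consists of tangent vectors on the
    hyperplane and [x_n] times partial products. Division by [x_n] leaves [horace d P G],
    restriction leaves [trace d P G R]. *)
Lemma horace_step d (P G R : finType) : (0 < n)%N ->
  horace d P G -> trace d P G R -> horace d.+1 (P + G)%type R.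
Proof.
move=> n0 [L1 [J1 [pt1 [M1 [F1 [J1' [pt1' [C1]]]]]]]].
case=> [[L1l M1l cJ1] [F1l C1s cJ1'] fr1 fr2].
case=> h [g [Jg [ptg [Mg [F [J' [pt' [C]]]]]]]].
case=> [hl [gl Mgl cJg] [Fl Cs cJ'] fr3 fr4].
pose Lt p := lines (L1 p) (h p).
pose gt q := lines (F1 q) (g q).
pose ht p := lines [seq restrict l | l <- L1 p] (h p).
have szLh p : size (L1 p) = size (h p).
  by have /andP[/eqP -> _] := L1l p; have /andP[/andP[/eqP ->]] := hl p.
have szFg q : size (F1 q) = size (g q).
  by have /andP[/andP[/eqP -> _] _] := F1l q; have /andP[/andP[/eqP ->]] := gl q.
(* The points of both configurations are joined by lines: a general [t] inherits
   the independence found at [t = 0] and the one found at [t = 1]. *)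
have [|D1 D10 D1fr] := @freef_open K n.+1 _ (fun p => \prod_(l <- Lt p) l) 0.
  apply: eq_freef fr1 => p; rewrite spec_prod spec_lines mixes0 //.
have [|D2 D20 D2fr] := @freef_open K n.+1 _ (fun u : J1 + J1' => match u with
    inl j => tvec (Lt (pt1 j)) (map (@cst K n.+1) (M1 j))
  | inr j => tvec (gt (pt1' j)) (map (@cst K n.+1) (consts (C1 j))) end) 0.
  by apply: eq_freef fr2 => -[j|j]; rewrite spec_tvec spec_lines mixes0.
have [|D3 D31 D3fr] := @freef_open K n.+1 _ (fun q => \prod_(l <- gt q) l) 1.
  by apply: eq_freef fr3 => q; rewrite spec_prod spec_lines mixes1.
have [|D4 D41 D4fr] := @freef_open K n.+1 _ (fun u : (P * 'I_n) + (Jg + J') => match u with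
    | inl (p, i) => \prod_(l <- ht p) l * @cst K n.+1 'X_(widen_ord (leqnSn n) i)
    | inr (inl j) => tvec (gt (ptg j)) (map (@cst K n.+1) (Mg j))
    | inr (inr j) => @cst K n.+1 (tvec (F (pt' j)) (consts (C j))) end) 1.
  apply: eq_freef fr4 => -[[p i]|[j|j]].
  - by rewrite rmorphM /= spec_cst spec_prod spec_lines mixes1 // size_map.
  - by rewrite spec_tvec spec_lines mixes1.
  - by rewrite spec_cst.
have [t [t0 /[dup] D12t]] := common_nonroot charK
  (mulf_neq0 (horner_neq0 D10) (horner_neq0 D20)) (mulf_neq0 (horner_neq0 D31) (horner_neq0 D41)).
rewrite !hornerM !mulf_eq0 !negb_or => /andP[D1t D2t] /andP[D3t D4t].
pose Lp p := mixes t (L1 p) (h p); pose gq q := mixes t (F1 q) (g q).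
have Lpl p : linforms d (Lp p) by apply: mixes_linforms => //; have /andP[] := hl p.
have gql q : linforms d.+1 (gq q).
  by apply: mixes_linforms; [have /andP[] := F1l q | have /andP[] := gl q].
have gqh q : all on_hyper (gq q).
  by apply: mixes_hyper; [have /andP[] := F1l q | have /andP[] := gl q].
have {}D1fr : freef (fun p => \prod_(l <- Lp p) l).
  by apply: eq_freef (D1fr _ D1t) => p; rewrite spec_prod spec_lines.
have {}D2fr : freef (fun u : J1 + J1' => match u with
    inl j => tvec (Lp (pt1 j)) (M1 j) | inr j => tvec (gq (pt1' j)) (consts (C1 j)) end).
  by apply: eq_freef (D2fr _ D2t) => -[j|j]; rewrite spec_tvec spec_lines.
have {}D3fr : freef (fun q => \prod_(l <- gq q) l).
  by apply: eq_freef (D3fr _ D3t) => q; rewrite spec_prod spec_lines.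
have {}D4fr : freef (fun u : (P * 'I_n) + (Jg + J') => match u with
    | inl (p, i) => restrict (\prod_(l <- Lp p) l) * 'X_(widen_ord (leqnSn n) i)
    | inr (inl j) => tvec (gq (ptg j)) (Mg j)
    | inr (inr j) => tvec (F (pt' j)) (consts (C j)) end).
  apply: eq_freef (D4fr _ D4t) => -[[p i]|[j|j]].
  - rewrite rmorphM /= spec_cst spec_prod spec_lines rmorph_prod -(big_map (@restrict K n) xpredT id).
    by rewrite restrict_mixes //; have /andP[] := hl p.
  - by rewrite spec_tvec spec_lines.
  - by rewrite spec_cst.
have xn0 : xn != 0 by rewrite -msize_poly_eq0 msizeX.
have rxn : restrict xn = 0 by rewrite restrictX eqxx.
have wid i : on_hyper 'X_(widen_ord (leqnSn n) i).
  rewrite /on_hyper restrictX; case: (_ =P ord_max) => [/(congr1 val)/= iE|_]; last exact: eqxx.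
  by have := ltn_ord i; rewrite {1}iE ltnn.
have Xh (i : 'I_n.+1) : ('X_i : A) \is 1.-homog by apply: mpolyX1_homog.
have nseqh k : linforms k (nseq k (0 : A)).
  by rewrite /linforms size_nseq eqxx; apply/allP => l /nseqP[-> _]; apply: rpred0.
exists (fun u : P + G => match u with inl p => xn :: Lp p | inr q => gq q end).
exists ((J1 + P * 'I_n) + (Jg + J1'))%type.
exists (fun u => match u with
  | inl (inl j) => inl (pt1 j) | inl (inr (p, _)) => inl p
  | inr (inl j) => inr (ptg j) | inr (inr j) => inr (pt1' j) end).
exists (fun u => match u with
  | inl (inl j) => 0 :: M1 j | inl (inr (_, i)) => 'X_(widen_ord (leqnSn n) i) :: nseq d 0
  | inr (inl j) => Mg j | inr (inr j) => [seq xn * m | m <- consts (C1 j)] end).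
exists F, J', pt', C; split; first split.
- by case=> [p|q] //; rewrite linforms_cons Xh Lpl.
- case=> [[j|[p i]]|[j|j]].
  + by rewrite linforms_cons rpred0 M1l.
  + by rewrite linforms_cons Xh nseqh.
  + by have /andP[] := Mgl j.
  + rewrite /linforms !size_map C1s eqxx; apply/allP => _ /mapP[_ /mapP[c _ ->] ->].
    by rewrite mulrC mul_mpolyC rpredZ ?Xh.
- by rewrite !card_sum card_prod card_ord cJ1 cJg cJ1'; case: (n) n0 => // k _ /=; ring.
- by [].
- apply: eq_freef (freef_split xn0 rxn D1fr _) => [[p|q]|]; rewrite ?big_cons //.
  by apply: eq_freef D3fr => q; rewrite on_hyper_prod.
pose v u := match u with inl j => tvec (Lp (pt1 j)) (M1 j)
  | inr j => tvec (gq (pt1' j)) (consts (C1 j)) end.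
pose w u := match u with
    | inl (p, i) => (\prod_(l <- Lp p) l) * 'X_(widen_ord (leqnSn n) i)
    | inr (inl j) => tvec (gq (ptg j)) (Mg j)
    | inr (inr j) => tvec (F (pt' j)) (consts (C j)) end.
(* Multiples of [x_n] go to the left, vectors seen by restriction to the right. *)
pose phi (u : (J1 + P * 'I_n) + (Jg + J1') + J') :
    (J1 + J1') + (P * 'I_n + (Jg + J')) := match u with
  | inl (inl (inl j)) => inl (inl j) | inl (inl (inr j)) => inr (inl j)
  | inl (inr (inl j)) => inr (inr (inl j)) | inl (inr (inr j)) => inl (inr j)
  | inr j => inr (inr (inr j)) end.
have phi_inj : injective phi by case=> [[[j|j]|[j|j]]|j] [[[k|k]|[k|k]]|k] //= [->].
have wfr : freef (fun i => restrict (w i)).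
  apply: eq_freef D4fr => -[[p i]|[j|j]] /=.
  - by rewrite rmorphM /= (eqP (wid i)).
  - by rewrite on_hyper_tvec //; have /andP[] := Mgl j.
  - by rewrite on_hyper_tvec ?on_hyper_consts //; have /andP[] := Fl (pt' j).
apply: eq_freef (freef_inj phi_inj (freef_split (v := v) (w := w) xn0 rxn D2fr wfr)).
case=> [[[j|[p i]]|[j|j]]|j] //=.
- by rewrite mul0r add0r.
- by rewrite tvec0 mulr0 addr0 mulrC.
- by rewrite tvec_scale.
Qed.

End Horace.

(** * Forms in five variables *)

Local Open Scope nat_scope.

Section Axis.
Local Notation b := (@partner 4 2).
Local Notation axis p q := (pair_exp 4 2 0 [:: p; q]).

Lemma axis_paired p q : paired 2 (axis p q).
Proof. exact: pair_exp_paired. Qed.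

Lemma mdeg_axis p q : mdeg (axis p q) = p + q.
Proof. by rewrite mdeg_pair_exp // !big_ord_recr big_ord0 /= addn0. Qed.

Lemma axis_sum p q : pair_sum (axis p q) 0 = p.
Proof. by rewrite pair_sum_exp // addn0. Qed.

Lemma axis_lead_odd d p q (y : move 5 d) e : e < 2 -> e != src y ->
  valid_move predT (axis p q) y -> move_lead b (axis p q) y (inord e.*2.+1) <= 1.
Proof.
move=> e2 ey vy; have sy := @src_lt 4 2 isT isT _ _ _ (axis_paired p q) vy.
case: y vy ey sy => [[[a j] i]|] vy ey sy; last by rewrite /= pair_exp_odd.
rewrite move_leadE pair_exp_odd //.
have -> : (b a == inord e.*2.+1 :> 'I_5) = false.
  apply/negbTE; move: ey; rewrite -val_eqE /= inordK; last by lia.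
  rewrite partnerE //; last by move: sy; rewrite /= ltn_half_double.
  by have := odd_double_half a; case: (odd a); lia.
by case: (j == _); lia.
Qed.

(** Outside its source pair a move raises an odd variable to at most 1. This separates these
    monomials from those divisible by [x_1 ^ 2 x_3 ^ 2]. *)
Lemma axis_min_odd d p q (y : move 5 d) : valid_move predT (axis p q) y ->
  exists2 e, e < 2 & move_lead b (axis p q) y (inord e.*2.+1) <= 1.
Proof.
move=> vy; have [sy|sy] := eqVneq (src y) 0.
  by exists 1 => //; apply: axis_lead_odd => //; rewrite sy.
by exists 0 => //; apply: axis_lead_odd => //; rewrite eq_sym.
Qed.

Lemma axis_sum_lead d p q (y : move 5 d) : valid_move predT (axis p q) y ->
  pair_sum (move_lead b (axis p q) y) 0 + (src y == 0) = p + (dst y == 0).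
Proof. by move=> vy; rewrite (pair_sum_lead _ _ (axis_paired p q)) // axis_sum. Qed.

(** [x_4] does not occur on the axis, so multiplication by it turns a partial product into a move,
    and facts on moves carry over. *)
Lemma axis_move d p q a (i : 'I_d) : i < axis p q a ->
  valid_move predT (axis p q) (Some (a, ord_max, i)).
Proof.
move=> ia /=; rewrite ia andbT; apply/eqP => aE.
by move: ia; rewrite -aE axis_paired.
Qed.

Lemma axis_sum_partial d p q a (i : 'I_d) : i < axis p q a ->
  pair_sum (mpartial_lead b (axis p q) a i) 0 + (a./2 == 0) = p.
Proof.
move=> /axis_move /axis_sum_lead /=; rewrite addn0 => H; rewrite -[RHS]H /pair_sum !mnmDE !mnm1E.
have ne k : k < 4 -> (ord_max == inord k :> 'I_5) = false.
  by move=> k4; apply/negbTE; rewrite -val_eqE /= inordK; lia.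
by rewrite !ne // !addn0.
Qed.

Lemma axis_partial_odd d p q a (i : 'I_d) : i < axis p q a ->
  exists2 e, e < 2 & mpartial_lead b (axis p q) a i (inord e.*2.+1) <= 1.
Proof.
move=> /axis_move /axis_min_odd[e e2] /=; rewrite mnmDE => le1; exists e => //.
by apply: leq_trans le1; apply: leq_addr.
Qed.

Lemma axis_lead_inj d p p' D (y y' : move 5 d) : p <= D -> p' <= D -> p = p' %[mod 5] ->
  valid_move predT (axis p (D - p)) y -> valid_move predT (axis p' (D - p')) y' ->
  move_lead b (axis p (D - p)) y = move_lead b (axis p' (D - p')) y' -> p = p' /\ y = y'.
Proof.
move=> pD pD' pp vy vy' E; have pE : p = p'.
  have := axis_sum_lead vy; have := axis_sum_lead vy'; rewrite E.
  move: pp; case: (src y == 0); case: (src y' == 0); case: (dst y == 0);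
    case: (dst y' == 0) => /=; lia.
by split=> //; subst p'; apply: move_lead_inj vy vy' E; apply: partner_neq.
Qed.

Lemma axis_partial_inj d p p' D a a' (i i' : 'I_d) : p <= D -> p' <= D -> p = p' %[mod 5] ->
  i < axis p (D - p) a -> i' < axis p' (D - p') a' ->
  mpartial_lead b (axis p (D - p)) a i = mpartial_lead b (axis p' (D - p')) a' i' ->
  [/\ p = p', a = a' & i = i'].
Proof.
move=> pD pD' pp ia ia' E.
have H : move_lead b (axis p (D - p)) (Some (a, ord_max, i)) =
    move_lead b (axis p' (D - p')) (Some (a', ord_max, i')) by rewrite /= E.
by have [-> [-> ->]] := axis_lead_inj pD pD' pp (axis_move ia) (axis_move ia') H.
Qed.

(** In the sum of the first pair, tangent vectors show [p - 1], [p], [p + 1] and partial products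
    [p + 2], [p + 3]: together the five residues modulo 5. *)
Lemma axis_lead_partial d d' p p' q q' (y : move 5 d) a (i : 'I_d') : p' = p + 3 %[mod 5] ->
  valid_move predT (axis p q) y -> i < axis p' q' a ->
  move_lead b (axis p q) y <> mpartial_lead b (axis p' q') a i.
Proof.
move=> pp vy ia E; have := axis_sum_lead vy; have := axis_sum_partial ia; rewrite E.
by case: (src y == 0); case: (dst y == 0); case: (_ == 0); move: pp => /=; lia.
Qed.

End Axis.

Local Open Scope ring_scope.

(** * The trace on the hyperplane [x_4 = 0] *)

Section Trace.
Variable K : fieldType.
Hypothesis charK : [pchar K] =i pred0.
Local Notation b := (@partner 4 2).
Local Notation axis p q := (pair_exp 4 2 0 [:: p; q]).
Local Notation on_hyper := (@on_hyper K 4).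
Local Notation w := (@widen_ord 4 5 (leqnSn 4)).

Lemma mpoint_hyper (tau : K) (al : 'X_{1..5}) : al ord_max = 0%N ->
  all on_hyper (mpoint b tau al).
Proof.
move=> al0; apply/allP => l /mpointP[a [c [al_a ->]]].
have am : a != ord_max by apply: contraTneq al_a => ->; rewrite al0.
have a4 : (a < 4)%N by move: am (ltn_ord a); rewrite -val_eqE /=; lia.
rewrite on_hyperD ?on_hyperZ ?on_hyperX // -val_eqE /= partnerE //.
by have := odd_double_half a; case: ifP; lia.
Qed.

(** [x_0] to [x_3] have distinct weights modulo 4, so for [gam] in one class the monomial times
    [x_i] determines [i]. *)
Definition weight (m : 'X_{1..5}) := (\sum_(k < 5) k * m k)%N.

Lemma weightD m j : weight (m + U_(j))%MM = (weight m + j)%N.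
Proof.
rewrite /weight (eq_bigr (fun k : 'I_5 => k * m k + k * (j == k))%N) => [|k _].
  rewrite big_split /=; congr addn.
  rewrite (bigD1 j) //= eqxx muln1 big1 ?addn0 // => k.
  by rewrite eq_sym => /negPf ->; rewrite muln0.
by rewrite mnmDE mnm1E mulnDr.
Qed.

Lemma card_partials d (m : 'X_{1..5}) : mdeg m = d ->
  #|[pred u : 'I_5 * 'I_d | (u.2 < m u.1)%N]| = d.
Proof.
move=> md; rewrite -sum1_card big_mkcond /=.
rewrite -(pair_bigA _ (fun (a : 'I_5) (i : 'I_d) => if (i < m a)%N then 1 else 0)%N) /=.
rewrite -[RHS]md mdegE; apply: eq_bigr => a _.
have ad : (m a <= d)%N by rewrite -md mdegE (bigD1 a) //= leq_addr.
by rewrite -big_mkcond -(big_ord_widen d (fun=> 1%N)) // sum_nat_const card_ord muln1.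
Qed.

(** Three kinds of monomials are kept apart: those from [gam] by exponents above 1 at both [x_1] and
    [x_3], the other two by residues modulo 5. *)
Lemma trace4 d (P G R : finType) (gam : P -> 'X_{1..5}) (pg : G -> nat) (pf : R -> nat) r v :
  injective gam -> (forall p, weight (gam p) = v %[mod 4]) ->
  (forall p, [/\ mdeg (gam p) = d, gam p ord_max = 0, 1 < gam p (inord 1) & 1 < gam p (inord 3)])%N ->
  injective pg -> (forall q, pg q <= d.+1 /\ pg q = r %[mod 5])%N ->
  injective pf -> (forall q, pf q <= d.+2 /\ pf q = r + 3 %[mod 5])%N ->
  trace K 4 d P G R.
Proof.
move=> gam_inj gamw gamP pg_inj pgP pf_inj pfP.
pose ag q := axis (pg q) (d.+1 - pg q)%N; pose af q := axis (pf q) (d.+2 - pf q)%N.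
have agd q : mdeg (ag q) = d.+1 by rewrite mdeg_axis subnKC //; have [] := pgP q.
have afd q : mdeg (af q) = d.+2 by rewrite mdeg_axis subnKC //; have [] := pfP q.
have ag0 q : ag q ord_max = 0%N by apply: axis_paired.
have af0 q : af q ord_max = 0%N by apply: axis_paired.
pose Jg : finType := {u : G * move 5 d.+1 | valid_move (fun j => j != ord_max) (ag u.1) u.2}.
pose J' : finType := {u : R * ('I_5 * 'I_d.+2) | (u.2.2 < af u.1 u.2.1)%N}.
have vJg (j : Jg) : valid_move predT (ag (val j).1) (val j).2.
  by have := valP j; case: (val j) => q [[[a k] i]|] //= /and3P[_ -> ->].
pose V (S : comNzRingType) (tau : S) (j : Jg) := move_vec b tau (ag (val j).1) (val j).2.
pose W (S : comNzRingType) (tau : S) (j : J') :=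
  mpartial b tau (af (val j).1) (val j).2.1 (val j).2.2.
have specV t u : spec t (V {poly K} 'X u) = V K t u.
  by rewrite /spec map_move_vec /= horner_evalE hornerX.
have specW t u : spec t (W {poly K} 'X u) = W K t u.
  by rewrite /spec map_mpartial /= horner_evalE hornerX.
pose lead (u : (P * 'I_4) + (Jg + J')) : 'X_{1..5} := match u with
  | inl (p, i) => (gam p + U_(w i))%MM
  | inr (inl j) => move_lead b (ag (val j).1) (val j).2
  | inr (inr j) => mpartial_lead b (af (val j).1) (val j).2.1 (val j).2.2 end.
have hodd p i e : (e < 2)%N -> (1 < (gam p + U_(w i))%MM (inord e.*2.+1))%N.
  move=> e2; rewrite mnmDE; have [_ _ g1 g3] := gamP p.
  by case: e e2 => [|[|//]] _; apply: ltn_addr.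
have gh p i (j : Jg) : (gam p + U_(w i))%MM <> move_lead b (ag (val j).1) (val j).2.
  move=> E; have [e e2] := axis_min_odd (vJg j).
  by rewrite leqNgt -E hodd.
have fh p i (j : J') : (gam p + U_(w i))%MM <>
    mpartial_lead b (af (val j).1) (val j).2.1 (val j).2.2.
  move=> E; have [e e2] := axis_partial_odd (valP j).
  by rewrite leqNgt -E hodd.
have gf (j : Jg) (j' : J') : move_lead b (ag (val j).1) (val j).2 <>
    mpartial_lead b (af (val j').1) (val j').2.1 (val j').2.2.
  apply: axis_lead_partial (vJg j) (valP j').
  have [_ fr] := pfP (val j').1; have [_ gr] := pgP (val j).1.
  by rewrite fr -modnDml -gr modnDml.
have lead_inj : injective lead.
  case=> [[p i]|[j|j]] [[p' i']|[j'|j']] //= E.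
  - have wE : (v + i = v + i' %[mod 4])%N.
      have := congr1 weight E; rewrite !weightD /= => wE.
      by rewrite -modnDml -(gamw p) modnDml wE -modnDml (gamw p') modnDml.
    have ii : i = i' by apply: ord_inj; move: wE (ltn_ord i) (ltn_ord i'); clear; lia.
    by move: E; rewrite ii => /addIm/gam_inj ->.
  - by case: (gh p i j').
  - by case: (fh p i j').
  - by case: (gh p' i' j).
  - have [g1 gr] := pgP (val j).1; have [g1' gr'] := pgP (val j').1.
    have [qE yE] := axis_lead_inj g1 g1' (etrans gr (esym gr')) (vJg j) (vJg j') E.
    by congr (inr (inl _)); apply/val_inj/eqP; rewrite -pair_eqE /= yE (pg_inj _ _ qE) !eqxx.
  - by case: (gf j j').
  - by case: (fh p' i' j).
  - by case: (gf j' j).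
  have [f1 fr] := pfP (val j).1; have [f1' fr'] := pfP (val j').1.
  have [qE aE iE] := axis_partial_inj f1 f1' (etrans fr (esym fr')) (valP j) (valP j') E.
  congr (inr (inr _)); apply/val_inj/eqP.
  by rewrite -!pair_eqE /= -pair_eqE /= aE iE (pf_inj _ _ qE) !eqxx.
have [|D D0 Dfr] := @freef_open K 5 _ (fun u : (P * 'I_4) + (Jg + J') => match u with
    | inl (p, i) => @cst K 5 ('X_[gam p] * 'X_(w i))
    | inr (inl j) => V {poly K} 'X j | inr (inr j) => W {poly K} 'X j end) 0.
  apply: eq_freef (freef_monomials lead_inj) => -[[p i]|[j|j]] /=.
  - by rewrite spec_cst mpolyXD.
  - by rewrite specV /V (move_vec0 b _ (valP j)).
  - by rewrite specW /W mpartial0 // (valP j).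
have [t [t0 Dt _]] := common_nonroot charK (horner_neq0 D0) (horner_neq0 D0).
have {}Dfr : freef (fun u : (P * 'I_4) + (Jg + J') => match u with
    | inl (p, i) => 'X_[gam p] * 'X_(w i)
    | inr (inl j) => V K t j | inr (inr j) => W K t j end).
  by apply: eq_freef (Dfr _ Dt) => -[[p i]|[j|j]]; rewrite ?spec_cst ?specV ?specW.
have /choice[M MP] : forall j : Jg, exists ms, (linforms d.+1 ms && all on_hyper ms) /\
    V K t j = tvec (mpoint b t (ag (val j).1)) ms.
  move=> j; have [|||ms [msl msh E]] := @move_vec_dir 5 d.+1 b (fun j => j != ord_max) K charK
    on_hyper t _ _ (agd (val j).1) isT t0 (valP j).
  - by move=> k c km; rewrite on_hyperZ // on_hyperX.
  - by rewrite -(scale0r 'X_ord0) on_hyperZ // on_hyperX.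
  - by apply/allP/mpoint_hyper.
  by exists ms; rewrite msl; split=> //; apply/allP.
have /choice[C CP] : forall j : J', exists cs : seq K, size cs = d.+2 /\
    W K t j = tvec (mpoint b t (af (val j).1)) (consts 4 cs).
  move=> j; have [cs sz E] := dconst_mpartial b charK t0 (valP j).
  exists cs; split=> //; rewrite sz.
  by have := mpoint_linforms b t (af (val j).1); rewrite afd => /andP[/eqP].
have lin tau m e : mdeg m = e -> m ord_max = 0%N ->
    linforms e (mpoint b tau m) && all on_hyper (mpoint b tau m).
  by move=> <- m0; rewrite mpoint_linforms mpoint_hyper.
(* The points of [P] enter the trace only through their products with variables, so their monomials
   are left undeformed. *)
exists (fun p => mpoint b 0 (gam p)), (fun q => mpoint b t (ag q)), Jg, (fun j => (val j).1), M.
exists (fun q => mpoint b t (af q)), J', (fun j => (val j).1), C; split.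
- by move=> p; have [gd g0 _ _] := gamP p; apply: lin.
- split=> [q|j|]; first exact: lin.
    by have [] := MP j.
  rewrite card_sig -sum1_card big_mkcond /=.
  rewrite -(pair_bigA _ (fun q (x : move 5 d.+1) =>
    if valid_move (fun j => j != ord_max) (ag q) x then 1 else 0)%N) /=.
  rewrite (eq_bigr (fun=> 1 + 3 * d.+1)%N) => [|q _].
    by rewrite sum_nat_const addnC [(3 * _)%N]mulnC.
  rewrite -big_mkcond sum1_card card_moves //.
    by rewrite (cardC1 (ord_max : 'I_5)) card_ord.
  by move=> a; apply: contraTneq => ->; rewrite ag0.
- split=> [q|j|]; first exact: lin.
    by have [] := CP j.
  rewrite card_sig -sum1_card big_mkcond /=.
  rewrite -(pair_bigA _ (fun q (x : 'I_5 * 'I_d.+2) => if (x.2 < af q x.1)%N then 1 else 0)%N) /=.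
  rewrite (eq_bigr (fun=> d.+2)) ?sum_nat_const // => q _.
  by rewrite -big_mkcond sum1_card card_partials.
- have none q : valid_move (fun j => j != ord_max) (ag (q, @None _ : move 5 d.+1).1)
    (q, @None _ : move 5 d.+1).2 by [].
  pose k q : (P * 'I_4) + (Jg + J') := inr (inl (Sub (q, None) (none q))).
  have k_inj : injective k by move=> q q' [].
  by apply: eq_freef (freef_inj k_inj Dfr) => q.
apply: eq_freef Dfr => -[[p i]|[j|j]].
- by rewrite mpoint0.
- by have [_ ->] := MP j.
- by have [_ ->] := CP j.
Qed.

End Trace.

(** * Counting points in five variables *)

Local Open Scope nat_scope.

Lemma weight_class d s : 4 <= d -> 4 * s < 'C(d.-1, 3) ->
  exists v (gam : 'I_s.+1 -> 'X_{1..5}), [/\ injective gam,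
    forall p, weight (gam p) = v %[mod 4] &
    forall p, [/\ mdeg (gam p) = d, gam p ord_max = 0, 1 < gam p (inord 1) & 1 < gam p (inord 3)]].
Proof.
move=> d4 sC; pose T : finType := {t : 4.-tuple 'I_(d - 4).+1 | \sum_(i <- t) i == d - 4}.
(* Two units are reserved for each of [x_1] and [x_3]; degree [d - 4] is distributed over four
   variables. *)
pose g (t : T) : 'X_{1..5} := [multinom nth 0 (map (@nat_of_ord _) (val t)) x + (odd x).*2 | x < 5].
have gE t (x : 'I_5) : g t x = nth 0 (map (@nat_of_ord _) (val t)) x + (odd x).*2.
  by rewrite mnmE.
have g_inj : injective g.
  move=> t t' E; apply/val_inj/val_inj/(inj_map (@ord_inj _))/(@eq_from_nth _ 0).
    by rewrite !size_map !size_tuple.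
  move=> i; rewrite size_map size_tuple => i4.
  have := congr1 (fun m : 'X_{1..5} => m (inord i)) E.
  by rewrite !gE inordK; [move/addIn | apply: leq_trans i4 _].
have cT : #|T| = 'C(d.-1, 3).
  rewrite card_sig (_ : d.-1 = d - 4 + 3); last by lia.
  by rewrite addnC -(card_ord_partitions 3); apply: eq_card => t; rewrite !inE.
have [||v [f [f_inj fv]]] := @pigeonhole T (fun t => weight (g t) %% 4) 4 s.
- by move=> t; rewrite ltn_mod.
- by rewrite cT.
exists v, (fun p => g (f p)); split; first by move=> p q /g_inj/f_inj.
  by move=> p; rewrite fv -(fv p) modn_mod.
move=> p; set t := f p; pose x e := nth 0 (map (@nat_of_ord _) (val t)) e.
have x4 : x 4 = 0 by rewrite /x nth_default // size_map size_tuple.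
have sx : \sum_(e < 4) x e = d - 4.
  rewrite -[RHS](eqP (valP t)) big_tuple; apply: eq_bigr => e _.
  by rewrite /x (nth_map ord0) ?size_tuple // -tnth_nth.
split.
- rewrite mdegE (eq_bigr (fun e : 'I_5 => x e + (odd e).*2)) => [|e _]; last exact: gE.
  by rewrite big_split big_ord_recr /= sx x4 !big_ord_recr big_ord0 /=; lia.
- by rewrite gE /= -/(x 4) x4.
- by rewrite gE inordK //= addn2.
by rewrite gE inordK //= addn2.
Qed.

(** For [d > 4], the number of [p <= d] congruent to [3 d + 2] modulo 5. The slope 3 matches the
    shift by 3 from degree [d + 1] to [d + 2] in [trace4]. *)
Definition gcount d := ((d - (3 * d + 2) %% 5) %/ 5).+1.

Lemma gcount_index d : 4 < d -> exists pg : 'I_(gcount d) -> nat, injective pg /\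
  forall q, pg q <= d /\ pg q = 3 * d + 2 %[mod 5].
Proof.
move=> d5; exists (fun q => (3 * d + 2) %% 5 + 5 * q); split.
  by move=> q q' /addnI/eqP; rewrite eqn_pmul2l // => /eqP/ord_inj.
move=> q; split; last by rewrite [5 * _]mulnC addnC modnMDl modn_mod.
by have := ltn_ord q; rewrite ltnS; move: (nat_of_ord q) => k; lia.
Qed.

(* The number of points found in degree [k + 4]. *)
Fixpoint pcount k := if k is k'.+1 then pcount k' + gcount (k' + 5) else 0.

Lemma pcount5 k : pcount k.+4.+1 = pcount k + k + 8.
Proof.
by rewrite /= /gcount; move: (pcount k) => c; lia.
Qed.

(** Lets [weight_class] in degree [k + 4] accommodate all earlier points. *)
Lemma pcount_upper k : 4 * pcount k < 'C(k + 3, 3) + 4.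
Proof.
elim/ltn_ind: k => -[|[|[|[|[|k]]]]] IHk //.
have /IHk : k < k.+4.+1 by lia.
rewrite pcount5 !addn3 !binS !bin1 !bin0; move: (pcount k) 'C(k, 3) 'C(k, 2) => u v x; lia.
Qed.

(** With [d = k + 6], it gives [s <= pcount (d - 4)] whenever [12 s <= d ^ 2]; 11 absorbs the
    rounding. *)
Lemma pcount_lower k : (k + 6) ^ 2 <= 12 * pcount (k + 2) + 11.
Proof.
elim/ltn_ind: k => -[|[|[|[|[|k]]]]] IHk //.
have /IHk : k < k.+4.+1 by lia.
by rewrite !addn2 pcount5 /= -addn2; move: (pcount _) => u; lia.
Qed.

Section Recursion.
Variable K : fieldType.
Hypothesis charK : ([pchar K] =i pred0)%R.

Lemma gcount_subindex d g : 4 < d -> g <= gcount d -> exists pg : 'I_g -> nat,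
  injective pg /\ forall q, pg q <= d /\ pg q = 3 * d + 2 %[mod 5].
Proof.
move=> d5 gd; have [pg [pg_inj pgP]] := gcount_index d5.
by exists (fun q => pg (widen_ord gd q)); split=> // q q' /pg_inj/(congr1 val)/= /ord_inj.
Qed.

(** The [g] products announced here in degree [k + 5] become the new points of the next step;
    inequalities allow for any smaller number of points. *)
Lemma horace_pcount k a g : a <= pcount k -> g <= gcount (k + 5) ->
  exists P : finType, #|P| = a /\ horace K 4 (k + 4) P 'I_g.
Proof.
elim: k a g => [|k IHk] a g ak gk.
  have [pf [pf_inj pfP]] := @gcount_subindex 5 g isT gk.
  have tr : trace K 4 3 void void 'I_g.
    (* Degree 3 holds no points; [r = 4] makes [r + 3] congruent to [3 * 5 + 2] modulo 5. *)
    apply: (trace4 charK (gam := of_void _) (pg := of_void _) (pf := pf) (r := 4) (v := 0)) => //.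
  have h3 : horace K 4 3 void void.
    exists (of_void _), void, (of_void _), (of_void _), (of_void _), void, (of_void _), (of_void _).
    by split; [split | split | move=> c _ [] | move=> c _ [[]|[]]]; rewrite ?card_void //; case.
  exists (void + void)%type; split; first by rewrite card_sum card_void; move: ak => /=; lia.
  exact: horace_step h3 tr.
(* As many points as possible come from the lower degree, the rest are put on the hyperplane. *)
pose a' := minn a (pcount k).
have a'k : a' <= pcount k by rewrite geq_minr.
have a''k : a - a' <= gcount (k + 5) by move: ak; rewrite /a' /=; lia.
have [P [cP hP]] := IHk a' (a - a') a'k a''k.
have [pg [pg_inj pgP]] := gcount_subindex (ltn_addl k (leqnn 5)) a''k.
have k6 : k.+1 + 5 = k + 6 by lia.
rewrite k6 in gk; have [pf [pf_inj pfP]] := gcount_subindex (ltn_addl k (leqnSn 5)) gk.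
exists (P + 'I_(a - a'))%type; split; first by rewrite card_sum cP card_ord subnKC // geq_minl.
have -> : k.+1 + 4 = (k + 4).+1 by lia.
apply: horace_step hP _ => //.
have [v [gam [gam_inj gamw gamP]]] : exists v (gam : P -> 'X_{1..5}), [/\ injective gam,
    forall p, weight (gam p) = v %[mod 4] & forall p, [/\ mdeg (gam p) = k + 4,
      gam p ord_max = 0, 1 < gam p (inord 1) & 1 < gam p (inord 3)]].
  case E : a' => [|c].
    have no (p : P) : False by have := fintype0 p; rewrite cP E => /(_ erefl).
    by exists 0, (fun p => match no p with end); split=> p; case: (no p).
  have [||v [gam [gam_inj gamw gamP]]] := @weight_class (k + 4) c; first by lia.
    by have := pcount_upper k; rewrite (_ : (k + 4).-1 = k + 3); lia.
  have cE : #|P| = c.+1 by rewrite cP.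
  exists v, (fun p => gam (cast_ord cE (enum_rank p))); split=> // p q.
  by move=> /gam_inj/cast_ord_inj/enum_rank_inj.
apply: (trace4 charK (r := 3 * (k + 5) + 2)) gam_inj gamw gamP pg_inj _ pf_inj _ => [q|q].
  by have := pgP q; rewrite (_ : k + 5 = (k + 4).+1) //; lia.
have [p1 p2] := pfP q; split; first by move: p1; lia.
by rewrite p2; congr (_ %% _); lia.
Qed.

Lemma horace_config d (P R : finType) : horace K 4 d P R -> indep_config K 4 d #|P|.
Proof.
case=> L [J [pt [M [F [J' [pt' [C [[Ll Ml cJ] _ fr1 fr2]]]]]]]].
exists (L \o enum_val), J, (enum_rank \o pt), M; split=> //.
- by move=> p; apply: Ll.
- exact: (freef_inj enum_val_inj fr1).
apply: eq_freef (freef_inj (@inl_inj J J') fr2) => j /=.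
by rewrite enum_rankK.
Qed.

Lemma quaternary_config d s : 5 < d -> 12 * s <= d ^ 2 -> indep_config K 4 d s.
Proof.
move=> d6 sd; have := pcount_lower (d - 6); rewrite subnK // => pl.
have [|P [<- hP]] := @horace_pcount (d - 4) s 0 _ (leq0n _).
  by rewrite (_ : d - 4 = d - 6 + 2); lia.
by rewrite subnK ?(leq_trans _ d6) // in hP; apply: (horace_config hP).
Qed.

End Recursion.

(** * Numerical bounds *)

Local Open Scope ring_scope.

Lemma c_fun_le n d m : (m < n.-1)%N -> c_fun n d <= c_term n d m.
Proof. by move=> mn; rewrite /c_fun big_mkord (bigmin_le _ (Ordinal mn)). Qed.

(** One bound for all residues: multiplied by 24, the largest branch is [x ^ 2 + 4 x + 3]. *)
Lemma s_tilde_le x : 24 * s_tilde x <= ((x + 2) ^ 2)%:R.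
Proof.
have x0 : 0 <= x%:R :> rat by apply: ler0n.
rewrite natrX natrD /s_tilde; move: x0; move: (x%:R : rat) => y y0.
by case: (x %% 6)%N => [|[|[|[|[|k]]]]] /=; lra.
Qed.

Lemma c_fun_bound n d s : (0 < s)%N -> s%:Z <= 2 ^+ (n - 3) * c_fun n d ->
  exists c : nat, [/\ (0 < c)%N, (s <= 2 ^ (n - 3) * c)%N &
    forall m, (m < n.-1)%N -> (24 * c * g_fun n m <= (d - m + 2) ^ 2)%N].
Proof.
move=> s0 sc; have c0 : 0 < c_fun n d.
  rewrite -(pmulr_rgt0 _ (exprn_gt0 (n - 3) (isT : 0 < 2 :> int))).
  by apply: lt_le_trans sc; rewrite ltz_nat.
have [c cE] : exists c : nat, c_fun n d = c%:Z.
  by exists `|c_fun n d|%N; rewrite gez0_abs // ltW.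
rewrite cE in sc c0; exists c; split.
- by move: c0; rewrite ltz_nat.
- have pE : 2 ^+ (n - 3) = (2 ^ (n - 3))%N%:Z by rewrite -natz natrX.
  by move: sc; rewrite pE -PoszM lez_nat.
move=> m mn; have [->|g0] := posnP (g_fun n m); first by rewrite muln0.
have := c_fun_le d mn; rewrite cE /c_term floor_ge_int ler_pdivlMr ?ltr0n // => le.
have gE : (24 * c * g_fun n m)%N%:R = 24 * (c%:R * (g_fun n m)%:R) :> rat.
  by rewrite -mulnA !natrM.
by rewrite -(ler_nat rat) gE; apply: le_trans (s_tilde_le (d - m)); rewrite ler_pM2l.
Qed.

Local Open Scope nat_scope.

(** * Growth of binomial coefficients *)

Lemma bin3_6 x : 'C(x + 3, 3) * 6 = (x + 3) * (x + 2) * (x + 1).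
Proof. by rewrite (bin_ffact _ 3) addn3 !ffactSS ffactn0; lia. Qed.

Lemma bin4_24 x : 'C(x + 5, 4) * 24 = (x + 5) * (x + 4) * (x + 3) * (x + 2).
Proof.
rewrite (bin_ffact _ 4) (_ : x + 5 = x.+4.+1); last by lia.
by rewrite !ffactSS ffactn0; lia.
Qed.

(** The step of [binomial_growth] with [a = k + 2], once the binomial coefficients have
    cancelled. *)
Lemma quadratic_step a X : 24 * a.+2 ^ 2 <= X ^ 2 ->
  8 * a.+1 * (X + a) <= (X + 2 * a + 3) * (X + 2 * a + 2).
Proof.
(* [97 / 20] is slightly below the square root of 24. *)
move=> h; have t : 97 * a.+2 <= 20 * X.
  by rewrite -leq_sqr !expnMn; move: h; lia.
have [u uE] : exists u, 20 * X = 97 * a.+2 + u by exists (20 * X - 97 * a.+2); lia.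
rewrite -(leq_pmul2l (isT : 0 < 400)).
have -> : 400 * (8 * a.+1 * (X + a)) = 20 * (8 * a.+1 * (20 * X + 20 * a)) by lia.
have -> : 400 * ((X + 2 * a + 3) * (X + 2 * a + 2)) =
  (20 * X + 40 * a + 60) * (20 * X + 40 * a + 40) by lia.
rewrite uE; nia.
Qed.

(** Here [N = k + 5] is the number of pairs and [X = d - m + 2]: classes times demand against the
    number of exponents. A step adds one pair and two variables, hence the factor 8. *)
Lemma binomial_growth k X : 24 * (k + 3) ^ 2 <= X ^ 2 ->
  2 ^ (3 * k + 12) * X ^ 2 <= 24 * ((k + 4) * (k + 3)) * 'C(X + 2 * k + 5, k + 4).
Proof.
elim: k => [|k IHk] h.
  have X15 : 15 <= X.
    rewrite leqNgt; apply/negP => X14.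
    by have : X ^ 2 <= 14 ^ 2; [rewrite leq_sqr; lia | lia].
  have := bin4_24 X; rewrite !add0n !addn0 => E.
  have -> : 24 * (4 * 3) * 'C(X + 5, 4) = 12 * ((X + 5) * (X + 4) * (X + 3) * (X + 2)) by lia.
  have [y ->] : exists y, X = 15 + y by exists (X - 15); lia.
  rewrite (_ : 2 ^ (3 * 0 + 12) = 4096) //; nia.
have {}IHk : 2 ^ (3 * k + 12) * X ^ 2 <= 24 * ((k + 4) * (k + 3)) * 'C(X + 2 * k + 5, k + 4).
  by apply: IHk; apply: leq_trans h; rewrite leq_pmul2l // leq_sqr; lia.
have q := @quadratic_step (k + 2) X; rewrite (_ : (k + 2).+2 = k.+1 + 3) in q; last by lia.
move/q: h => {}q.
have d1 := mul_bin_diag (X + 2 * k + 6).+1 (k + 4).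
rewrite [_.+1.-1]/= in d1; have d2 := mul_bin_down (X + 2 * k + 6) (k + 4).
rewrite (_ : (X + 2 * k + 6).-1 = X + 2 * k + 5) in d2; last by lia.
rewrite (_ : X + 2 * k + 6 - (k + 4) = X + (k + 2)) in d2; last by lia.
have -> : X + 2 * k.+1 + 5 = (X + 2 * k + 6).+1 by lia.
have -> : k.+1 + 4 = (k + 4).+1 by lia.
have -> : 2 ^ (3 * k.+1 + 12) = 8 * 2 ^ (3 * k + 12).
  by rewrite (_ : 3 * k.+1 + 12 = 3 + (3 * k + 12)) ?expnD //; lia.
move: IHk d1 d2 q; move: (2 ^ (3 * k + 12)) 'C(X + 2 * k + 5, k + 4) 'C(X + 2 * k + 6, k + 4)
  'C((X + 2 * k + 6).+1, (k + 4).+1) => P C0 C1 C2 IHk d1 d2 q.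
have key : 8 * (k + 3) * C0 <= (k + 4).+1 * C2.
  rewrite -(leq_pmul2l (_ : 0 < X + (k + 2))); last by lia.
  rewrite -d1.
  have -> : (X + (k + 2)) * ((X + 2 * k + 6).+1 * C1) =
    (X + 2 * k + 6).+1 * ((X + (k + 2)) * C1) by lia.
  rewrite -d2.
  have -> : (X + (k + 2)) * (8 * (k + 3) * C0) = 8 * (k + 2).+1 * (X + (k + 2)) * C0 by lia.
  have -> : (X + 2 * k + 6).+1 * ((X + 2 * k + 6) * C0) =
     (X + 2 * (k + 2) + 3) * (X + 2 * (k + 2) + 2) * C0 by lia.
  by rewrite leq_mul2r q orbT.
rewrite -mulnA; apply: leq_trans (_ : 8 * (24 * ((k + 4) * (k + 3)) * C0) <= _).
  by rewrite leq_mul2l IHk.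
have -> : 8 * (24 * ((k + 4) * (k + 3)) * C0) = 24 * (k + 4) * (8 * (k + 3) * C0) by lia.
have -> : 24 * ((k + 4).+1 * (k.+1 + 3)) * C2 = 24 * (k + 4) * ((k + 4).+1 * C2) by lia.
by rewrite leq_mul2l key orbT.
Qed.

(** * Case distinction on [n] *)

Section Cases.
Variables (K : fieldType) (d s c : nat).
Hypothesis charK : ([pchar K] =i pred0)%R.
Hypotheses (s0 : 0 < s) (c0 : 0 < c).

Lemma pairs_config_leq n N (twist : bool) :
  1 < N -> N.*2 <= n.+1 -> 0 < d -> (twist -> 2 < N <= d) ->
  (2 ^ N).-1 * s <= 'C(d + N.-1, N.-1) + (if twist then 'C(d - N + N.-1, N.-1) else 0) ->
  indep_config K n d s.
Proof.
move=> N2 Nn d0 tw le; rewrite -(prednK s0); apply: (pairs_config charK N2 Nn d0 tw).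
apply: leq_trans le; rewrite ltn_pmul2l ?prednK //.
by rewrite -ltnS prednK ?expn_gt0 // (ltn_exp2l 0 N (isT : 1 < 2)) ltnW.
Qed.

Lemma bin2_sum_twist : 2 < d -> 'C(d + 2, 2) + 'C(d - 3 + 2, 2) = d ^ 2 + 2.
Proof.
move=> d3; have [e ->] : exists e, d = e + 3 by exists (d - 3); lia.
rewrite addnK (_ : e + 3 + 2 = e.+4.+1) ?addn2; last by lia.
have := bin_ffact e.+4.+1 2; have := bin_ffact e.+2 2; rewrite !ffactSS !ffactn0.
by rewrite (_ : 2`! = 2) //; lia.
Qed.

(** Three pairs without [twist] give about [d ^ 2 / 14] points, but [n = 5] and [n = 6] ask for
    about [d ^ 2 / 12] and [d ^ 2 / 9]; [twist] doubles the count. *)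
Lemma config3 n : 4 < n -> 2 < d -> 7 * s <= d ^ 2 + 2 -> indep_config K n d s.
Proof.
move=> n5 d3 le; apply: (@pairs_config_leq n 3 true) => //; first by lia.
by have := bin2_sum_twist d3 => /= ->.
Qed.

Lemma config4 n : 6 < n -> 0 < d -> 15 * s * 6 <= (d + 3) * (d + 2) * (d + 1) ->
  indep_config K n d s.
Proof.
move=> n7 d1 le; apply: (@pairs_config_leq n 4 false) => //.
by rewrite addn0 (_ : 4.-1 = 3) // -(leq_pmul2r (isT : 0 < 6)) bin3_6.
Qed.

(** All [N = (n + 1) / 2] pairs are used, and [m = N - 2] maximizes the divisor [m (n - m - 3)] in
    the bound on [c]. *)
Lemma config_large n : 8 < n -> n <= d -> s <= 2 ^ (n - 3) * c ->
  24 * c * g_fun n ((n.+1)./2 - 2) <= (d - ((n.+1)./2 - 2) + 2) ^ 2 -> indep_config K n d s.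
Proof.
move=> n9 nd sc gc.
have [k kE] : exists k, (n.+1)./2 = k + 5.
  by exists ((n.+1)./2 - 5); have := odd_double_half n.+1; lia.
rewrite kE in gc; have kn := odd_double_half n.+1; rewrite kE in kn.
rewrite (_ : k + 5 - 2 = k + 3) in gc; last by lia.
pose X := d - (k + 3) + 2; rewrite -/X in gc.
have gE : g_fun n (k + 3) = (k + 3) * (if odd n.+1 then k + 4 else k + 3).
  rewrite /g_fun; do 3! (rewrite ifF; last by lia).
  by congr (_ * _); case: ifP kn => _ /= kn; lia.
rewrite gE in gc.
(* Both parities of [n] lead to one inequality; for odd [n] the missing factor 2 is traded for
   [k + 4 <= 2 (k + 3)]. *)
have sX : 24 * ((k + 4) * (k + 3)) * s <= 2 ^ (2 * k + 7) * X ^ 2.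
  case: ifP kn gc => _ kn gc.
    apply: leq_trans (_ : 24 * ((k + 4) * (k + 3)) * (2 ^ (2 * k + 7) * c) <= _).
      by rewrite leq_mul2l (_ : 2 * k + 7 = n - 3) ?sc ?orbT //; lia.
    rewrite mulnCA leq_mul2l; apply/orP; right; apply: leq_trans gc.
    by rewrite mulnAC [(k + 4) * _]mulnC.
  apply: leq_trans (_ : 24 * (2 * (k + 3) * (k + 3)) * (2 ^ (2 * k + 6) * c) <= _).
    apply: leq_mul; first by rewrite leq_mul2l leq_mul2r; lia.
    by rewrite (_ : 2 * k + 6 = n - 3) //; lia.
  have -> : 2 ^ (2 * k + 7) = 2 * 2 ^ (2 * k + 6).
    by rewrite (_ : 2 * k + 7 = (2 * k + 6).+1) ?expnS //; lia.
  have -> : 24 * (2 * (k + 3) * (k + 3)) * (2 ^ (2 * k + 6) * c) =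
    2 * 2 ^ (2 * k + 6) * (24 * c * ((k + 3) * (k + 3))) by move: (2 ^ _) => u; lia.
  by rewrite leq_mul2l gc orbT.
have Xk : 24 * (k + 3) ^ 2 <= X ^ 2.
  apply: leq_trans gc; rewrite -mulnA leq_mul2l /=.
  apply: leq_trans (leq_pmull _ c0); rewrite expnS expn1 leq_mul2l.
  by case: ifP; lia.
have dE : d + (k + 5).-1 = X + 2 * k + 5 by rewrite /X; lia.
apply: (@pairs_config_leq n (k + 5) false) => //; [by lia | by lia | by lia | ].
rewrite addn0 dE (_ : (k + 5).-1 = k + 4); last by lia.
apply: leq_trans (_ : 2 ^ (k + 5) * s <= _); first by rewrite leq_mul2r leq_pred orbT.
rewrite -(leq_pmul2l (_ : 0 < 24 * ((k + 4) * (k + 3)))); last by lia.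
apply: leq_trans (binomial_growth Xk).
rewrite mulnCA (_ : 3 * k + 12 = (k + 5) + (2 * k + 7)); last by lia.
by rewrite [2 ^ (_ + (_ + 7))]expnD -[X in _ <= X]mulnA leq_mul2l sX orbT.
Qed.

Lemma secant_config n : 3 < n -> n <= d -> s <= 2 ^ (n - 3) * c ->
  (forall m, m < n.-1 -> 24 * c * g_fun n m <= (d - m + 2) ^ 2) -> indep_config K n d s.
Proof.
move=> n4 nd sc B.
have [n9|n8] := ltnP 8 n.
  apply: config_large => //; apply: B.
  by have := odd_double_half n.+1; case: odd; lia.
have : n = 4 \/ n = 5 \/ n = 6 \/ n = 7 \/ n = 8 by lia.
case=> [|[|[|[|]]]] nE; subst n.
- have := B 2 isT; rewrite /g_fun /= muln1 (_ : d - 2 + 2 = d); last by lia.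
  move: sc; rewrite (_ : 2 ^ (4 - 3) = 2) // => sc cd.
  have [d6|d5] := ltnP 5 d; first by apply: quaternary_config => //; lia.
  (* Positivity of [c] leaves only [d = 5], [c = 1] and [s <= 2]. *)
  apply: (@pairs_config_leq 4 2 false) => //; first by lia.
  rewrite /= bin1.
  have : d = 4 \/ d = 5 by lia.
  by case=> dE; subst d; move: cd; rewrite [X in _ <= X]/=; lia.
- have := B 2 isT; rewrite /g_fun /= (_ : d - 2 + 2 = d); last by lia.
  move: sc; rewrite (_ : 2 ^ (5 - 3) = 4) // => sc cd.
  by apply: config3 => //; lia.
- have := B 3 isT; rewrite /g_fun /= (_ : d - 3 + 2 = d - 1); last by lia.
  move: sc; rewrite (_ : 2 ^ (6 - 3) = 8) // => sc cd.
  have : (d - 1) ^ 2 <= d ^ 2 by rewrite leq_sqr leq_subr.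
  by move=> le; apply: config3 => //; lia.
- have := B 4 isT; rewrite /g_fun /=.
  have [e dE] : exists e, d = e + 4 by exists (d - 4); lia.
  rewrite {1}dE addnK; move: sc; rewrite (_ : 2 ^ (7 - 3) = 16) // => sc cd.
  (* [c >= 1] gives [96 <= (e + 2) ^ 2]; from [e = 8] on the cubic count exceeds the quadratic
     demand. *)
  have e8 : 8 <= e.
    rewrite leqNgt; apply/negP => e7.
    by have : (e + 2) ^ 2 <= 9 ^ 2; [rewrite leq_sqr; lia | lia].
  apply: config4 => //; first by lia.
  have [u uE] : exists u, e = 8 + u by exists (e - 8); lia.
  by rewrite dE uE; rewrite uE in cd; nia.
have := B 3 isT; rewrite /g_fun /=.
have [e dE] : exists e, d = e + 3 by exists (d - 3); lia.
rewrite {1}dE addnK; move: sc; rewrite (_ : 2 ^ (8 - 3) = 32) // => sc cd.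
have e10 : 10 <= e.
  rewrite leqNgt; apply/negP => e9.
  by have : (e + 2) ^ 2 <= 11 ^ 2; [rewrite leq_sqr; lia | lia].
apply: config4 => //; first by lia.
have [u uE] : exists u, e = 10 + u by exists (e - 10); lia.
by rewrite dE uE; rewrite uE in cd; nia.
Qed.

End Cases.

Local Open Scope ring_scope.

Theorem theorem1p1p6 (K : closedFieldType) (charK : [pchar K] =i pred0)
    (n d s : nat) (hn : (4 <= n)%N) (hd : (n <= d)%N) (hs : (0 < s)%N)
    (hsc : s%:Z <= 2 ^+ (n - 3) * c_fun n d) :
  nondefective K n d s.
Proof.
have [c [c0 sc cB]] := c_fun_bound hs hsc.
have : indep_config K n d s by apply: secant_config sc cB.
case: d hd {cB hsc} => [|d _]; first by lia.
exact: indep_config_nondefective.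
Qed.
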